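(* Let $G$ be a locally compact, compactly generated group, and let $K$ be a centered probability density on $G$ such that $K$ is compactly supported, bounded, and $\inf\{K(g):g\in W\}>0$ for some relatively compact, open and symmetric neighborhood $W$ of the identity $e$ of $G$ which generates $G$. Let $Tf=K*f$. Then the following statements hold. (I) There is $c>0$ such that $|((I-T)f_1,f_2)|\le c\,\Gamma_\infty(f_1)\Gamma_1(f_2)$ for all $f_1\in L^\infty$ and $f_2\in L^1$. (II) There is $\omega>0$ such that $\|e^{\lambda\psi}T^ne^{-\lambda\psi}\|_{2\to2}\le e^{\omega\lambda^2n}$ for all $n\in\mathbb{N}$, $\lambda\in\mathbb{R}$, $\psi\in\mathcal{E}$. For each $p\in(1,\infty)$ there exist $c=c(p)$, $b=b(p)>0$ such that $\|\chi_ET^n\chi_F\|_{p\to p}\le c\,e^{-b\,d(E,F)^2/n}$ for all $n\in\mathbb{N}$ and all Borel sets $E,F\subseteq G$. (III) There are $c,b>0$ such that $K^{(n)}(g)\le c\,\Delta(g)^{-1/2}e^{-b\rho(g)^2/n}$ for all $n\in\mathbb{N}$ and $g\in G$.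
   Context: $\mathbb{N}=\{1,2,3,\dots\}$; $dg$ is a left Haar measure on $G$ and $\Delta:G\to(0,\infty)$ is the modular function, normalized so that $d(g^{-1})=\Delta(g^{-1})dg$ is a right Haar measure; $L^p=L^p(G;dg)$ (complex-valued); $(f_1,f_2)=\int_G dg\,f_1\overline{f_2}$; $\|\cdot\|_{p\to q}$ is the norm of bounded operators $L^p\to L^q$. Convolution: $(f_1*f_2)(g)=\int_G dh\,f_1(h)f_2(h^{-1}g)$; $K^{(n)}=K*\cdots*K$ ($n$ factors). A probability density on $G$ is a Borel measurable $K:G\to[0,\infty)$ with $\int_G dg\,K(g)=1$. Distance: fix a relatively compact, open, symmetric ($U=U^{-1}$) neighborhood $U$ of $e$ which generates $G$, and set $\rho(g)=\inf\{n\in\mathbb{N}: g\in U^n\}$, where $U^n=\{g_1\cdots g_n: g_i\in U\}$. $d(E,F)=\inf\{\rho(gh^{-1}):g\in E,h\in F\}$ (with $d(E,F)=+\infty$ and $e^{-b\,d(E,F)^2/n}=0$ if $E$ or $F$ is empty). $\chi_E$ is the characteristic function of $E$, and also the operator of multiplication by it. $(L(g)f)(h)=f(g^{-1}h)$, $\partial_g=L(g)-I$, $\Gamma_p(f)=\sup_{u\in U}\|\partial_uf\|_p$. $\mathcal{E}$ is the class of all locally bounded Borel measurable $\psi:G\to\mathbb{R}$ (not assumed bounded) with $\Gamma_\infty(\psi)\le1$. $e^{\lambda\psi}T^ne^{-\lambda\psi}$ is the operator $f\mapsto e^{\lambda\psi}T^n(e^{-\lambda\psi}f)$, i.e. $g\mapsto\int_G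 dh\,K^{(n)}(h)e^{\lambda(\psi(g)-\psi(h^{-1}g))}f(h^{-1}g)$. Centered: let $G_0=\overline{[G,G]}$ be the closure of the commutator subgroup, $\pi_0:G\to G/G_0$ the canonical homomorphism. $G/G_0$ is a compactly generated locally compact abelian group, so $G/G_0\cong\mathbb{R}^q\times\mathbb{Z}^r\times M$ with integers $q,r\ge0$ and $M$ a compact abelian group. Put $G_1=\pi_0^{-1}(\{0\}\times M)$, and let $\pi_1:G\to G/G_1\cong\mathbb{R}^q\times\mathbb{Z}^r$ have components $\pi_1^{(i)}$, $i\in\{1,\dots,q+r\}$ (real-valued for $i\le q$, integer-valued for $i>q$). $K$ is centered if $\int_G dg\,K(g)\pi_1^{(i)}(g)=0$ for all $i\in\{1,\dots,q+r\}$. *)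

(* Defs.v *)
From HB Require Import structures.
From mathcomp Require Import all_boot all_order all_algebra generic_quotient.
From mathcomp Require Import complex.
From mathcomp Require Import all_classical all_reals all_analysis.

Set Implicit Arguments.
Unset Strict Implicit.
Unset Printing Implicit Defensive.

Import Order.TTheory GRing.Theory Num.Theory.
Import numFieldNormedType.Exports.

Local Open Scope classical_set_scope.
Local Open Scope ring_scope.

HB.mixin Record isTopologicalGroup G of Topological G & Group G := {
  mulg_continuous : continuous (fun x : G * G => (x.1 * x.2)%g) ;
  invg_continuous : continuous (fun x : G => (x^-1)%g)
}.

#[short(type="topologicalGroupType")]
HB.structure Definition TopologicalGroup :=
  {G of Topological G & Group G & isTopologicalGroup G}.

(* Measurable types are pointed in the library; a group is pointed by 1. *)
Definition pointed_group (G : topologicalGroupType) : Type := G.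
HB.instance Definition _ (G : topologicalGroupType) :=
  Choice.on (pointed_group G).
HB.instance Definition _ (G : topologicalGroupType) :=
  isPointed.Build (pointed_group G) (1%g : G).

Definition borel (G : topologicalGroupType) : Type :=
  @g_sigma_algebraType (pointed_group G) (@open G).
HB.instance Definition _ (G : topologicalGroupType) :=
  Measurable.copy (borel G) (@g_sigma_algebraType (pointed_group G) (@open G)).

HB.instance Definition _ (T : zmodType) :=
  GRing.Zmodule.copy (discrete_topology T) T.

Section Generation.
Variable G : topologicalGroupType.
Implicit Types (S U H : set G) (x y g : G).

Definition is_subgroup H :=
  [/\ H 1%g, forall x y, H x -> H y -> H (x * y)%g
    & forall x, H x -> H (x^-1)%g].

Definition generated S : set G := smallest is_subgroup S.

Definition compactly_generated :=
  exists2 C : set G, compact C & generated C = [set: G].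

Definition generating_nbhd U :=
  [/\ precompact U, open U, U 1%g, (forall x, U x -> U (x^-1)%g)
    & generated U = [set: G]].

Fixpoint set_pow U (n : nat) : set G :=
  if n is m.+1 then [set (x * y)%g | x in U & y in set_pow U m] else [set 1%g].

End Generation.

Section Abelianization.
Variable G : topologicalGroupType.
Local Open Scope quotient_scope.

Definition closed_commutator : set G :=
  closure (generated [set [~ x, y]%g | x in [set: G] & y in [set: G]]).

Definition same_coset (x y : G) : bool :=
  `[< [set (x * k)%g | k in closed_commutator] =
      [set (y * k)%g | k in closed_commutator] >].

Lemma same_coset_refl : reflexive same_coset.
Proof. by move=> x; apply/asboolP. Qed.

Lemma same_coset_sym : symmetric same_coset.
Proof. by move=> x y; apply/asboolP/asboolP => ->. Qed.

Lemma same_coset_trans : transitive same_coset.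
Proof. by move=> y x z /asboolP xy /asboolP yz; apply/asboolP; rewrite xy. Qed.

Canonical same_coset_equiv :=
  EquivRel same_coset same_coset_refl same_coset_sym same_coset_trans.

Definition abelianization : topologicalType :=
  quotient_topology {eq_quot same_coset_equiv}.

Definition abelianization_proj (x : G) : abelianization :=
  \pi_({eq_quot same_coset_equiv}) x.

End Abelianization.

(* An isomorphism of topological groups G / G_0 ~ R^q x Z^r x M; the group law
   of G / G_0 is the one carried over from G by the projection. *)
Record splitting (R : realType) (G : topologicalGroupType) := Splitting {
  split_q : nat;
  split_r : nat;
  split_M : topologicalZmodType;
  split_M_compact : compact [set: split_M];
  split_map : abelianization G ->
    ('rV[R]_split_q * 'rV[discrete_topology int]_split_r * split_M)%type;
  split_inv :
    ('rV[R]_split_q * 'rV[discrete_topology int]_split_r * split_M)%type ->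
    abelianization G;
  split_mapK : cancel split_map split_inv;
  split_invK : cancel split_inv split_map;
  split_map_continuous : continuous split_map;
  split_inv_continuous : continuous split_inv;
  split_mapM : forall x y : G,
    split_map (abelianization_proj (x * y)%g) =
    split_map (abelianization_proj x) + split_map (abelianization_proj y)
}.

(* The component i of G -> G / G_1 ~ R^q x Z^r, where G_1 is the preimage of
   {0} x M: forgetting the factor M is the quotient by {0} x M. *)
Definition split_component (R : realType) (G : topologicalGroupType)
    (s : splitting R G) (i : 'I_(split_q s + split_r s)) (g : G) : R :=
  let z := split_map s (abelianization_proj g) in
  match fintype.split i with
  | inl j => z.1.1 ord0 j
  | inr j => ((z.1.2 ord0 j : int)%:~R)
  end.
Arguments split_component {R G} s i g.

Section HaarMeasure.
Variables (R : realType) (G : topologicalGroupType).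
Variable mu : {measure set (borel G) -> \bar R}.
Local Open Scope ereal_scope.

Definition left_haar_measure :=
  [/\ [/\ forall C : set G, compact C -> mu C < +oo,
          forall A : set G, measurable (A : set (borel G)) ->
            mu A =
            ereal_inf [set mu O | O in [set O : set G | open O /\ A `<=` O]]
        & forall O : set G, open O ->
            mu O =
            ereal_sup [set mu C | C in [set C : set G | compact C /\ C `<=` O]]],
      0 < mu [set: G]
    & forall (g : G) (A : set G), measurable (A : set (borel G)) ->
        mu [set (g * x)%g | x in A] = mu A].

(* The last clause says d(g^-1) = Delta(g^-1) dg. *)
Definition modular_function (Delta : G -> R) :=
  [/\ continuous Delta, forall g, (0 < Delta g)%R,
      forall g h : G, Delta (g * h)%g = (Delta g * Delta h)%R
    & forall A : set G, measurable (A : set (borel G)) ->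
        mu [set (x^-1)%g | x in A] =
        \int[mu]_(g in (A : set (borel G))) (Delta (g^-1)%g)%:E].

End HaarMeasure.

Section FunctionSpaces.
Variables (R : realType) (G : topologicalGroupType).
Variable mu : {measure set (borel G) -> \bar R}.
Local Notation C := (R[i]).
Implicit Types (f : G -> C) (p q : \bar R).

Definition cintegral (f : G -> C) : C :=
  Complex (\int[mu]_g complex.Re (f g)) (\int[mu]_g complex.Im (f g)).

Definition cpairing f1 f2 : C := cintegral (fun g => f1 g * (f2 g)^*)%C.

Definition cmeasurable f :=
  measurable_fun [set: borel G] (fun g => complex.Re (f g)) /\
  measurable_fun [set: borel G] (fun g => complex.Im (f g)).

Definition Lp_norm p f : \bar R :=
  Lnorm mu p (fun g : borel G => (Normc.normc (f g))%:E).

Definition in_Lp p f := cmeasurable f /\ (Lp_norm p f < +oo)%E.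

(* +oo when A is not a bounded operator from L^p to L^q. *)
Definition opnorm p q (A : (G -> C) -> (G -> C)) : \bar R :=
  ereal_inf [set M%:E | M in [set M : R | 0 <= M /\
    forall f, in_Lp p f ->
      in_Lp q (A f) /\ (Lp_norm q (A f) <= M%:E * Lp_norm p f)%E]].

Definition translate (u : G) f : G -> C := fun g => f (u^-1 * g)%g.

Definition difference (u : G) f : G -> C := translate u f \- f.

Definition Gamma (U : set G) p f : \bar R :=
  ereal_sup [set Lp_norm p (difference u f) | u in U].

Definition weight_class (U : set G) (psi : G -> R) :=
  [/\ [locally [bounded psi g | g in [set: G]]],
      measurable_fun [set: borel G] psi
    & (Gamma U +oo (fun g => (psi g)%:C%C) <= 1)%E].

Definition convolution (f1 f2 : G -> R) : G -> R :=
  fun g => \int[mu]_h (f1 h * f2 (h^-1 * g)%g).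

(* conv_power K n is K^(n) for n >= 1. *)
Definition conv_power (K : G -> R) (n : nat) : G -> R := iter n.-1 (convolution K) K.

Definition conv_op (K : G -> R) f : G -> C :=
  fun g => cintegral (fun h => (K h)%:C%C * f (h^-1 * g)%g).

Definition mult_op (a : G -> R) f : G -> C := fun g => (a g)%:C%C * f g.

Definition probability_density (K : G -> R) :=
  [/\ measurable_fun [set: borel G] K, forall g, 0 <= K g
    & (\int[mu]_g (K g)%:E = 1)%E].

(* Since +oo - oo = -oo in \bar R, a vanishing integral is a convergent one. *)
Definition centered (s : splitting R G) (K : G -> R) :=
  forall i, (\int[mu]_g (K g * split_component s i g)%:E = 0)%E.

End FunctionSpaces.

Section Distance.
Variables (R : realType) (G : topologicalGroupType) (U : set G).
Local Open Scope ereal_scope.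

Definition rho (g : G) : \bar R :=
  ereal_inf [set (n%:R)%:E | n in [set n | (0 < n)%N /\ set_pow U n g]].

Definition set_dist (E F : set G) : \bar R :=
  ereal_inf [set rho (g * h^-1)%g | g in E & h in F].

Definition gaussian (b : R) (n : nat) (d : \bar R) : \bar R :=
  expeR (- ((b / n%:R)%:E * (d * d))).

End Distance.

(* Main.v *)
(* Let nu = K dg, so that T f = int nu(dh) L(h) f.

   For phi in L^1 and psi Lipschitz, F(x) = int phi (L(x) psi - psi) is a
   homomorphism up to an error of order D = Gamma_1(phi) Gamma_oo(psi).  A map
   on G with small defect is small on commutators, hence on their closure G_0,
   and is bounded modulo G_0 on the compact part M; so F is within O(D) of a
   linear combination of the components of pi_1 on the support of K, and
   |int nu(dh) F(h)| and |int nu(dh) F(h^-1)| are O(D) because K is centered.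
   This is (I).

   For (II), e^(lambda psi) T e^(- lambda psi) f = int nu(dh) X_h and
     ||int nu X||^2 + 1/2 iint nu nu ||X_h - X_k||^2 = int nu ||X_h||^2.
   By Taylor's formula the right-hand side is (1 + O(lambda^2)) ||f||^2 plus the
   linear term 2 lambda int nu(dh) F(h^-1) with phi = f^2.  By the first step it
   is at most eps sup_U ||L(u) f - f||^2 + O(lambda^2) ||f||^2, and the lower
   bound on K makes the variance dominate the first summand.  Choosing psi as
   the distance to F and lambda proportional to d(E,F)/n gives the off-diagonal
   bound on L^2, and Jensen's or Hoelder's inequality for the positive operator
   T^n transfers it to L^p.

   For (III), K^(n+1)(g) = int K(g h) K^(n)(h^-1) dh; insert e^(lambda rho) and
   apply the Cauchy-Schwarz inequality and the weighted estimate of (II). *)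

From HB Require Import structures.
Require Import Defs.
From mathcomp Require Import all_boot all_order all_algebra.
From mathcomp Require Import complex.
From mathcomp Require Import ring lra.
From mathcomp Require Import all_classical all_reals all_analysis.
From mathcomp Require Import finmap measurable_realfun ess_sup_inf.

Set SsrOldRewriteGoalsOrder.
Set Implicit Arguments.
Unset Strict Implicit.
Unset Printing Implicit Defensive.

Import Order.TTheory GRing.Theory Num.Theory.
Import numFieldNormedType.Exports.

Local Open Scope classical_set_scope.
Local Open Scope ring_scope.

(** * Densities and iterated integrals *)

Section MeasureGeneralities.
Local Open Scope ereal_scope.

Import HBNNSimple.

(** The constant in the first step must not depend on F, whereas commutators, their limits and the
    factor M are reached by words whose length depends on the element. Hence a normalization: for
    maps with |F| <= 1 on U that vanish at lifts of the basis vectors, a property is eventual if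
    some d > 0 makes it true for all of them with defect at most d. Finitely many eventual
    properties can be combined, each fixed element turns out to carry eventually small values, and
    compactness of the closure of U then improves the bound 1 on U to 1/2. By homogeneity the
    supremum on U is at most a constant times the defect. The group need not be second countable, so
    Tonelli's theorem does not apply directly to functions of h^-1 g; these are exchanged for almost
    everywhere equal ones that are measurable on the product. Since K >= 0, averaging acts on
    functions with values in [0, +oo], where iteration needs no integrability; in (II) complex
    functions enter only through their modulus. Identities are arranged so that nothing infinite is
    subtracted. *)

Lemma le_measurable d (T : measurableType d) (R : realType)
    (mu : {measure set T -> \bar R}) (A B : set T) :
  measurable A -> measurable B -> A `<=` B -> mu A <= mu B.
Proof. by move=> mA mB AB; apply: le_measure => //; exact/mem_set. Qed.

(** Simple functions are finite nonnegative combinations of indicators, and every nonnegative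
    measurable function is an increasing limit of simple ones. *)
Lemma ge0_measurable_ind d (T : measurableType d) (R : realType)
    (P : (T -> \bar R) -> Prop) :
  (forall A, measurable A -> P (fun x => (\1_A x)%:E)) ->
  (forall f g : T -> \bar R, measurable_fun setT f -> measurable_fun setT g ->
     (forall x, 0 <= f x) -> (forall x, 0 <= g x) ->
     P f -> P g -> P (fun x => f x + g x)) ->
  (forall (k : R) (f : T -> \bar R), (0 <= k)%R -> measurable_fun setT f ->
     (forall x, 0 <= f x) -> P f -> P (fun x => k%:E * f x)) ->
  (forall F : nat -> T -> \bar R, (forall n, measurable_fun setT (F n)) ->
     (forall n x, 0 <= F n x) ->
     (forall x, {homo F^~ x : m n / (m <= n)%N >-> m <= n}) ->
     (forall n, P (F n)) -> P (fun x => limn (F^~ x))) ->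
  forall f : T -> \bar R, measurable_fun setT f -> (forall x, 0 <= f x) -> P f.
Proof.
move=> P1 PD PZ Plim f mf f0.
pose h := nnsfun_approx measurableT mf.
have Psim (g : {nnsfun T >-> R}) : P (fun x => (g x)%:E).
  have -> : (fun x => (g x)%:E) = (fun x =>
      \sum_(r <- fset_set (range g)) (r%:E * (\1_(g @^-1` [set r]) x)%:E)).
    apply/funext => x; rewrite fimfunE fsbig_finite//= -sumEFin.
    by apply: eq_bigr => r _; rewrite EFinM.
  suff sumP (s : seq R) : (forall r, r \in s -> (0 <= r)%R) ->
      P (fun x => \sum_(r <- s) (r%:E * (\1_(g @^-1` [set r]) x)%:E)).
    apply: sumP => r rg; have : r \in range g by rewrite -in_fset_set.
    by move=> /set_mem[t _ <-].
  elim: s => [|r s IH] s0.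
    under eq_fun do rewrite big_nil.
    have -> : (fun=> 0 : \bar R) = (fun x : T => (\1_(set0 : set T) x)%:E).
      by apply/funext => x; rewrite indic0.
    exact: P1.
  under eq_fun do rewrite big_cons.
  have r0 : (0 <= r)%R by apply: s0; rewrite inE eqxx.
  have ms q : measurable_fun setT (fun x => (\1_(g @^-1` [set q]) x : R)%:E).
    exact/measurable_EFinP/measurable_indic.
  apply: PD.
  - exact: measurable_funeM.
  - by apply: emeasurable_sum => q; apply: measurable_funeM.
  - by move=> x; rewrite mule_ge0// lee_fin.
  - move=> x; rewrite big_seq; apply: sume_ge0 => q qs.
    by rewrite mule_ge0// lee_fin// s0// inE qs orbT.
  - by apply: PZ => //; apply: P1.
  - by apply: IH => q qs; rewrite s0// inE qs orbT.
have -> : f = (fun x => limn (fun n => (h n x)%:E)).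
  apply/funext => x; apply/esym/cvg_lim => //.
  by apply: cvg_nnsfun_approx => // y _; exact: f0.
apply: Plim => //.
- by move=> n; apply/measurable_EFinP.
- by move=> n x; rewrite lee_fin.
- by move=> x m n mn; rewrite lee_fin; exact/lefP/nd_nnsfun_approx.
Qed.

(** No sign is assumed for [g]; it is nonnegative almost everywhere, so its positive part has the
    same integral. *)
Lemma ge0_ae_le_integral d (T : measurableType d) (R : realType)
    (mu : {measure set T -> \bar R}) (f g : T -> \bar R) :
  measurable_fun setT f -> measurable_fun setT g -> (forall x, 0 <= f x) ->
  {ae mu, forall x, f x <= g x} -> \int[mu]_x f x <= \int[mu]_x g x.
Proof.
move=> mf mg f0 fg; have mgp := measurable_funepos mg.
rewrite [leRHS](ae_eq_integral (g^\+)%E)//; last first.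
  by apply: filterS fg => x fgx _; rewrite funeposE max_l// (le_trans (f0 x)).
apply: ae_ge0_le_integral => //.
by apply: filterS fg => x fgx _; rewrite funeposE le_max fgx.
Qed.

(* The absolute value makes this a measure for every [w]. *)
Definition with_density d (T : measurableType d) (R : realType)
    (mu : {measure set T -> \bar R}) (w : T -> R) (A : set T) : \bar R :=
  \int[mu]_(x in A) `|w x|%:E.

Section with_density.
Context d (T : measurableType d) (R : realType).
Variables (mu : {measure set T -> \bar R}) (w : T -> R).

Hypothesis mw : measurable_fun setT w.
Local Notation nu := (with_density mu w).

Let mnw : measurable_fun setT (fun x => `|w x|%:E).
Proof. by apply/measurable_EFinP; apply: measurableT_comp. Qed.

Let nu0 : nu set0 = 0.
Proof. exact: integral_set0. Qed.

Let nu_ge0 A : 0 <= nu A.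
Proof. by apply: integral_ge0 => x _; rewrite lee_fin. Qed.

Let nu_sigma : semi_sigma_additive nu.
Proof. by apply: semi_sigma_additive_nng_induced => // x; rewrite lee_fin. Qed.

Definition density_measure_mixin := isMeasure.Build _ _ _ nu nu0 nu_ge0 nu_sigma.

Definition density_measure : {measure set T -> \bar R} :=
  HB.pack (with_density mu w) density_measure_mixin.

Lemma integral_density (f : T -> \bar R) : measurable_fun setT f ->
  (forall x, 0 <= f x) -> (forall x, (0 <= w x)%R) ->
  \int[density_measure]_x f x = \int[mu]_x ((w x)%:E * f x).
Proof.
move=> mf f0 w0; move: f mf f0.
have mw' : measurable_fun setT (fun x => (w x)%:E) by exact/measurable_EFinP.
apply: (@ge0_measurable_ind _ _ _ (fun f =>
  \int[density_measure]_x f x = \int[mu]_x ((w x)%:E * f x))).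
- move=> A mA; rewrite integral_indic// setIT/= /with_density.
  rewrite integral_mkcond/=; apply: eq_integral => x _.
  by rewrite patchE indicE; case: ifPn => _; rewrite ?mule0 ?mule1 ?ger0_norm.
- move=> f g mf mg f0 g0 Ef Eg; rewrite ge0_integralD//= Ef Eg.
  rewrite -ge0_integralD//=.
  + by apply: eq_integral => x _; rewrite ge0_muleDr.
  + by move=> x _; rewrite mule_ge0// lee_fin.
  + exact: emeasurable_funM.
  + by move=> x _; rewrite mule_ge0// lee_fin.
  + exact: emeasurable_funM.
- move=> k f k0 mf f0 Ef; rewrite ge0_integralZl_EFin// Ef -ge0_integralZl_EFin//.
  + by apply: eq_integral => x _; rewrite muleCA.
  + by move=> x _; rewrite mule_ge0// lee_fin.
  + exact: emeasurable_funM.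
- move=> F mF F0 hF EF; rewrite monotone_convergence//.
  under eq_fun do rewrite EF.
  rewrite -monotone_convergence//.
  + apply: eq_integral => x _; apply/cvg_lim => //; apply: cvgeZl => //.
    by apply: ereal_nondecreasing_is_cvgn; exact: hF.
  + by move=> n; exact: emeasurable_funM.
  + by move=> n x _; rewrite mule_ge0// lee_fin.
  + by move=> x _ m n mn; rewrite lee_wpmul2l// ?lee_fin//; exact: hF.
Qed.

End with_density.

Section sigma_finite_tonelli.
Context d1 d2 (T1 : measurableType d1) (T2 : measurableType d2) (R : realType).
Variables (m1 : {measure set T1 -> \bar R}) (m2 : {measure set T2 -> \bar R}).
Hypothesis s1 : sigma_finite setT m1.
Hypothesis s2 : sigma_finite setT m2.

Let m1' : {sigma_finite_measure set T1 -> \bar R} :=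
  HB.pack_for (SigmaFiniteMeasure.type T1 R) (Measure.sort m1)
    (isSFinite.Build _ T1 R m1 (sfinite_measure_sigma_finite s1))
    (isSigmaFinite.Build _ T1 R m1 s1).
Let m2' : {sigma_finite_measure set T2 -> \bar R} :=
  HB.pack_for (SigmaFiniteMeasure.type T2 R) (Measure.sort m2)
    (isSFinite.Build _ T2 R m2 (sfinite_measure_sigma_finite s2))
    (isSigmaFinite.Build _ T2 R m2 s2).

Variable f : T1 * T2 -> \bar R.

Lemma tonelli : measurable_fun setT f -> (forall z, 0 <= f z) ->
  \int[m1]_x \int[m2]_y f (x, y) = \int[m2]_y \int[m1]_x f (x, y).
Proof. by move=> mf f0; exact: (@fubini_tonelli _ _ _ _ _ m1' m2'). Qed.

Lemma measurable_tonelli1 : measurable_fun setT f -> (forall z, 0 <= f z) ->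
  measurable_fun setT (fun x => \int[m2]_y f (x, y)).
Proof.
by move=> mf f0; exact: (@measurable_fun_fubini_tonelli_F _ _ _ _ _ m2').
Qed.

Lemma measurable_tonelli2 : measurable_fun setT f -> (forall z, 0 <= f z) ->
  measurable_fun setT (fun y => \int[m1]_x f (x, y)).
Proof.
by move=> mf f0; exact: (@measurable_fun_fubini_tonelli_G _ _ _ _ _ m1').
Qed.

Lemma fubini_signed : measurable_fun setT f ->
  \int[m1]_x \int[m2]_y `|f (x, y)| < +oo ->
  \int[m1]_x \int[m2]_y f (x, y) = \int[m2]_y \int[m1]_x f (x, y).
Proof.
by move=> mf foo; apply: (@Fubini _ _ _ _ _ m1' m2'); exact/integrable12ltyP.
Qed.

End sigma_finite_tonelli.

End MeasureGeneralities.

(** * Topological groups *)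

(** Compactness is used in its near-covering form, for the filter of lists that contain a given
    list: a list that is large enough near each point can be chosen large enough for all points at
    once. *)
Lemma compact_finite_cover (T : topologicalType) (C : set T) (V : T -> set T) :
  compact C -> (forall x, C x -> nbhs x (V x)) ->
  exists s : seq T, forall x, C x -> exists2 y, y \in s /\ C y & V y x.
Proof.
move=> /compact_near_coveringP cC hV.
pose F : set_system (seq T) := fun A =>
  exists s0 : seq T, forall s : seq T, {subset s0 <= s} -> A s.
have FF : Filter F.
  split; first by exists [::].
    move=> A B [sA hA] [sB hB]; exists (sA ++ sB) => s ss; split.
      by apply: hA => x xs; apply: ss; rewrite mem_cat xs.
    by apply: hB => x xs; apply: ss; rewrite mem_cat xs orbT.
  by move=> A B AB [sA hA]; exists sA => s /hA; exact: AB.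
have [|s0 hs0] := cC _ F (fun s x => exists2 y, y \in s /\ C y & V y x) FF;
  last by exists s0 => x Cx; exact: (hs0 s0).
move=> x Cx; exists (V x, [set s : seq T | x \in s]) => /=.
  split => /=; first exact: hV.
  by exists [:: x] => s; apply; rewrite inE.
by move=> -[y s] [/= Vy xs]; exists x.
Qed.

Lemma compact_exhaust (T : topologicalType) (C : set T) (A : nat -> set T) :
  compact C -> (forall n, open (A n)) ->
  (forall m n, (m <= n)%N -> A m `<=` A n) -> (forall x, C x -> exists n, A n x) ->
  exists n, C `<=` A n.
Proof.
move=> /compact_near_coveringP cC oA hA CA.
have [|n _ hn] := cC _ \oo (fun n x => A n x) _; last first.
  by exists n => x; apply: (hn n) => /=.
move=> x Cx; have [n Anx] := CA _ Cx.
exists (A n, [set m | (n <= m)%N]) => /=.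
  by split => /=; [exact: open_nbhs_nbhs|exists n].
by move=> -[y m] [/= Any nm]; exact: hA Any.
Qed.

Section TopologicalGroups.
Variable G : topologicalGroupType.
Implicit Types (S U V W O : set G) (x y g h : G).

Lemma continuous_mulg (T : topologicalType) (f k : T -> G) :
  continuous f -> continuous k -> continuous (fun t => (f t * k t)%g).
Proof.
move=> cf ck t.
apply: (@continuous2_cvg _ _ _ _ _ _ f k (fun x y => (x * y)%g)).
- exact: (mulg_continuous (f t, k t)).
- exact: cf.
- exact: ck.
Qed.

Lemma continuous_mulgl x : continuous (fun y => (x * y)%g).
Proof. by apply: continuous_mulg => [?|?]; [exact: cvg_cst|exact: cvg_id]. Qed.

Lemma continuous_mulgr x : continuous (fun y => (y * x)%g).
Proof. by apply: continuous_mulg => [?|?]; [exact: cvg_id|exact: cvg_cst]. Qed.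

Lemma open_mulgl x O : open O -> open [set y | O (x * y)%g].
Proof. by move=> oO; apply: open_comp => // y _; exact: continuous_mulgl. Qed.

Lemma open_mulgr x O : open O -> open [set y | O (y * x)%g].
Proof. by move=> oO; apply: open_comp => // y _; exact: continuous_mulgr. Qed.

Lemma open_invg O : open O -> open [set y | O (y^-1)%g].
Proof. by move=> oO; apply: open_comp => // y _; exact: invg_continuous. Qed.

Definition unit_nbhd V := [/\ open V, V 1%g & forall x, V x -> V (x^-1)%g].

Lemma unit_nbhd_shrink O : open O -> O 1%g ->
  exists2 V, unit_nbhd V & forall x y, V x -> V y -> O (x * y)%g.
Proof.
move=> oO O1.
have : nbhs ((1%g, 1%g) : G * G) [set p : G * G | O (p.1 * p.2)%g].
  have := @mulg_continuous G (1%g, 1%g); apply.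
  by rewrite /= mulg1; exact: open_nbhs_nbhs.
case=> -[A B] [] /= nA nB AB.
rewrite !nbhsE in nA nB.
case: nA => A' [oA' A'1] sA; case: nB => B' [oB' B'1] sB.
pose V := A' `&` B' `&` [set y | (A' `&` B') (y^-1)%g].
have oV : open V.
  by apply: openI; [exact: openI|apply: open_invg; exact: openI].
exists V.
- split => //; first by rewrite /V /= invg1.
  by rewrite /V => x /= [xAB xVAB]; rewrite invgK.
- by move=> x y [[Ax _] _] [[_ By] _]; apply: (AB (x, y)); split; [exact: sA|exact: sB].
Qed.

Lemma unit_nbhdI V W : unit_nbhd V -> unit_nbhd W -> unit_nbhd (V `&` W).
Proof.
move=> [oV V1 iV] [oW W1 iW]; split => //; first exact: openI.
by move=> x [Vx Wx]; split; [exact: iV|exact: iW].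
Qed.

Lemma set_pow_mul U m n x y :
  set_pow U m x -> set_pow U n y -> set_pow U (m + n) (x * y)%g.
Proof.
elim: m x => [|m IH] x; first by move=> ->; rewrite mul1g.
move=> [u Uu [v Uv <-]] Uy; exists u => //; exists (v * y)%g; first exact: IH.
by rewrite mulgA.
Qed.

Lemma set_pow1 U : set_pow U 1 = U.
Proof.
apply/seteqP; split => x /=; first by move=> [u Uu [v ->]]; rewrite mulg1 => <-.
by move=> Ux; exists x => //; exists 1%g => //; rewrite mulg1.
Qed.

Lemma set_pow_leq U m n : U 1%g -> (m <= n)%N -> set_pow U m `<=` set_pow U n.
Proof.
move=> U1 mn x Ux; rewrite -(subnK mn) -(mul1g x); apply: set_pow_mul => //.
by elim: (n - m)%N => //= k IH; exists 1%g => //; exists 1%g => //; rewrite mulg1.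
Qed.

Lemma set_pow_inv U n x : (forall y, U y -> U (y^-1)%g) ->
  set_pow U n x -> set_pow U n (x^-1)%g.
Proof.
move=> iU; elim: n x => [|n IH] x; first by move=> ->; rewrite /= invg1.
move=> [u Uu [v Uv <-]]; rewrite invgM -addn1; apply: set_pow_mul; first exact: IH.
by rewrite set_pow1; exact: iU.
Qed.

Lemma set_pow_expg U x k n : set_pow U n x -> set_pow U (k * n) (x ^+ k)%g.
Proof.
move=> Ux; elim: k => [|k IH]; first by rewrite mul0n expg0.
by rewrite mulSn expgS; exact: set_pow_mul.
Qed.

(** The zeroth power is the single point 1, which need not be open; this is why powers are indexed
    by a successor here and in [set_pow_cover]. *)
Lemma open_set_pow U n : open U -> open (set_pow U n.+1).
Proof.
move=> oU; elim: n => [|n IH]; first by rewrite set_pow1.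
have -> : set_pow U n.+2 =
    \bigcup_(u in U) [set y | set_pow U n.+1 (u^-1 * y)%g].
  apply/seteqP; split => y /=.
    by move=> [u Uu [v Uv <-]]; exists u => //=; rewrite mulKg.
  by move=> [u Uu Uv]; exists u => //; exists (u^-1 * y)%g => //; rewrite mulVKg.
by apply: bigcup_open => u _; exact: open_mulgl.
Qed.

Section generating.
Variable U : set G.
Hypothesis hU : generating_nbhd U.

Let oU : open U. Proof. by case: hU. Qed.
Let U1 : U 1%g. Proof. by case: hU. Qed.
Let iU : forall x, U x -> U (x^-1)%g. Proof. by case: hU. Qed.

Lemma generating_unit_nbhd : unit_nbhd U.
Proof. by case: hU. Qed.

Lemma set_pow_cover g : exists n, set_pow U n.+1 g.
Proof.
have : generated U g by case: hU => _ _ _ _ ->.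
apply: (@smallest_sub _ _ _ [set g | exists n, set_pow U n.+1 g]).
- split.
  + by exists 0%N; rewrite set_pow1.
  + move=> x y [m Ux] [n Uy]; exists (m + n.+1)%N; rewrite -addSn.
    exact: set_pow_mul.
  + by move=> x [n Ux]; exists n; exact: set_pow_inv.
- by move=> x Ux; exists 0%N; rewrite set_pow1.
Qed.

Lemma compact_set_pow C : compact C -> exists n, C `<=` set_pow U n.+1.
Proof.
move=> cC; apply: (@compact_exhaust G C (fun n => set_pow U n.+1)) => //.
- by move=> n; exact: open_set_pow.
- by move=> m n mn; apply: set_pow_leq.
- by move=> x _; exact: set_pow_cover.
Qed.

Lemma compact_mul (C D : set G) : compact C -> compact D ->
  compact [set (x * y)%g | x in C & y in D].
Proof.
move=> cC cD.
have -> : [set (x * y)%g | x in C & y in D] =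
    [set (p.1 * p.2)%g | p in C `*` D].
  apply/seteqP; split => z /=; first by move=> [x Cx [y Dy <-]]; exists (x, y).
  by move=> [[x y] [/= Cx Dy] <-]; exists x => //; exists y.
apply: continuous_compact; last exact: compact_setX.
by apply: continuous_subspaceT; exact: mulg_continuous.
Qed.

Lemma set_powS (A B : set G) n : A `<=` B -> set_pow A n `<=` set_pow B n.
Proof.
by move=> AB; elim: n => //= n IH x [u Au [v Av <-]]; exists u; [exact: AB|];
  exists v => //; exact: IH.
Qed.

Lemma sigma_compact : exists C : nat -> set G,
  [/\ forall n, compact (C n), forall m n, (m <= n)%N -> C m `<=` C n,
     forall n, set_pow U n `<=` C n & forall g, exists n, C n g].
Proof.
have cU : compact (closure U) by rewrite -precompactE; case: hU.
have sU : U `<=` closure U by exact: subset_closure.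
exists (fun n => set_pow (closure U) n); split.
- by elim => [|n IH] /=; [exact: compact_set1|exact: compact_mul].
- by move=> m n; apply: set_pow_leq; exact: sU.
- by move=> n; exact: set_powS.
- by move=> g; have [n Ug] := set_pow_cover g; exists n.+1; exact: set_powS Ug.
Qed.

(** Each compact piece of G is covered by finitely many translates of V, and the pair (piece,
    position in its list) is coded by one natural number. This is the substitute for second
    countability: it gives positive measure to open sets and countable grids of rectangles in G x
    G. *)
Lemma countable_translates V : unit_nbhd V ->
  exists a : nat -> G, forall g, exists i v, V v /\ g = (a i * v)%g.
Proof.
move=> [oV V1 iV]; have [C [cC _ _ hC]] := sigma_compact.
have /choice[s hs] : forall n, exists s : seq G,
    forall x, C n x -> exists2 y, y \in s /\ C n y & V (y^-1 * x)%g.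
  move=> n; apply: (@compact_finite_cover G (C n) (fun y x => V (y^-1 * x)%g)) => //.
  move=> x _; apply: open_nbhs_nbhs; split; first exact: open_mulgl.
  by rewrite /= mulVg.
exists (fun k => if (choice.unpickle k : option (nat * nat)) is Some (n, i)
  then nth 1%g (s n) i else 1%g) => g.
have [n Cg] := hC g; have [y [ys _] Vyg] := hs n g Cg.
exists (choice.pickle ((n, index y (s n)) : nat * nat)%type), (y^-1 * g)%g; split => //.
by rewrite choice.pickleK nth_index// mulVKg.
Qed.

End generating.
End TopologicalGroups.

(** * Haar measure and the modular function *)

Section Haar.
Variables (R : realType) (G : topologicalGroupType).
Implicit Types (g h x y : G).

Local Notation B := (borel G).

Lemma open_borel (O : set G) : open O -> measurable (O : set B).
Proof. by move=> oO; exact: sub_sigma_algebra. Qed.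

Lemma continuous_borel (f : G -> G) :
  continuous f -> measurable_fun [set: B] (f : B -> B).
Proof.
move=> cf; apply: (@measurability _ _ B B setT f (@open G : set (set B))) => //.
move=> _ [V oV <-]; rewrite setTI; apply: open_borel.
by apply: open_comp => // x _; exact: cf.
Qed.

Lemma continuous_borelR (f : G -> R) :
  continuous f -> measurable_fun [set: B] (f : B -> R).
Proof.
move=> cf; apply: (@measurability _ _ B R setT f _ (RGenOInfty.measurableE R)).
move=> _ [_ [x ->] <-]; rewrite setTI; apply: open_borel.
by apply: open_comp => // y _; exact: cf.
Qed.

Lemma measurable_mulgl x : measurable_fun [set: B] (fun y : B => (x * y)%g : B).
Proof. by apply: continuous_borel; exact: continuous_mulgl. Qed.

Lemma measurable_invg : measurable_fun [set: B] (fun y : B => (y^-1)%g : B).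
Proof. by apply: continuous_borel; exact: invg_continuous. Qed.

Lemma image_mulgl x (A : set G) : [set (x * y)%g | y in A] = (fun y => (x^-1 * y)%g) @^-1` A.
Proof.
apply/seteqP; split => y /=; first by move=> [z Az <-]; rewrite mulKg.
by move=> Ay; exists (x^-1 * y)%g => //; rewrite mulVKg.
Qed.

Lemma image_invg (A : set G) : [set (y^-1)%g | y in A] = (fun y => (y^-1)%g) @^-1` A.
Proof.
apply/seteqP; split => y /=; first by move=> [z Az <-]; rewrite invgK.
by move=> Ay; exists (y^-1)%g => //; rewrite invgK.
Qed.

Hypothesis hG : hausdorff_space G.
Variable U : set G.
Hypothesis hU : generating_nbhd U.
Variable mu : {measure set B -> \bar R}.
Hypothesis hmu : left_haar_measure mu.
Local Open Scope ereal_scope.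

Lemma compact_borel (C : set G) : compact C -> measurable (C : set B).
Proof.
move=> cC; rewrite -[C]setCK; apply: measurableC; apply: open_borel.
by have := compact_closed hG cC; rewrite -openC.
Qed.

Lemma haar_compact (C : set G) : compact C -> mu C < +oo.
Proof. by case: hmu => -[hC _ _] _ _; exact: hC. Qed.

Lemma haar_nbhd (V : set G) : open V -> V `<=` U -> mu V < +oo.
Proof.
move=> oV VU; have cU : compact (closure U) by rewrite -precompactE; case: hU.
apply: (@le_lt_trans _ _ (mu (closure U))); last exact: haar_compact.
apply: le_measurable; [exact: open_borel|exact: compact_borel|].
exact: subset_trans VU (@subset_closure _ _).
Qed.

Lemma haar_sigma_finite : sigma_finite setT mu.
Proof.
have [C [cC ndC _ hC]] := sigma_compact hU.
exists C.
  by apply/seteqP; split => // x _; have [n Cx] := hC x; exists n.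
by move=> n; split; [exact: compact_borel|exact: haar_compact].
Qed.

Lemma haar_mulgl x (A : set G) : measurable (A : set B) ->
  mu ((fun y => (x * y)%g) @^-1` A) = mu A.
Proof.
move=> mA; case: hmu => _ _ /(_ (x^-1)%g _ mA) <-.
by rewrite image_mulgl invgK.
Qed.

Lemma integral_mulgl_set x (D : set G) (f : B -> \bar R) : measurable (D : set B) ->
  measurable_fun setT f -> (forall y, 0 <= f y) ->
  \int[mu]_(y in (fun y => (x * y)%g) @^-1` D) f (x * y)%g = \int[mu]_(y in D) f y.
Proof.
move=> mD mf f0.
rewrite -[LHS](@ge0_integral_pushforward _ _ _ _ _ _ (measurable_mulgl x) mu D)//; last first.
  exact: measurable_funTS.
apply: eq_measure_integral; first exact: measurable_mulgl.
by move=> ? A mA _; exact: haar_mulgl.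
Qed.

Lemma integral_mulgl x (f : B -> \bar R) : measurable_fun setT f ->
  (forall y, 0 <= f y) -> \int[mu]_y f (x * y)%g = \int[mu]_y f y.
Proof. exact: (integral_mulgl_set x measurableT). Qed.

Lemma ae_mulgl x (P : G -> Prop) : {ae mu, forall y : B, P y} ->
  {ae mu, forall y : B, P (x * y)%g}.
Proof.
move=> [N [mN N0 sN]]; exists ((fun y => (x * y)%g) @^-1` N); split.
- by rewrite -[X in measurable X]setTI; exact: measurable_mulgl.
- by rewrite haar_mulgl.
- by move=> y /= nP; exact: sN.
Qed.

(** If O were null, so would be a neighborhood V of 1 contained in a translate of O; countably many
    translates of V cover G, and the whole measure would vanish. *)
Lemma haar_open (O : set G) : open O -> O !=set0 -> 0 < mu O.
Proof.
move=> oO [x Ox]; rewrite lt0e measure_ge0 andbT; apply/eqP => O0.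
have O1 : [set y | O (x * y)%g] 1%g by rewrite /= mulg1.
have [V uV sV] := unit_nbhd_shrink (open_mulgl x oO) O1.
have [oV V1 _] := uV.
have [a ha] := countable_translates hU uV.
case: hmu => _ + _; apply/negP; rewrite -leNgt.
have V0 : mu V = 0.
  apply/eqP; rewrite -measure_le0 -O0 -(haar_mulgl x (open_borel oO)).
  apply: le_measurable.
  - exact: open_borel.
  - by apply: open_borel; exact: open_mulgl.
  - by move=> y Vy; have := sV y 1%g Vy V1; rewrite mulg1.
have mW n : measurable ((fun y => ((a n)^-1 * y)%g) @^-1` V : set B).
  by apply: open_borel; exact: open_mulgl.
apply: (@le_trans _ _ (\sum_(n <oo) mu ((fun y => ((a n)^-1 * y)%g) @^-1` V))).
  apply: measure_sigma_subadditive => //.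
  by move=> g _; have [i [v [Vv ->]]] := ha g; exists i => //=; rewrite mulKg.
by rewrite eseries0// => n _ _; rewrite haar_mulgl//; exact: open_borel.
Qed.

Variable Delta : G -> R.
Hypothesis hDelta : modular_function mu Delta.

Lemma modular_gt0 g : (0 < Delta g)%R.
Proof. by case: hDelta. Qed.

Lemma modularM g h : Delta (g * h)%g = (Delta g * Delta h)%R.
Proof. by case: hDelta. Qed.

Lemma modular1 : Delta 1%g = 1%R.
Proof.
apply: (mulfI (lt0r_neq0 (modular_gt0 1%g))).
by rewrite -modularM mulg1 mulr1.
Qed.

Lemma modularV g : Delta (g^-1)%g = (Delta g)^-1%R.
Proof.
apply: (mulfI (lt0r_neq0 (modular_gt0 g))).
by rewrite -modularM mulgV modular1 divff// lt0r_neq0// modular_gt0.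
Qed.

Lemma measurable_modular : measurable_fun [set: B] (Delta : B -> R).
Proof. by case: hDelta => cD _ _ _; exact: continuous_borelR. Qed.

Lemma measurable_modularV : measurable_fun [set: B] (fun g : B => Delta (g^-1)%g).
Proof. exact: (measurableT_comp measurable_modular measurable_invg). Qed.

Lemma integral_invg (f : B -> \bar R) : measurable_fun setT f ->
  (forall y, 0 <= f y) ->
  \int[mu]_y f (y^-1)%g = \int[mu]_y ((Delta (y^-1)%g)%:E * f y).
Proof.
move=> mf f0.
rewrite -[LHS](@ge0_integral_pushforward _ _ _ _ _ _ measurable_invg mu setT)//.
rewrite -(integral_density mu measurable_modularV mf f0); last first.
  by move=> x; rewrite ltW// modular_gt0.
apply: eq_measure_integral; first exact: measurable_invg.
move=> ? A mA _; rewrite /= /pushforward -image_invg; case: hDelta => _ _ _ -> //.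
by apply: eq_integral => x _; rewrite ger0_norm// ltW// modular_gt0.
Qed.

Lemma ae_invg (P : G -> Prop) : {ae mu, forall y : B, P y} ->
  {ae mu, forall y : B, P (y^-1)%g}.
Proof.
move=> [N [mN N0 sN]]; exists ((fun y => (y^-1)%g) @^-1` N); split.
- by rewrite -[X in measurable X]setTI; exact: measurable_invg.
- rewrite -image_invg; case: hDelta => _ _ _ -> //.
  by apply: null_set_integral => //; apply/measurable_EFinP/measurable_funTS;
    exact: measurable_modularV.
- by move=> y /= nP; exact: sN.
Qed.

(** Inversion and left translations preserve null sets. Consequently a change of f on a null set
    does not affect the average of f (h^-1 * g) over h, for any g at all; the replacement of f by a
    better version relies on this. *)
Lemma ae_divg g (P : G -> Prop) : {ae mu, forall y : B, P y} ->
  {ae mu, forall y : B, P (y^-1 * g)%g}.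
Proof.
move=> hP; have := ae_invg hP => /(ae_mulgl (g^-1)%g).
by apply: filterS => y; rewrite invgM invgK.
Qed.

End Haar.

(** * Joint measurability of h^-1 g *)

Section DivMeasurable.
Variables (R : realType) (G : topologicalGroupType).
Implicit Types (g h x y : G).
Local Notation B := (borel G).

(* [G] need not be second countable, so for a Borel function [f] the map
   (h, g) |-> f (h^-1 g) may fail to be measurable for the product of the Borel
   sigma-algebras.  Every Borel function is almost everywhere equal to one for
   which it is measurable. *)
Definition div_measurable d (T : measurableType d) (f : G -> T) :=
  measurable_fun [set: B * B] (fun p : B * B => f (p.1^-1 * p.2)%g).

Lemma div_measurable_borel d (T : measurableType d) (f : G -> T) :
  div_measurable f -> measurable_fun [set: B] (f : B -> T).
Proof.
move=> mf; have := measurable_fun_pair2 (1%g : B) mf.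
by apply: eq_measurable_fun => x _; rewrite /= invg1 mul1g.
Qed.

Definition div_measurable_set (A : set G) :=
  measurable [set p : B * B | A (p.1^-1 * p.2)%g].

Lemma div_measurable_set_borel (A : set G) :
  div_measurable_set A -> measurable (A : set B).
Proof.
move=> mA; have -> : A = xsection [set p : B * B | A (p.1^-1 * p.2)%g] (1%g : B).
  apply/seteqP; split => x; rewrite /xsection /=.
    by move=> Ax; apply/mem_set; rewrite /= invg1 mul1g.
  by move=> /set_mem; rewrite /= invg1 mul1g.
exact: measurable_xsection.
Qed.

Variable U : set G.
Hypothesis hU : generating_nbhd U.

(** Around each c of C continuity gives a neighborhood for which v * (c * t) * w stays in O. The
    factor t absorbs the passage from c to nearby points of C, so finitely many c suffice and their
    neighborhoods can be intersected. *)
Lemma compact_two_sided_nbhd (C O : set G) : compact C -> open O -> C `<=` O ->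
  exists2 V, unit_nbhd V &
    forall v c w, V v -> C c -> V w -> O (v * c * w)%g.
Proof.
move=> cC oO CO.
have uC c : exists V, C c -> unit_nbhd V /\
    forall v t w, V v -> V t -> V w -> O (v * (c * t) * w)%g.
  have [Cc|nCc] := pselect (C c); last by exists set0.
  have O1 : [set x | O (x * c)%g] 1%g by rewrite /= mul1g; exact: CO.
  have [V1 uV1 hV1] := unit_nbhd_shrink (open_mulgr c oO) O1.
  have [oV1 V11 _] := uV1.
  have V1c : [set x | V1 (c * x * c^-1)%g] 1%g by rewrite /= mulg1 mulgV.
  have oV1c : open [set x | V1 (c * x * c^-1)%g].
    exact: (open_mulgl c (open_mulgr (c^-1)%g oV1)).
  have [V2 uV2 hV2] := unit_nbhd_shrink oV1c V1c.
  exists (V1 `&` V2) => _; split; first exact: unit_nbhdI.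
  move=> v t w [Vv _] [_ Vt] [_ Vw]; have /= := hV1 v _ Vv (hV2 t w Vt Vw).
  by rewrite !mulgA mulgVK.
have [V hV] := choice uC.
have [s hs] := @compact_finite_cover G C (fun c x => V c (c^-1 * x)%g) cC
  (fun c Cc => ltac:(have [[oV V1 _] _] := hV c Cc; apply: open_nbhs_nbhs;
     split; [exact: open_mulgl | by rewrite /= mulVg])).
have [W uW WV] : exists2 W, unit_nbhd W &
    forall c, c \in s -> C c -> W `<=` V c.
  elim: (s) => [|c t [W uW hW]]; first by exists setT => //; split => //; exact: openT.
  have [Cc|nCc] := pselect (C c).
    exists (W `&` V c); first by apply: unit_nbhdI => //; case: (hV c Cc).
    move=> x; rewrite inE => /predU1P[-> _ y []//|xt Cx y [Wy _]]; exact: hW Wy.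
  by exists W => // x; rewrite inE => /predU1P[->//|]; exact: hW.
exists W => // v c w Wv Cc Ww; have [c' [c's Cc'] Vc] := hs c Cc.
have [_ hO] := hV c' Cc'.
by rewrite -(mulVKg c' c); apply: hO => //; exact: (WV c').
Qed.

(** The set A is the intersection of the sets V_n C V_n, where V_(n+1) V_(n+1) lies in V_n. To see
    that P = {(h, g) | h^-1 g in A} is measurable on the product, G x G is covered at each level by
    countably many small open rectangles, and those that meet P are kept. Two points of one
    rectangle change h^-1 g by a small factor on each side, so a kept rectangle of level n lies over
    V_n C V_n, and P is the intersection over n of the unions kept. *)
Lemma compact_open_div_measurable (C O : set G) : compact C -> open O -> C `<=` O ->
  exists A, [/\ div_measurable_set A, C `<=` A & A `<=` O].
Proof.
move=> cC oO CO.
have [V0 uV0 hV0] := compact_two_sided_nbhd cC oO CO.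
have /choice[sh hsh] : forall V : set G, exists W, unit_nbhd V ->
    unit_nbhd W /\ forall x y, W x -> W y -> V (x * y)%g.
  move=> V; have [uV|nuV] := pselect (unit_nbhd V); last by exists set0.
  have [W uW hW] := unit_nbhd_shrink (let: And3 a _ _ := uV in a)
    (let: And3 _ a _ := uV in a).
  by exists W.
pose V n := iter n sh V0.
have uV n : unit_nbhd (V n) by elim: n => //= n /hsh[].
have VV n x y : V n.+1 x -> V n.+1 y -> V n (x * y)%g by have [_] := hsh _ (uV n); exact.
have V1 n : V n 1%g by case: (uV n).
have iV n x : V n x -> V n (x^-1)%g by case: (uV n) => _ _; exact.
pose D n x := exists v c w, [/\ V n v, C c, V n w & x = (v * c * w)%g].
pose A := [set x | forall n, D n x].
have CA : C `<=` A.
  by move=> c Cc n; exists 1%g, c, 1%g; rewrite mul1g mulg1.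
have AO : A `<=` O by move=> x /(_ 0%N)[v [c [w [Vv Cc Vw ->]]]]; exact: hV0.
exists A; split => //.
have /choice[a ha] : forall n, exists a : nat -> G,
    forall g, exists i v, V n v /\ g = (a i * v)%g.
  by move=> n; apply: (countable_translates hU).
pose P := [set p : B * B | A (p.1^-1 * p.2)%g].
pose rect n i j : set (B * B) := [set x : B | V n.+2 ((a n.+2 i)^-1 * x)%g] `*`
  [set x : B | V n.+2 ((a n.+2 j)^-1 * x)%g].
have mrect n i j : measurable (rect n i j).
  by apply: measurableX; apply: open_borel; apply: open_mulgl; case: (uV n.+2).
pose RR n := \bigcup_i \bigcup_(j in [set j | (rect n i j `&` P) !=set0]) rect n i j.
rewrite /div_measurable_set -/P.
suff -> : P = \bigcap_n RR n.
  by apply: bigcapT_measurable => n; apply: bigcupT_measurable => i;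
    exact: bigcup_measurable.
apply/seteqP; split => -[h g] /=.
  move=> Phg n _; have [i [v [Vv hE]]] := ha n.+2 h.
  have [j [w [Vw gE]]] := ha n.+2 g.
  have rij : rect n i j (h, g) by rewrite /rect /= hE gE !mulKg.
  by exists i => //; exists j => //; exists (h, g).
move=> hRR n; have [i _ [j [[h0 g0] [[/= r1 r2] P0]] [/= q1 q2]]] := hRR n I.
have t1 : V n.+1 (h^-1 * h0)%g.
  have -> : (h^-1 * h0 = ((a n.+2 i)^-1 * h)^-1 * ((a n.+2 i)^-1 * h0))%g.
    by rewrite invgM invgK -mulgA mulVKg.
  by apply: VV => //; exact: iV.
have t2 : V n.+1 (g0^-1 * g)%g.
  have -> : (g0^-1 * g = ((a n.+2 j)^-1 * g0)^-1 * ((a n.+2 j)^-1 * g))%g.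
    by rewrite invgM invgK -mulgA mulVKg.
  by apply: VV => //; exact: iV.
have [v [c [w [Vv Cc Vw E]]]] := P0 n.+1.
exists (h^-1 * h0 * v)%g, c, (w * (g0^-1 * g))%g; split => //; [exact: VV|exact: VV|].
have /= -> : (h^-1 * g = h^-1 * h0 * (h0^-1 * g0) * (g0^-1 * g))%g.
  by rewrite !mulgA !mulgK.
by rewrite E !mulgA.
Qed.

Hypothesis hG : hausdorff_space G.
Variable mu : {measure set B -> \bar R}.
Hypothesis hmu : left_haar_measure mu.
Local Open Scope ereal_scope.

(** By inner regularity O contains compact sets of measure within 1/(n+1) of its own; the union over
    n of the sets interpolated between them and O has full measure in O. *)
Lemma open_ae_div_measurable (O : set G) : open O -> mu O < +oo ->
  exists2 A, div_measurable_set A & {ae mu, forall x : B, O x <-> A x}.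
Proof.
move=> oO Ooo.
have fO : mu O \is a fin_num by rewrite ge0_fin_numE.
have regO : mu O = ereal_sup [set mu C | C in [set C : set G | compact C /\ C `<=` O]].
  by case: hmu => -[_ _ reg] _ _; exact: reg.
have /choice[A hA] : forall n : nat, exists A, [/\ div_measurable_set A, A `<=` O &
    mu O <= mu A + (n.+1%:R^-1)%:E].
  move=> n; have [||_ [C [cC CO] <-]] := @ub_ereal_sup_adherent R
    [set mu C | C in [set C : set G | compact C /\ C `<=` O]] n.+1%:R^-1%R.
  - by rewrite invr_gt0.
  - by rewrite -regO.
  rewrite -regO => hC.
  have [A [mA CA AO]] := compact_open_div_measurable cC oO CO.
  exists A; split => //; rewrite -leeBlDr//; apply: (le_trans (ltW hC)).
  by apply: le_measurable => //; [exact: (compact_borel hG)|exact: div_measurable_set_borel].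
have mA n := let: And3 a _ _ := hA n in a.
pose A' := \bigcup_n A n.
have mA' : div_measurable_set A'.
  rewrite /div_measurable_set.
  have -> : [set p : B * B | A' (p.1^-1 * p.2)%g] =
    \bigcup_n [set p : B * B | A n (p.1^-1 * p.2)%g] by [].
  exact: bigcupT_measurable.
have bA' := div_measurable_set_borel mA'.
have bO := open_borel oO.
have A'O : A' `<=` O by move=> x [n _]; case: (hA n) => _ + _; exact.
have muA' : mu O = mu A'.
  apply/eqP; rewrite eq_le; apply/andP; split; last exact: le_measurable.
  apply/lee_addgt0Pr => e e0.
  have [n ne] : exists n : nat, (n.+1%:R^-1 <= e)%R.
    exists (Num.truncn e^-1); rewrite -[leRHS]invrK lef_pV2// ?posrE ?invr_gt0//.
    by rewrite ltW// Num.Theory.truncnS_gt.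
  have [_ _ h] := hA n; apply: (le_trans h); apply: leeD; last by rewrite lee_fin.
  apply: le_measurable => //; first exact: div_measurable_set_borel.
  by move=> x Ax; exists n.
exists A' => //; exists (O `\` A'); split.
- exact: measurableD.
- have -> : mu (O `\` A') = mu O - mu (O `&` A') by apply: measureD.
  by rewrite setIidr// -muA' subee.
- move=> x /= h; apply: contrapT => nOA; apply: h; split; last exact: A'O.
  by move=> Ox; apply: contrapT => nA; apply: nOA.
Qed.

(** The sets that have such a version form a sigma-algebra. An open set may have infinite measure,
    so it is cut by the powers of U before the finite case applies. *)
Lemma set_ae_div_measurable (A : set G) : measurable (A : set B) ->
  exists2 A', div_measurable_set A' & {ae mu, forall x : B, A x <-> A' x}.
Proof.
pose S := [set A : set B | exists2 A', div_measurable_set A' &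
  {ae mu, forall x : B, A x <-> A' x}].
have SU (F : nat -> set B) : (forall n, S (F n)) -> S (\bigcup_n F n).
  move=> SF; have /choice[F' hF'] : forall n, exists A', div_measurable_set A' /\
      {ae mu, forall x : B, F n x <-> A' x} by move=> n; have [A' ? ?] := SF n; exists A'.
  exists (\bigcup_n F' n).
    rewrite /div_measurable_set.
    have -> : [set p : B * B | (\bigcup_n F' n) (p.1^-1 * p.2)%g] =
      \bigcup_n [set p : B * B | F' n (p.1^-1 * p.2)%g] by [].
    by apply: bigcupT_measurable => n; have [] := hF' n.
  have := ae_foralln (fun n => (hF' n).2).
  apply: filterS => x hx; split=> -[n _] /hx ?; by exists n.
move=> mA; suff : S A by [].
apply: (smallest_sub _ _ mA).
- split => //.
  + by exists set0; [exact: measurable0|exact: nearW].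
  + move=> E [E' mE' aeE]; exists (~` E').
      rewrite /div_measurable_set.
      have -> : [set p : B * B | (~` E') (p.1^-1 * p.2)%g] =
        ~` [set p : B * B | E' (p.1^-1 * p.2)%g] by [].
      exact: measurableC.
    by apply: filterS aeE => x [h1 h2]; rewrite setTD; split; exact: contra_not.
- move=> O oO.
  have [C [cC ndC UC hC]] := sigma_compact hU.
  have -> : O = \bigcup_n (O `&` set_pow U n.+1).
    apply/seteqP; split => [x Ox|x [n _ []]//].
    by have [n Un] := set_pow_cover hU x; exists n.
  apply: SU => n; apply: open_ae_div_measurable.
    by apply: openI => //; apply: open_set_pow; case: hU.
  apply: (@le_lt_trans _ _ (mu (C n.+1))); last exact: haar_compact.
  apply: le_measurable.
  + by apply: open_borel; apply: openI => //; apply: open_set_pow; case: hU.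
  + exact: compact_borel.
  + by move=> x [_ /UC].
Qed.

Lemma ge0_ae_div_measurable (f : B -> \bar R) : measurable_fun setT f ->
  (forall x, 0 <= f x) ->
  exists f' : G -> \bar R, [/\ div_measurable f', forall x, 0 <= f' x &
    {ae mu, forall x : B, f x = f' x}].
Proof.
move: f; apply: (ge0_measurable_ind (P := fun f => exists f' : G -> \bar R,
  [/\ div_measurable f', forall x, 0 <= f' x & {ae mu, forall x : B, f x = f' x}])).
- move=> A /set_ae_div_measurable[A' mA' aeA].
  exists (fun x => (\1_A' x)%:E); split.
  + apply/measurable_EFinP.
    exact: (measurable_indic (U := [set p : B * B | A' (p.1^-1 * p.2)%g])).
  + by move=> x; rewrite lee_fin.
  + apply: filterS aeA => x [h1 h2]; rewrite !indicE.
    suff -> : (x \in (A : set G)) = (x \in A') by [].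
    by apply/idP/idP => /set_mem ?; apply/mem_set; auto.
- move=> f g mf mg f0 g0 [f' [mf' f'0 aef]] [g' [mg' g'0 aeg]].
  exists (fun x => f' x + g' x); split.
  + exact: emeasurable_funD.
  + by move=> x; rewrite adde_ge0.
  + by apply: filterS2 aef aeg => x -> ->.
- move=> k f k0 mf f0 [f' [mf' f'0 aef]]; exists (fun x => k%:E * f' x); split.
  + exact: measurable_funeM.
  + by move=> x; rewrite mule_ge0.
  + by apply: filterS aef => x ->.
- move=> F mF F0 hF /choice[F' hF'].
  (* The versions are monotone in n only almost everywhere. The upper limit exists everywhere, and
     the maximum with 0 keeps the sign on the exceptional set. *)
  exists (fun x => maxe (limn_esup (F'^~ x)) 0); split.
  + apply: measurable_maxe => //.
    by apply: measurable_fun_limn_esup => n; have [] := hF' n.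
  + by move=> x; rewrite le_max lexx orbT.
  + have := ae_foralln (fun n => let: And3 _ _ a := hF' n in a).
    apply: filterS => x hx.
    have -> : F'^~ x = F^~ x by apply/funext => n; rewrite hx.
    have cF : cvgn (F^~ x) by apply: ereal_nondecreasing_is_cvgn; exact: hF.
    rewrite is_cvg_limn_esupE// max_l//.
    by apply: lime_ge => //; exact: nearW.
Qed.

Lemma ge0_real_ae_div_measurable (f : G -> R) : measurable_fun [set: B] (f : B -> R) ->
  (forall x, 0 <= f x)%R ->
  exists f' : G -> R, [/\ div_measurable f', forall x, (0 <= f' x)%R &
    {ae mu, forall x : B, f x = f' x}].
Proof.
move=> mf f0; have [||f' [mf' f'0 aef]] := @ge0_ae_div_measurable (fun x => (f x)%:E).
- exact/measurable_EFinP.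
- by move=> x; rewrite lee_fin.
exists (fun x => fine (f' x)); split.
- by apply: measurableT_comp mf'; exact: fine_measurable.
- by move=> x; exact: fine_ge0.
- by apply: filterS aef => x <-.
Qed.

Lemma real_ae_div_measurable (f : G -> R) : measurable_fun [set: B] (f : B -> R) ->
  exists2 f' : G -> R, div_measurable f' & {ae mu, forall x : B, f x = f' x}.
Proof.
move=> mf.
have [||p [mp _ aep]] := @ge0_real_ae_div_measurable (fun x => Num.max (f x) 0%R).
- exact: measurable_maxr.
- by move=> x; rewrite le_max lexx orbT.
have [||q [mq _ aeq]] := @ge0_real_ae_div_measurable (fun x => Num.max (- f x)%R 0%R).
- by apply: measurable_maxr => //; exact: measurableT_comp.
- by move=> x; rewrite le_max lexx orbT.
exists (fun x => p x - q x)%R; first exact: measurable_funB.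
apply: filterS2 aep aeq => x <- <-; rewrite /Num.max oppr_lt0.
by case: ltgtP => // [_|_|->]; rewrite ?subr0 ?sub0r ?opprK ?oppr0.
Qed.

End DivMeasurable.

(** * Stability of quasi-homomorphisms *)

Section SplitComponents.
Local Open Scope quotient_scope.
Variables (R : realType) (G : topologicalGroupType) (s : splitting R G).
Implicit Types (g h x y : G).

Local Notation A := ('rV[R]_(split_q s) * 'rV[discrete_topology int]_(split_r s)
  * split_M s)%type.

Definition split_coord (g : G) : A := split_map s (abelianization_proj g).

Lemma split_coordM g h : split_coord (g * h)%g = split_coord g + split_coord h.
Proof. exact: split_mapM. Qed.

Lemma split_coord1 : split_coord 1%g = 0.
Proof.
by apply: (addIr (split_coord 1%g)); rewrite -split_coordM mulg1 add0r.
Qed.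

Lemma split_coordV g : split_coord (g^-1)%g = - split_coord g.
Proof.
by apply: (addIr (split_coord g)); rewrite -split_coordM mulVg split_coord1 addNr.
Qed.

Lemma split_coordX g n : split_coord (g ^+ n)%g = split_coord g *+ n.
Proof.
elim: n => [|n IH]; first by rewrite expg0 split_coord1.
by rewrite expgS split_coordM IH mulrS.
Qed.

Lemma split_coord_inj g h : split_coord g = split_coord h ->
  exists2 k, @closed_commutator G k & h = (g * k)%g.
Proof.
move=> /(can_inj (@split_mapK _ _ s)) E.
have /asboolP Ec : same_coset g h by apply/(@eqmodP _ (@same_coset_equiv G)).
have : [set (h * k)%g | k in @closed_commutator G] h.
  exists 1%g; rewrite ?mulg1//; apply: subset_closure => X [[X1 _ _] _]; exact: X1.
by rewrite -Ec => -[k hk <-]; exists k.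
Qed.

Lemma split_coord_surj a : exists g, split_coord g = a.
Proof.
pose b : {eq_quot (@same_coset_equiv G)} := split_inv a.
exists (repr b); rewrite /split_coord /abelianization_proj.
have -> : \pi_({eq_quot (@same_coset_equiv G)}) (repr b) = b by exact: reprK.
by rewrite /b split_invK.
Qed.

Lemma split_coord_continuous : continuous split_coord.
Proof.
move=> x; apply: (@continuous_comp _ _ _ (@abelianization_proj G) (@split_map R G s)).
  exact: pi_continuous.
exact: split_map_continuous.
Qed.

(** The quotient map is open: if y in O has the class of x, then t near x has the class of y * (x^-1
    * t), which is near y. *)
Lemma open_split_coord (O : set G) : open O -> open [set split_coord g | g in O].
Proof.
move=> oO.
have -> : [set split_coord g | g in O] =
    @split_inv R G s @^-1` [set abelianization_proj g | g in O].
  apply/seteqP; split => a /=.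
    by move=> [g Og <-]; exists g => //; rewrite /split_coord split_mapK.
  by move=> [g Og E]; exists g => //; rewrite /split_coord E split_invK.
apply: open_comp => [a _|]; first exact: split_inv_continuous.
rewrite /open /= /quotient_open.
rewrite openE => x /= [y Oy E].
have Exy : split_coord y = split_coord x by rewrite /split_coord E.
have oyt : open [set t | O (y * (x^-1 * t))%g].
  have := open_mulgl (x^-1)%g (open_mulgl y oO); exact.
have : nbhs x [set t | O (y * (x^-1 * t))%g].
  by apply: open_nbhs_nbhs; split => //=; rewrite mulVg mulg1.
apply: filterS => t /= Ot; exists (y * (x^-1 * t))%g => //.
apply: (can_inj (@split_mapK _ _ s)).
rewrite -/(split_coord _) -/(split_coord _).
by rewrite !split_coordM split_coordV Exy addrA subrr add0r.
Qed.

Lemma split_componentM i g h :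
  split_component s i (g * h)%g = split_component s i g + split_component s i h.
Proof.
rewrite /split_component split_mapM.
by case: fintype.split => j; rewrite !mxE// rmorphD.
Qed.

Lemma split_component_continuous i : continuous (split_component s i).
Proof.
have cf : continuous (fun g => (split_coord g).1).
  move=> x; apply: (@continuous_comp _ _ _ split_coord fst); last exact: cvg_fst.
  exact: split_coord_continuous.
move=> x; rewrite /split_component -/(split_coord).
case E : (fintype.split i) => [j|j].
  apply: (@continuous_comp _ _ _ (fun g => (split_coord g).1)
    (fun z : 'rV[R]_(split_q s) * 'rV[discrete_topology int]_(split_r s) => z.1 ord0 j)).
    exact: (cf x).
  apply: (@continuous_comp _ _ _ fst (fun M : 'rV[R]_(split_q s) => M ord0 j)).
    exact: cvg_fst.
  exact: coord_continuous.
apply: (@continuous_comp _ _ _ (fun g => (split_coord g).1)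
    (fun z : 'rV[R]_(split_q s) * 'rV[discrete_topology int]_(split_r s) =>
      (z.2 ord0 j : int)%:~R : R)); first exact: (cf x).
apply: (@continuous_comp _ _ _ snd
  (fun M : 'rV[discrete_topology int]_(split_r s) => (M ord0 j : int)%:~R : R)).
  exact: cvg_snd.
move=> V nV.
exists (fun i' j' => [set (split_coord x).1.2 i' j' : discrete_topology int]).
  by move=> i' j'; exact: discrete_set1.
by move=> N /= /(_ ord0 j) ->; exact: nbhs_singleton.
Qed.

End SplitComponents.

Lemma zmod_closed_mulz (V : zmodType) (P : V -> Prop) (x : V) (k : int) :
  P 0 -> (forall y z, P y -> P z -> P (y + z)) -> (forall y, P y -> P (- y)) ->
  P x -> P (x *~ k).
Proof.
move=> P0 PD PN Px.
have Pn n : P (x *+ n) by elim: n => [|n IH]; [rewrite mulr0n|rewrite mulrS; exact: PD].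
by case: k => n; [exact: Pn|rewrite NegzE mulrNz; exact/PN/Pn].
Qed.

Lemma compact_norm_bounded (R : realType) (T : topologicalType) (C : set T)
    (f : T -> R) : compact C -> continuous f ->
  exists M, forall x, C x -> `|f x| <= M.
Proof.
move=> cC cf.
have [|||n hn] := @compact_exhaust T C (fun n => [set x | `|f x| < n%:R]) cC.
- move=> n; apply: (@open_comp _ _ (fun x => `|f x|) [set y | y < n%:R]).
    by move=> x _; apply: continuous_comp; [exact: cf|exact: norm_continuous].
  exact: open_lt.
- by move=> m n mn x /= /lt_le_trans; apply; rewrite ler_nat.
- by move=> x _; exists (Num.truncn `|f x|).+1; exact: Num.Theory.truncnS_gt.
by exists n%:R => x /hn /ltW.
Qed.

Lemma pair_mulrn (V W : zmodType) (z : V * W) n : z *+ n = (z.1 *+ n, z.2 *+ n).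
Proof.
elim: n => [|n IH]; first by [].
by rewrite mulrS IH [LHS]surjective_pairing /= -!mulrS.
Qed.

Section QuasiHomomorphisms.
Variables (R : realType) (G : topologicalGroupType) (U : set G).
Hypothesis hU : generating_nbhd U.
Variable s : splitting R G.
Implicit Types (g h x y : G) (F : G -> R).

Local Notation q := (split_q s).
Local Notation r := (split_r s).
Local Notation A := ('rV[R]_q * 'rV[discrete_topology int]_r * split_M s)%type.
Local Notation sc := (@split_coord R G s).

(** The defect may grow with the word lengths. This is the form that telescoping gives for
    [pair_diff], where i letters are spent on phi and j letters on psi. *)
Definition quasi_hom (D : R) F := forall i j g h,
  set_pow U i g -> set_pow U j h ->
  `|F (g * h)%g - F g - F h| <= D * (i%:R * j%:R).

Definition basis_coord (i : 'I_(q + r)) : A :=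
  match fintype.split i with
  | inl j => (delta_mx ord0 j, 0, 0)
  | inr j => (0, delta_mx ord0 j : 'rV[discrete_topology int]_r, 0)
  end.

Variable e : 'I_(q + r) -> G.
Hypothesis eE : forall i, sc (e i) = basis_coord i.

Let oU : open U. Proof. by case: hU. Qed.
Let U1 : U 1%g. Proof. by case: hU. Qed.
Let iU : forall x, U x -> U (x^-1)%g. Proof. by case: hU. Qed.

Lemma split_component_basis i k : split_component s i (e k) = (i == k)%:R.
Proof.
have := eE k; rewrite /split_component /basis_coord -/(split_coord s _) => ->.
have [->|ik] := eqVneq i k.
  by case: fintype.split => j /=; rewrite mxE !eqxx.
case Ei: (fintype.split i) => [a|a]; case Ek : (fintype.split k) => [b|b] /=;
  rewrite mxE ?eqxx//=.
- case: eqP => // ab; move: ik; rewrite -(splitK i) -(splitK k) Ei Ek ab.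
  by rewrite eqxx.
- case: eqP => // ab; move: ik; rewrite -(splitK i) -(splitK k) Ei Ek ab.
  by rewrite eqxx.
Qed.

Definition normalized (d : R) F :=
  [/\ quasi_hom d F, forall u, U u -> `|F u| <= 1 & forall i, F (e i) = 0].

(** The threshold d may depend on P but serves all F at once. The quantifier is stable under finite
    conjunctions, which is all the uniformity that the compactness arguments need. *)
Definition eventually_normalized (P : (G -> R) -> Prop) :=
  exists2 d, 0 < d & forall F, normalized d F -> P F.

Local Notation ev := eventually_normalized.

Lemma quasi_hom_le D D' F : D <= D' -> quasi_hom D F -> quasi_hom D' F.
Proof.
move=> DD' hF i j g h Ug Uh; apply: le_trans (hF i j g h Ug Uh) _.
by rewrite ler_wpM2r// mulr_ge0.
Qed.

Lemma normalized_le d d' F : d <= d' -> normalized d F -> normalized d' F.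
Proof. by move=> dd' [hF F1 Fe]; split => //; exact: quasi_hom_le hF. Qed.

Lemma evI P Q : ev P -> ev Q -> ev (fun F => P F /\ Q F).
Proof.
move=> [d d0 hP] [d' d'0 hQ]; exists (Num.min d d'); first by rewrite lt_min d0.
move=> F hF; split; [apply: hP|apply: hQ]; apply: normalized_le hF;
  by rewrite ge_min lexx ?orbT.
Qed.

Lemma evS (P Q : (G -> R) -> Prop) : (forall F, P F -> Q F) -> ev P -> ev Q.
Proof. by move=> PQ [d d0 hP]; exists d => // F /hP/PQ. Qed.

Lemma ev_defect m n eps : 0 < eps -> ev (fun F => forall g h,
  set_pow U m g -> set_pow U n h -> `|F (g * h)%g - F g - F h| <= eps).
Proof.
move=> e0; exists (eps / (m * n).+1%:R); first by rewrite divr_gt0.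
move=> F [hF _ _] g h Ug Uh; apply: le_trans (hF _ _ _ _ Ug Uh) _.
by rewrite -mulrA ger_pMr// mulrC ler_pdivrMr// mul1r -natrM ler_nat.
Qed.

Lemma quasi_hom1 D F : quasi_hom D F -> F 1%g = 0.
Proof.
move=> hF; have := hF 0%N 0%N 1%g 1%g erefl erefl.
rewrite mul0r mulr0 mulg1 normr_le0 => /eqP; lra.
Qed.

Lemma ev1 : ev (fun F => F 1%g = 0).
Proof. by exists 1 => // F [hF _ _]; exact: quasi_hom1 hF. Qed.

(** Splitting off one letter from a word with k further letters costs M and a defect D * k; these
    defects add up to at most D * n^2. *)
Lemma quasi_hom_bound D M F n g : 0 <= D -> quasi_hom D F ->
  (forall u, U u -> `|F u| <= M) -> set_pow U n g ->
  `|F g| <= n%:R * M + D * n%:R ^+ 2.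
Proof.
move=> D0 hF hM.
elim: n g => [g ->|n IH g [u Uu [v Uv <-]]].
  by rewrite (quasi_hom1 hF) normr0 mul0r expr0n/= mulr0 addr0.
have h1 := hF 1%N n u v; rewrite set_pow1 mul1r in h1.
have {h1}h1 := h1 Uu Uv; have h2 := hM u Uu; have h3 := IH v Uv.
have n0 : 0 <= n%:R :> R by [].
rewrite -addn1 natrD; move: h1 h2 h3; rewrite !ler_norml.
move=> /andP[a1 a2] /andP[b1 b2] /andP[c1 c2]; apply/andP; split; nra.
Qed.

(** The goal is [Z_all]: every element is negligible. The negligible elements form a closed subgroup
    that contains all commutators and all [e i], and only a compact quotient then remains to be
    treated. *)
Definition negligible_on g := forall eps, 0 < eps -> ev (fun F => `|F g| <= eps).

Local Notation Z := negligible_on.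

Lemma Z1 : Z 1%g.
Proof. by move=> eps e0; apply: evS ev1 => F ->; rewrite normr0 ltW. Qed.

Lemma ZM g h : Z g -> Z h -> Z (g * h)%g.
Proof.
move=> Zg Zh eps e0.
have [m Ug] := set_pow_cover hU g; have [n Uh] := set_pow_cover hU h.
have e3 : 0 < eps / 3 by rewrite divr_gt0.
apply: evS (evI (evI (Zg _ e3) (Zh _ e3)) (ev_defect m.+1 n.+1 e3)).
move=> F [[h1 h2] h3]; have {h3} := h3 g h Ug Uh; move: h1 h2.
rewrite !ler_norml => /andP[a1 a2] /andP[b1 b2] /andP[c1 c2].
apply/andP; split; lra.
Qed.

Lemma ev_inv g eps : 0 < eps -> ev (fun F => `|F g + F (g^-1)%g| <= eps).
Proof.
move=> e0; have [m Ug] := set_pow_cover hU g.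
apply: evS (evI ev1 (ev_defect m.+1 m.+1 e0)) => F [h1 h2].
have := h2 g (g^-1)%g Ug (set_pow_inv iU Ug).
by rewrite mulgV h1 sub0r -opprD normrN.
Qed.

Lemma ZV g : Z g -> Z (g^-1)%g.
Proof.
move=> Zg eps e0; have e2 : 0 < eps / 2 by rewrite divr_gt0.
apply: evS (evI (Zg _ e2) (ev_inv g e2)) => F [].
rewrite !ler_norml => /andP[a1 a2] /andP[b1 b2]; apply/andP; split; lra.
Qed.

Lemma Zcomm x y : Z [~ x, y]%g.
Proof.
(* Five errors: two from the inverses of x and y, and three from the products x^-1 * y^-1, x * y and
   the product of these two. *)
move=> eps e0; have e5 : 0 < eps / 5 by rewrite divr_gt0.
have [m Ux] := set_pow_cover hU x; have [n Uy] := set_pow_cover hU y.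
have Ux' := set_pow_inv iU Ux; have Uy' := set_pow_inv iU Uy.
apply: evS (evI (evI (ev_inv x e5) (ev_inv y e5))
  (evI (ev_defect m.+1 n.+1 e5) (ev_defect (m.+1 + n.+1) (m.+1 + n.+1) e5))).
move=> F [[h1 h2] [h3 h4]].
have := h3 _ _ Ux' Uy'; have := h3 _ _ Ux Uy.
have := h4 _ _ (set_pow_mul Ux' Uy') (set_pow_mul Ux Uy).
have -> : (x^-1 * y^-1 * (x * y) = [~ x, y])%g by rewrite /commg /conjg !mulgA.
move: h1 h2; rewrite !ler_norml => /andP[a1 a2] /andP[b1 b2] /andP[c1 c2].
move=> /andP[d1 d2] /andP[f1 f2]; apply/andP; split; lra.
Qed.

Lemma Zsubgroup : is_subgroup [set g | Z g].
Proof. by split; [exact: Z1|exact: ZM|exact: ZV]. Qed.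

(** F is not assumed continuous; smallness near 1 comes from squaring. If w and its square lie in W,
    where |F| <= c, then 2 F w differs from F (w * w) by a defect of at most c / 2, so |F w| <= 3 c
    / 4. Iteration gives the powers of 3/4. *)
Lemma ev_small_nbhd eps : 0 < eps ->
  exists2 W, unit_nbhd W & ev (fun F => forall w, W w -> `|F w| <= eps).
Proof.
have H k : exists W, [/\ unit_nbhd W, W `<=` U &
    ev (fun F => forall w, W w -> `|F w| <= (3 / 4) ^+ k)].
  elim: k => [|k [W [uW WU IH]]].
    exists U; split => //.
    by exists 1 => // F [_ + _]; rewrite expr0.
  have [V uV VW] := unit_nbhd_shrink (let: And3 a _ _ := uW in a)
    (let: And3 _ a _ := uW in a).
  have uVW := unit_nbhdI uV uW.
  exists (V `&` W); split => //; first by move=> x [_ /WU].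
  have e0 : 0 < (3 / 4 : R) ^+ k / 2 by rewrite divr_gt0// exprn_gt0// divr_gt0.
  apply: evS (evI IH (ev_defect 1 1 e0)) => F [h1 h2] w [Vw Ww].
  rewrite set_pow1 in h2; have := h2 w w (WU _ Ww) (WU _ Ww).
  have := h1 _ (VW w w Vw Vw); rewrite exprS.
  rewrite !ler_norml => /andP[a1 a2] /andP[b1 b2]; apply/andP; split; lra.
move=> e0.
have [k hk] : exists k, (3 / 4 : R) ^+ k <= eps.
  have : (fun n => (3 / 4 : R) ^+ n) @ \oo --> (0 : R).
    by apply: cvg_expr; rewrite ger0_norm ?divr_ge0// ltr_pdivrMr// mul1r ltr_nat.
  move/cvgrPdist_le => /(_ _ e0)[k _ hk]; exists k.
  have := hk k (leqnn _); rewrite /= sub0r normrN; apply: le_trans.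
  exact: ler_norm.
have [W [uW _ hW]] := H k; exists W => //.
by apply: evS hW => F hF w /hF h; exact: le_trans hk.
Qed.

Lemma Zclosure g : closure [set g | Z g] g -> Z g.
Proof.
move=> cg eps e0; have e3 : 0 < eps / 3 by rewrite divr_gt0.
have [W [oW W1 iW] hW] := ev_small_nbhd e3.
have : nbhs g [set x | W (x^-1 * g)%g].
  apply: open_nbhs_nbhs; split; last by rewrite /= mulVg.
  apply: (@open_comp _ _ (fun x => (x^-1 * g)%g) W) => // x _.
  apply: (@continuous_mulg G G (fun x => x^-1)%g (fun=> g)).
    exact: invg_continuous.
  by move=> ?; exact: cvg_cst.
move=> /cg[x [/= Zx Wx]].
have [m Ux] := set_pow_cover hU x; have [n Uh] := set_pow_cover hU (x^-1 * g)%g.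
apply: evS (evI (evI (Zx _ e3) hW) (ev_defect m.+1 n.+1 e3)).
move=> F [[h1 h2] h3]; have {h3} := h3 _ _ Ux Uh; have {h2} := h2 _ Wx; move: h1.
rewrite mulVKg.
rewrite !ler_norml => /andP[a1 a2] /andP[b1 b2] /andP[c1 c2].
apply/andP; split; lra.
Qed.

Lemma Zclosed_commutator g : closed_commutator g -> Z g.
Proof.
move=> cg; apply: Zclosure; apply: closureS cg.
apply: smallest_sub; first exact: Zsubgroup.
by move=> _ [x _ [y _ <-]]; exact: Zcomm.
Qed.

Let L (a : A) := exists2 g, Z g & sc g = a.

Let L0 : L 0.
Proof. by exists 1%g; [exact: Z1|exact: split_coord1]. Qed.

Let LD a b : L a -> L b -> L (a + b).
Proof.
by move=> [g Zg <-] [h Zh <-]; exists (g * h)%g; [exact: ZM|exact: split_coordM].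
Qed.

Let LN a : L a -> L (- a).
Proof.
by move=> [g Zg <-]; exists (g^-1)%g; [exact: ZV|exact: split_coordV].
Qed.

Let Lbasis i : L (basis_coord i).
Proof.
by exists (e i) => // eps e0; exists 1 => // F [_ _ ->]; rewrite normr0 ltW.
Qed.

(** Products and inverses of negligible elements reach only the integer combinations of the basis
    vectors; the fractional parts of the real coordinates are left to compactness in [Z_all]. *)
Let L_int (k : 'I_q -> int) (z : 'rV[discrete_topology int]_r) :
  L (\row_j (k j)%:~R, z, 0).
Proof.
have L1 (v : 'rV[R]_q) : (forall j, exists c : int, v ord0 j = c%:~R) -> L (v, 0, 0).
  move=> hv; rewrite (row_sum_delta v).
  have P0 : L (0 : 'rV[R]_q, 0, 0) by exact: L0.
  have PD (y w : 'rV[R]_q) : L (y, 0, 0) -> L (w, 0, 0) -> L (y + w, 0, 0).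
    move=> Ly Lw; have := LD Ly Lw.
    by rewrite [X in L X -> _]surjective_pairing
      [X in L (X, _) -> _]surjective_pairing /= !addr0.
  have PN (y : 'rV[R]_q) : L (y, 0, 0) -> L (- y, 0, 0).
    move=> Ly; have := LN Ly.
    by rewrite [X in L X -> _]surjective_pairing
      [X in L (X, _) -> _]surjective_pairing /= !oppr0.
  apply: (big_ind (fun v : 'rV[R]_q => L (v, 0, 0))) => // j _.
  have [c ->] := hv j; rewrite scaler_int.
  apply: (zmod_closed_mulz (P := fun v : 'rV[R]_q => L (v, 0, 0))) => //.
  by have := Lbasis (lshift r j); rewrite /basis_coord (unsplitK (inl j)).
have L2 : L (0, z, 0).
  have P0 : L (0, (0 : 'rV[int]_r) : 'rV[discrete_topology int]_r, 0) by exact: L0.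
  have PD (y w : 'rV[int]_r) :
      L (0, y : 'rV[discrete_topology int]_r, 0) ->
      L (0, w : 'rV[discrete_topology int]_r, 0) ->
      L (0, (y + w : 'rV[int]_r) : 'rV[discrete_topology int]_r, 0).
    move=> Ly Lw; have := LD Ly Lw.
    by rewrite [X in L X -> _]surjective_pairing
      [X in L (X, _) -> _]surjective_pairing /= !addr0.
  have PN (y : 'rV[int]_r) : L (0, y : 'rV[discrete_topology int]_r, 0) ->
      L (0, (- y : 'rV[int]_r) : 'rV[discrete_topology int]_r, 0).
    move=> Ly; have := LN Ly.
    by rewrite [X in L X -> _]surjective_pairing
      [X in L (X, _) -> _]surjective_pairing /= !oppr0.
  have -> : z = \sum_j (z ord0 j : int) *: (delta_mx ord0 j : 'rV[int]_r).
    exact: (row_sum_delta (z : 'rV[int]_r)).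
  apply: (big_ind (fun v : 'rV[int]_r =>
    L (0, v : 'rV[discrete_topology int]_r, 0))) => // j _.
  rewrite -[z ord0 j]intz scaler_int.
  apply: (zmod_closed_mulz (P := fun v : 'rV[int]_r =>
    L (0, v : 'rV[discrete_topology int]_r, 0))) => //.
  by have := Lbasis (rshift q j); rewrite /basis_coord (unsplitK (inr j)).
have := LD (L1 (\row_j (k j)%:~R) _) L2.
rewrite [X in L X]surjective_pairing [X in L (X, _)]surjective_pairing /= !addr0 add0r.
by apply=> j; exists (k j); rewrite mxE.
Qed.

Lemma ev_expg g n eps : 0 < eps -> ev (fun F => `|F (g ^+ n)%g - n%:R * F g| <= eps).
Proof.
elim: n eps => [|n IH] eps e0.
  by apply: evS ev1 => F; rewrite expg0 mul0r subr0 => ->; rewrite normr0 ltW.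
have e2 : 0 < eps / 2 by rewrite divr_gt0.
have [m Ug] := set_pow_cover hU g.
apply: evS (evI (IH _ e2) (ev_defect m.+1 (n * m.+1) e2)) => F [h1 h2].
have := h2 g (g ^+ n)%g Ug (set_pow_expg n Ug); move: h1; rewrite -expgS.
rewrite -[n.+1]addn1 natrD.
rewrite !ler_norml => /andP[a1 a2] /andP[b1 b2]; apply/andP; split; lra.
Qed.

(** For every n, g^n = p * x * z: p is negligible and carries the integer parts of the coordinates
    of g^n, x lies over the unit cube times M and hence in a power of U that does not depend on n,
    and z lies in G_0. Therefore n * F g is eventually bounded by a constant independent of n, and n
    is taken large. *)
Lemma Z_all g : Z g.
Proof.
move=> eps e0.
pose Q : set A := ([set v : 'rV[R]_q | forall j, `[0, 1]%classic (v ord0 j)] `*`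
  [set (0 : 'rV[discrete_topology int]_r)]) `*` [set: split_M s].
have cQ : compact Q.
  apply: compact_setX; last exact: split_M_compact.
  apply: compact_setX; last exact: compact_set1.
  apply: (@rV_compact R q (fun=> `[0%R, 1%R]%classic : set R)) => _.
  exact: segment_compact.
have [||a _|N QN] := @compact_exhaust A Q (fun n => [set sc x | x in set_pow U n.+1]) cQ.
- by move=> n; apply: open_split_coord; exact: open_set_pow.
- by move=> m n mn _ [x Ux <-]; exists x => //; exact: (set_pow_leq U1 _ Ux).
- have [x <-] := split_coord_surj a.
  by have [n Ux] := set_pow_cover hU x; exists n; exists x.
(* C bounds F x by [quasi_hom_bound] with |F| <= 1 on U and defect 1. The 5 added below collects
   five errors of size 1: that of g^n, the values at p and z, and the defects of the two
   products. *)
pose C : R := N.+1%:R + N.+1%:R ^+ 2.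
have [n n0 hn] : exists2 n : nat, (0 < n)%N & C + 5 <= eps * n%:R.
  exists (Num.truncn ((C + 5) / eps)).+1 => //.
  by rewrite mulrC -ler_pdivrMr// ltW// Num.Theory.truncnS_gt.
pose a := sc g.
have [p Zp pE] := L_int (fun j => Num.floor (n%:R * a.1.1 ord0 j)) (a.1.2 *+ n).
have [x Ux xE] : [set sc x | x in set_pow U N.+1] (sc (g ^+ n)%g - sc p).
  apply: QN; rewrite split_coordX pE -/a !pair_mulrn /=.
  split => //; split => /=; last by rewrite subrr.
  move=> j; rewrite !mxE mulmxnE /= in_itv /= subr_ge0 -[X in _ <= X]mulr_natl -[X in X - _]mulr_natl.
  rewrite Num.Theory.floor_le_tmp /= lerBlDl ltW//.
  by have := Num.Theory.lt_succ_floor (n%:R * a.1.1 ord0 j); rewrite intrD.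
have [z cz gnE] : exists2 z, closed_commutator z & (g ^+ n = p * x * z)%g.
  apply: (@split_coord_inj R G s); rewrite split_coordM xE addrC subrK.
  by [].
have [mp Up] := set_pow_cover hU p.
have [mz Uz] := set_pow_cover hU z.
have d1 : ev (normalized 1) by exists 1.
apply: evS (evI (evI (ev_expg g n ltr01) d1) (evI (evI (Zp 1 ltr01)
  (Zclosed_commutator cz ltr01)) (evI (ev_defect mp.+1 N.+1 ltr01)
  (ev_defect (mp.+1 + N.+1) mz.+1 ltr01)))).
move=> F [[h1 [hF F1 _]] [[h2 h3] [h4 h5]]].
have h6 := quasi_hom_bound ler01 hF F1 Ux; rewrite mulr1 mul1r -/C in h6.
have := h4 _ _ Up Ux; have := h5 _ _ (set_pow_mul Up Ux) Uz; rewrite -gnE.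
have n0' : 0 < n%:R :> R by rewrite ltr0n.
move: h1 h2 h3 h6; rewrite !ler_norml => /andP[a1 a2] /andP[b1 b2] /andP[c1 c2].
move=> /andP[d1' d2] /andP[f1 f2] /andP[k1 k2].
by apply/andP; split; rewrite -(ler_pM2l n0'); lra.
Qed.

Lemma ev_seq (P : G -> (G -> R) -> Prop) (t : seq G) : (forall x, ev (P x)) ->
  ev (fun F => forall x, x \in t -> P x F).
Proof.
move=> hP; elim: t => [|x t IH]; first by exists 1.
by apply: evS (evI (hP x) IH) => F [h1 h2] y; rewrite inE => /predU1P[->|/h2].
Qed.

(** Finitely many translates y W of a neighborhood on which F is small cover the closure of U. The
    value at y, the value on W and the defect of their product contribute 1/6 each. *)
Lemma ev_contract : ev (fun F => forall u, U u -> `|F u| <= 1 / 2).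
Proof.
have cU : compact (closure U) by rewrite -precompactE; case: hU.
have e6 : 0 < 1 / 6 :> R by rewrite divr_gt0.
have [W [oW W1 iW] hW] := ev_small_nbhd e6.
have [t ht] : exists t : seq G, forall x, closure U x ->
    exists2 y, y \in t /\ closure U y & W (y^-1 * x)%g.
  apply: (@compact_finite_cover G (closure U) (fun y x => W (y^-1 * x)%g)) => // x _.
  by apply: open_nbhs_nbhs; split; [exact: open_mulgl|rewrite /= mulVg].
have [m Um] := compact_set_pow hU cU.
have UU u : U u -> set_pow U m.+1 u by move=> Uu; apply/Um/subset_closure.
have hd : ev (fun F => forall y, y \in t -> `|F y| <= 1 / 6).
  by apply: ev_seq => x; exact: Z_all.
apply: evS (evI (evI hW hd) (ev_defect m.+1 (m.+1 + m.+1) e6)).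
move=> F [[h1 h2] h3] u Uu; have [y [yt cy] Wy] := ht u (subset_closure Uu).
have := h3 y (y^-1 * u)%g (Um _ cy) (set_pow_mul (set_pow_inv iU (Um _ cy)) (UU _ Uu)).
rewrite mulVKg; have := h2 y yt; have := h1 _ Wy.
rewrite !ler_norml => /andP[a1 a2] /andP[b1 b2] /andP[c1 c2].
apply/andP; split; lra.
Qed.

Lemma quasi_homD D F F' : quasi_hom D F ->
  (forall g h, F' (g * h)%g = F' g + F' h) -> quasi_hom D (fun g => F g - F' g).
Proof.
move=> hF hF' i j g h Ug Uh; have := hF i j g h Ug Uh; rewrite hF'.
by congr (`| _ | <= _); lra.
Qed.

Definition linear_part F g := \sum_i F (e i) * split_component s i g.

Lemma linear_partM F g h :
  linear_part F (g * h)%g = linear_part F g + linear_part F h.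
Proof.
by rewrite -big_split; apply: eq_bigr => i _; rewrite split_componentM mulrDr.
Qed.

Lemma linear_part_basis F k : linear_part F (e k) = F (e k).
Proof.
rewrite /linear_part (bigD1 k)//= split_component_basis eqxx mulr1 big1 ?addr0// => i ik.
by rewrite split_component_basis (negbTE ik) mulr0.
Qed.

Lemma linear_part_bounded F : exists M, forall u, U u -> `|linear_part F u| <= M.
Proof.
have cU : compact (closure U) by rewrite -precompactE; case: hU.
have /choice[M hM] : forall i, exists M, forall u, closure U u ->
    `|split_component s i u| <= M.
  by move=> i; apply: compact_norm_bounded => //; exact: split_component_continuous.
exists (\sum_i `|F (e i)| * M i) => u Uu.
apply: le_trans (ler_norm_sum _ _ _) _; apply: ler_sum => i _.
by rewrite normrM ler_wpM2l// hM//; exact: subset_closure.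
Qed.

(* Normalizing by the supremum on [U], the defect becomes small unless the
   supremum is controlled by it; [ev_contract] excludes the former. *)
Lemma quasi_hom_stability : exists2 C, 0 < C &
  forall D F n g, 0 <= D -> quasi_hom D F ->
    (exists M, forall u, U u -> `|F u| <= M) -> set_pow U n g ->
    `|F g - linear_part F g| <= C * D * n%:R ^+ 2.
Proof.
have [d d0 hd] := ev_contract.
(* The part d^-1 comes from the bound D / d for F minus its linear part on U, the 1 from the defects
   accumulated along a word. *)
exists (d^-1 + 1); first by rewrite addr_gt0// invr_gt0.
move=> D F n g D0 hF [M1 hM1] Ug.
have [M2 hM2] := linear_part_bounded F.
pose F' g := F g - linear_part F g.
have hF' : quasi_hom D F' by apply: quasi_homD => // x y; exact: linear_partM.
have F'e i : F' (e i) = 0 by rewrite /F' linear_part_basis subrr.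
pose S := [set `|F' u| | u in U].
have S1 : has_sup S.
  split; first by exists `|F' 1%g|; exists 1%g.
  exists (M1 + M2) => _ [u Uu <-]; apply: le_trans (ler_normB _ _) _.
  by apply: lerD; [exact: hM1|exact: hM2].
pose M := sup S.
have MU u : U u -> `|F' u| <= M by move=> Uu; apply: ub_le_sup; [case: S1|exists u].
have M0 : 0 <= M by apply: le_trans (MU _ U1).
have MD : M <= d^-1 * D.
  rewrite leNgt; apply/negP => lt.
  have Mgt : 0 < M by apply: le_lt_trans lt; rewrite mulr_ge0// invr_ge0 ltW.
  have nF : normalized d (fun g => M^-1 * F' g).
    split.
    - move=> i j x y Ux Uy; rewrite -!mulrBr normrM gtr0_norm ?invr_gt0//.
      rewrite ler_pdivrMl//; apply: le_trans (hF' i j x y Ux Uy) _.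
      rewrite [M * _]mulrA ler_wpM2r ?mulr_ge0//.
      by rewrite ltW// -ltr_pdivrMr// mulrC.
    - by move=> u Uu; rewrite normrM gtr0_norm ?invr_gt0// ler_pdivrMl// mulr1 MU.
    - by move=> i; rewrite F'e mulr0.
  have : M <= M / 2.
    apply: ge_sup; first by case: S1.
    move=> _ [u Uu <-]; have := hd _ nF u Uu.
    by rewrite normrM gtr0_norm ?invr_gt0// ler_pdivrMl// mul1r.
  by rewrite ler_pdivlMr// mulr_natr mulr2n gerDr leNgt Mgt.
have := quasi_hom_bound D0 hF' MU Ug; rewrite -/(F' g) => /le_trans; apply.
have [->|n0] := eqVneq n 0%N; first by rewrite mul0r expr0n/= !mulr0 addr0.
have n1 : 1 <= n%:R :> R by rewrite ler1n lt0n.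
apply: (@le_trans _ _ (n%:R * (d^-1 * D) + D * n%:R ^+ 2)).
  by rewrite lerD2r ler_wpM2l.
have dD : 0 <= d^-1 * D by rewrite mulr_ge0// invr_ge0 ltW.
have -> : (d^-1 + 1) * D * n%:R ^+ 2 = n%:R ^+ 2 * (d^-1 * D) + D * n%:R ^+ 2.
  by set c := d^-1; ring.
by rewrite lerD2r ler_wpM2r// ler_eXnr.
Qed.

End QuasiHomomorphisms.

(** * Averages over the law K dg *)

Section Averaging.
Variables (R : realType) (G : topologicalGroupType).
Implicit Types (g h x y : G).
Local Notation B := (borel G).
Hypothesis hG : hausdorff_space G.
Variable U : set G.
Hypothesis hU : generating_nbhd U.
Variable mu : {measure set B -> \bar R}.
Hypothesis hmu : left_haar_measure mu.
Variable Delta : G -> R.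
Hypothesis hDelta : modular_function mu Delta.
Variable K : G -> R.
Hypothesis mK : measurable_fun [set: B] (K : B -> R).
Hypothesis K0 : forall g, 0 <= K g.
Hypothesis K1 : (\int[mu]_g (K g)%:E = 1)%E.
Local Open Scope ereal_scope.

Local Notation nu := (density_measure mu mK).

Lemma integral_law (f : B -> \bar R) : measurable_fun setT f ->
  (forall x, 0 <= f x) -> \int[nu]_x f x = \int[mu]_x ((K x)%:E * f x).
Proof. by move=> mf f0; rewrite integral_density. Qed.

Lemma lawT : nu setT = 1.
Proof.
by rewrite /= /with_density -K1; apply: eq_integral => x _; rewrite ger0_norm.
Qed.

Lemma law_sigma_finite : sigma_finite setT nu.
Proof.
exists (fun=> setT); first by rewrite bigcup_const.
by move=> _; split => //; rewrite lawT ltry.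
Qed.

Lemma integral_law_cst (c : \bar R) : \int[nu]_x c = c.
Proof. by rewrite (integral_cst nu measurableT c) lawT mule1. Qed.

Lemma le_integral_law (f f' : B -> \bar R) :
  measurable_fun setT f -> measurable_fun setT f' ->
  (forall x, 0 <= f x) -> (forall x, 0 <= f' x) ->
  (forall x, K x != 0%R -> f x <= f' x) -> \int[nu]_x f x <= \int[nu]_x f' x.
Proof.
move=> mf mf' f0 f'0 ff'; rewrite !integral_law//.
have mKE : measurable_fun setT (fun x : B => (K x)%:E) by exact/measurable_EFinP.
apply: ge0_le_integral => //.
- by move=> x _; rewrite mule_ge0// lee_fin.
- exact: emeasurable_funM.
- exact: emeasurable_funM.
- move=> x _; have [->|Kx] := eqVneq (K x) 0%R; first by rewrite !mul0e.
  by rewrite lee_wpmul2l// ?lee_fin// ff'.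
Qed.

Lemma ae_law (P : G -> Prop) : {ae mu, forall x : B, P x} -> {ae nu, forall x : B, P x}.
Proof.
move=> [N [mN N0 sN]]; exists N; split => //=.
rewrite /with_density; apply: null_set_integral => //.
by apply/measurable_EFinP/measurable_funTS; exact: measurableT_comp.
Qed.

Lemma measurable_divg d (T : measurableType d) (f : G -> T) g :
  measurable_fun [set: B] (f : B -> T) ->
  measurable_fun [set: B] (fun h : B => f (h^-1 * g)%g).
Proof.
move=> mf; apply: (measurableT_comp mf (g := fun h : B => (h^-1 * g)%g : B)).
apply: continuous_borel; apply: continuous_mulg; first exact: invg_continuous.
by move=> ?; exact: cvg_cst.
Qed.

(** This is T on functions with values in [0, +oo], where it is defined, monotone and additive
    without integrability and can be iterated freely. *)
Definition avg (f : G -> \bar R) (g : G) : \bar R := \int[nu]_h f (h^-1 * g)%g.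

Lemma avg_ge0 f g : (forall x, 0 <= f x) -> 0 <= avg f g.
Proof. by move=> f0; exact: integral_ge0. Qed.

Lemma ae_eq_avg (f f' : G -> \bar R) g :
  measurable_fun [set: B] (f : B -> \bar R) ->
  measurable_fun [set: B] (f' : B -> \bar R) ->
  (forall x, 0 <= f x) -> (forall x, 0 <= f' x) ->
  {ae mu, forall x : B, f x = f' x} -> avg f g = avg f' g.
Proof.
move=> mf mf' f0 f'0 ff'; apply: ge0_ae_eq_integral => //.
- exact: measurable_divg.
- exact: measurable_divg.
- have := ae_law (ae_divg hmu hDelta g ff').
  by apply: filterS => x + _.
Qed.

Lemma tonelli_law (f : B * B -> \bar R) : measurable_fun setT f ->
  (forall z, 0 <= f z) ->
  \int[mu]_g \int[nu]_h f (h, g) = \int[nu]_h \int[mu]_g f (h, g).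
Proof.
move=> mf f0; apply/esym; apply: tonelli => //.
- exact: law_sigma_finite.
- exact: (haar_sigma_finite hG hU hmu).
Qed.

Lemma measurable_int_law (f : B * B -> \bar R) : measurable_fun setT f ->
  (forall z, 0 <= f z) -> measurable_fun setT (fun g : B => \int[nu]_h f (h, g)).
Proof. by move=> mf f0; apply: measurable_tonelli2 => //; exact: law_sigma_finite. Qed.

Lemma measurable_int_haar (f : B * B -> \bar R) : measurable_fun setT f ->
  (forall z, 0 <= f z) -> measurable_fun setT (fun h : B => \int[mu]_g f (h, g)).
Proof.
by move=> mf f0; apply: measurable_tonelli1 => //; exact: (haar_sigma_finite hG hU hmu).
Qed.

(** A version of f that is measurable on the product has the same average at every point, so
    Tonelli's theorem applied to the version settles the question for f. *)
Lemma measurable_avg f : measurable_fun [set: B] (f : B -> \bar R) ->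
  (forall x, 0 <= f x) -> measurable_fun [set: B] (avg f : B -> \bar R).
Proof.
move=> mf f0.
have [f' [mf' f'0 ff']] := ge0_ae_div_measurable hU hG hmu mf f0.
rewrite (_ : avg f = avg f'); last first.
  apply/funext => g; apply: ae_eq_avg => //. exact: div_measurable_borel.
exact: (measurable_int_law (f := fun p => f' (p.1^-1 * p.2)%g)).
Qed.

Lemma integral_avg f : measurable_fun [set: B] (f : B -> \bar R) ->
  (forall x, 0 <= f x) -> \int[mu]_g avg f g = \int[mu]_g f g.
Proof.
move=> mf f0.
have [f' [mf' f'0 ff']] := ge0_ae_div_measurable hU hG hmu mf f0.
have mf'B := div_measurable_borel mf'.
rewrite (_ : avg f = avg f'); last by apply/funext => g; exact: ae_eq_avg.
rewrite (tonelli_law (f := fun p => f' (p.1^-1 * p.2)%g))//.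
under eq_integral => h _ do rewrite /= (integral_mulgl hmu (h^-1)%g mf'B)//.
rewrite integral_law_cst; apply: ge0_ae_eq_integral => //.
by apply: filterS ff' => x -> _.
Qed.

End Averaging.

(** * The spectral gap *)

Section SpectralGap.
Variables (R : realType) (G : topologicalGroupType).
Implicit Types (g h x y z : G).
Local Notation B := (borel G).
Hypothesis hG : hausdorff_space G.
Variable U : set G.
Hypothesis hU : generating_nbhd U.
Variable mu : {measure set B -> \bar R}.
Hypothesis hmu : left_haar_measure mu.
Local Open Scope ereal_scope.

Definition sq_diff (f : G -> R) (z : G) : \bar R :=
  \int[mu]_g ((f (z^-1 * g)%g - f g) ^+ 2)%:E.

Lemma sq_diff_ge0 f z : 0 <= sq_diff f z.
Proof. by apply: integral_ge0 => x _; rewrite lee_fin sqr_ge0. Qed.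

Lemma measurable_mulgl_comp d (T : measurableType d) (f : G -> T) x :
  measurable_fun [set: B] (f : B -> T) ->
  measurable_fun [set: B] (fun g : B => f (x * g)%g).
Proof. by move=> mf; exact: (measurableT_comp mf (measurable_mulgl x)). Qed.

Lemma measurable_sqB (d : measure_display) (T : measurableType d) (f1 f2 : T -> R) :
  measurable_fun setT f1 -> measurable_fun setT f2 ->
  measurable_fun setT (fun x : T => ((f1 x - f2 x) ^+ 2)%:E).
Proof.
by move=> m1 m2; apply/measurable_EFinP/measurable_funX; exact: measurable_funB.
Qed.

Lemma sq_diff_pair f x y : measurable_fun [set: B] (f : B -> R) ->
  \int[mu]_g ((f (x^-1 * g)%g - f (y^-1 * g)%g) ^+ 2)%:E = sq_diff f (y^-1 * x)%g.
Proof.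
move=> mf; rewrite -(integral_mulgl hmu y) /=.
- by apply: eq_integral => g _; rewrite mulKg invgM invgK mulgA.
- by apply: measurable_sqB; exact: measurable_mulgl_comp.
- by move=> g; rewrite lee_fin sqr_ge0.
Qed.

Lemma sq_diffV f x : measurable_fun [set: B] (f : B -> R) ->
  sq_diff f (x^-1)%g = sq_diff f x.
Proof.
move=> mf; rewrite -{1}(mulg1 (x^-1)%g) -sq_diff_pair//.
by apply: eq_integral => g _; rewrite invg1 mul1g -sqrrN opprB.
Qed.

Lemma sq_diffM f x y : measurable_fun [set: B] (f : B -> R) ->
  sq_diff f (x * y)%g <= 2%:E * sq_diff f x + 2%:E * sq_diff f y.
Proof.
move=> mf.
have -> : sq_diff f y =
    \int[mu]_g ((f (y^-1 * (x^-1 * g))%g - f (x^-1 * g)%g) ^+ 2)%:E.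
  rewrite /sq_diff -(integral_mulgl hmu (x^-1)%g) //=.
  by apply: measurable_sqB => //; exact: measurable_mulgl_comp.
  by move=> g; rewrite lee_fin sqr_ge0.
have m1 : measurable_fun [set: B] (fun g : B => ((f (x^-1 * g)%g - f g) ^+ 2)%:E).
  by apply: measurable_sqB => //; exact: measurable_mulgl_comp.
have m2 : measurable_fun [set: B]
    (fun g : B => ((f (y^-1 * (x^-1 * g))%g - f (x^-1 * g)%g) ^+ 2)%:E).
  apply: measurable_sqB; last exact: measurable_mulgl_comp.
  by apply: (measurable_mulgl_comp (f := fun g => f (y^-1 * g)%g));
    exact: measurable_mulgl_comp.
rewrite -!ge0_integralZl//; try by move=> g _; rewrite lee_fin sqr_ge0.
rewrite -ge0_integralD//; first last.
- exact: measurable_funeM.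
- by move=> g _; rewrite mule_ge0// lee_fin sqr_ge0.
- exact: measurable_funeM.
- by move=> g _; rewrite mule_ge0// lee_fin sqr_ge0.
apply: ge0_le_integral => //.
- by move=> g _; rewrite lee_fin sqr_ge0.
- by apply: measurable_sqB => //; exact: measurable_mulgl_comp.
- by apply: emeasurable_funD; exact: measurable_funeM.
- move=> g _; rewrite -!EFinM -EFinD lee_fin invgM -mulgA.
  set a := f _; set b := f (x^-1 * g)%g; set c := f g.
  have := sqr_ge0 ((a - b) - (b - c))%R; nra.
Qed.

Lemma div_measurable_sq_diff f : div_measurable f -> div_measurable (sq_diff f).
Proof.
move=> mf; have mfB := div_measurable_borel mf.
rewrite /div_measurable.
have -> : (fun p : B * B => sq_diff f (p.1^-1 * p.2)%g) =
    (fun p : B * B => \int[mu]_g ((f (p.2^-1 * g)%g - f (p.1^-1 * g)%g) ^+ 2)%:E).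
  by apply/funext => -[x y] /=; rewrite sq_diff_pair.
apply: (measurable_tonelli1 (haar_sigma_finite hG hU hmu)
  (f := fun z : (B * B) * B =>
    ((f (z.1.2^-1 * z.2)%g - f (z.1.1^-1 * z.2)%g) ^+ 2)%:E)).
  apply: measurable_sqB.
  - apply: (measurableT_comp mf (g := fun z : (B * B) * B => (z.1.2, z.2))).
    apply: measurable_fun_pair => //.
    exact: (measurableT_comp measurable_snd measurable_fst).
  - apply: (measurableT_comp mf (g := fun z : (B * B) * B => (z.1.1, z.2))).
    apply: measurable_fun_pair => //.
    exact: (measurableT_comp measurable_fst measurable_fst).
by move=> z; rewrite lee_fin sqr_ge0.
Qed.

Variable K : G -> R.
Hypothesis mK : measurable_fun [set: B] (K : B -> R).
Hypothesis K0 : (forall g, 0 <= K g)%R.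
Hypothesis K1 : \int[mu]_g (K g)%:E = 1.
Local Notation nu := (density_measure mu mK).

(** By [sq_diff_pair] the integrand is the squared L^2 distance of L(h) f and L(k) f, so this is the
    double integral of the variance identity at lambda = 0. *)
Definition energy (f : G -> R) : \bar R :=
  \int[nu]_k \int[nu]_h sq_diff f (k^-1 * h)%g.

Lemma energy_ge0 f : 0 <= energy f.
Proof.
by apply: integral_ge0 => x _; apply: integral_ge0 => y _; exact: sq_diff_ge0.
Qed.

Variables (W : set G) (kappa : R).
Hypothesis hW : generating_nbhd W.
Hypothesis kappa0 : (0 < kappa)%R.
Hypothesis kappaW : forall g, W g -> (kappa <= K g)%R.

Let oW : open W. Proof. by case: hW. Qed.
Let W1 : W 1%g. Proof. by case: hW. Qed.
Let mW : measurable (W : set B). Proof. exact: open_borel. Qed.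

Lemma law_lower (f : B -> \bar R) (D : set G) : measurable (D : set B) -> D `<=` W ->
  measurable_fun setT f -> (forall x, 0 <= f x) ->
  kappa%:E * \int[mu]_(x in D) f x <= \int[nu]_x f x.
Proof.
move=> mD DW mf f0; rewrite integral_law//.
rewrite -ge0_integralZl//; [|exact: measurable_funTS|by rewrite lee_fin ltW].
have mKE : measurable_fun setT (fun x : B => (K x)%:E) by exact/measurable_EFinP.
apply: (@le_trans _ _ (\int[mu]_(x in D) ((K x)%:E * f x))).
  apply: ge0_le_integral => //.
  - by move=> x _; rewrite mule_ge0// lee_fin ltW.
  - by apply: measurable_funeM; exact: measurable_funTS.
  - by apply: measurable_funTS; exact: emeasurable_funM.
  - by move=> x Dx; rewrite lee_wpmul2r// lee_fin kappaW//; exact: DW.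
apply: ge0_subset_integral => //; first exact: emeasurable_funM.
by move=> x _; rewrite mule_ge0// lee_fin.
Qed.

(** The outer integral is restricted to D and the inner one to W, where K >= kappa. The error term a
    stays on the larger side, since it may be infinite and cannot be subtracted. *)
Lemma energy_lower f (D : set G) (a c : \bar R) : measurable (D : set B) ->
  D `<=` W -> div_measurable f -> 0 <= a ->
  (forall y, D y -> c <= a + kappa%:E * \int[mu]_(x in W) sq_diff f (y^-1 * x)%g) ->
  kappa%:E * (c * mu D) <= kappa%:E * (a * mu D) + energy f.
Proof.
move=> mD DW mf a0 hc; have msd := div_measurable_sq_diff mf.
have mfix y : measurable_fun [set: B] (fun x : B => sq_diff f (y^-1 * x)%g).
  by apply: measurable_mulgl_comp; exact: div_measurable_borel.
have mnu : measurable_fun [set: B] (fun y : B => \int[nu]_x sq_diff f (y^-1 * x)%g).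
  apply: (measurable_tonelli1 (law_sigma_finite mK K0 K1)
    (f := fun p : B * B => sq_diff f (p.1^-1 * p.2)%g)) => // z.
  exact: sq_diff_ge0.
have Y0 y : 0 <= \int[nu]_x sq_diff f (y^-1 * x)%g.
  by apply: integral_ge0 => x _; exact: sq_diff_ge0.
apply: le_trans (leeD2l _ (law_lower mD DW mnu Y0)).
rewrite -ge0_muleDr ?mule_ge0 ?integral_ge0//.
apply: lee_wpmul2l; first by rewrite lee_fin ltW.
have [c0|c0] := leP c 0.
  apply: (@le_trans _ _ 0); first by rewrite mule_le0_ge0.
  by rewrite adde_ge0 ?mule_ge0 ?integral_ge0.
rewrite -!(integral_cst mu mD) -ge0_integralD//; last exact: measurable_funTS.
apply: ge0_le_integral => //.
- by move=> y _; exact: ltW.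
- by apply: emeasurable_funD => //; exact: measurable_funTS.
- move=> y Dy; apply: le_trans (hc y Dy) _; apply: leeD2l.
  apply: law_lower => // x; exact: sq_diff_ge0.
Qed.

(** If y and z lie in V then y * z lies in W, so the energy is at least kappa^2 * mu V times the
    integral of [sq_diff f] over V. The value at a single w is recovered by integrating sq_diff f w
    <= 2 sq_diff f (w * z) + 2 sq_diff f z over z in V', where z and w * z both stay in V; hence the
    factor 4. *)
Lemma sq_diff_small : exists V C, [/\ unit_nbhd V, V `<=` W, V `<=` U, (0 <= C)%R &
  forall f, div_measurable f -> forall w, V w -> sq_diff f w <= C%:E * energy f].
Proof.
have uU := generating_unit_nbhd hU; have uW := generating_unit_nbhd hW.
have [oUW UW1 iUW] := unit_nbhdI uU uW.
have [V uV VV] := unit_nbhd_shrink oUW UW1; have [oV V1 iV] := uV.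
have [V' uV' V'V] := unit_nbhd_shrink oV V1; have [oV' V'1 iV'] := uV'.
have VUW x : V x -> (U `&` W) x by move=> Vx; have := VV _ _ Vx V1; rewrite mulg1.
have V'V1 x : V' x -> V x by move=> Vx; have := V'V _ _ Vx V'1; rewrite mulg1.
have mV : measurable (V : set B) by exact: open_borel.
have mV' : measurable (V' : set B) by exact: open_borel.
have fin A : open A -> A `<=` U -> A 1%g -> exists2 m : R, (0 < m)%R & mu A = m%:E.
  move=> oA AU A1; have : mu A \is a fin_num.
    by rewrite ge0_fin_numE// (haar_nbhd hG hU hmu).
  move=> /fineK muA; exists (fine (mu A)) => //.
  by rewrite -lte_fin muA (haar_open hU hmu)//; exists 1%g.
have [m m0 mE] : exists2 m : R, (0 < m)%R & mu V = m%:E.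
  by apply: fin => // x /VUW[].
have [m' m'0 m'E] : exists2 m : R, (0 < m)%R & mu V' = m%:E.
  by apply: fin => // x /V'V1/VUW[].
exists V', (4 / (kappa ^+ 2 * m * m'))%R; split => //.
- by move=> x /V'V1/VUW[].
- by move=> x /V'V1/VUW[].
- by rewrite divr_ge0// !mulr_ge0// ?sqr_ge0// ltW.
move=> f mf w Vw; have mfB := div_measurable_borel mf.
have mn : measurable_fun [set: B] (sq_diff f : B -> \bar R).
  by apply: div_measurable_borel; exact: div_measurable_sq_diff.
have n0 x := sq_diff_ge0 f x.
have h1 : kappa%:E * (kappa%:E * \int[mu]_(z in V) sq_diff f z * m%:E) <= energy f.
  rewrite -mE; have := @energy_lower f V 0 (kappa%:E * \int[mu]_(z in V) sq_diff f z) mV.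
  rewrite mul0e mule0 add0e; apply => // [x /VUW[]//|y Vy].
  rewrite add0e; apply: lee_wpmul2l; first by rewrite lee_fin ltW.
  rewrite -(integral_mulgl_set hmu (y^-1)%g mV)//.
  apply: ge0_subset_integral => //.
  - by rewrite -[X in measurable X]setTI; exact: measurable_mulgl.
  - by apply: measurable_funTS; exact: measurable_mulgl_comp.
  - by move=> x /= Vx; rewrite -(mulVKg y x); have [] := VV _ _ Vy Vx.
pose I := \int[mu]_(z in V) sq_diff f z.
have I0 : 0 <= I by exact: integral_ge0.
have h2 : sq_diff f w * m'%:E <= 4%:E * I.
  pose D := [set x | V' (w^-1 * x)%g].
  have mD : measurable (D : set B) by apply: open_borel; exact: open_mulgl.
  have DE : V' = (fun y => (w * y)%g) @^-1` D.
    by apply/seteqP; split => x; rewrite /D /= mulKg.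
  rewrite -m'E -(integral_cst mu mV').
  apply: (@le_trans _ _ (\int[mu]_(z in V')
      (2%:E * sq_diff f (w * z)%g + 2%:E * sq_diff f z))).
    have mwz : measurable_fun [set: B] (fun z : B => sq_diff f (w * z)%g).
      exact: measurable_mulgl_comp.
    apply: ge0_le_integral => //.
    - by move=> z _ /=.
    - by apply: measurable_funTS; apply: emeasurable_funD; exact: measurable_funeM.
    - move=> z _; rewrite -(sq_diffV z)// -{1}(mulgK z w); exact: sq_diffM.
  have mwz : measurable_fun [set: B] (fun z : B => sq_diff f (w * z)%g).
    exact: measurable_mulgl_comp.
  rewrite ge0_integralD//; first last.
  - by apply: measurable_funTS; exact: measurable_funeM.
  - by move=> z _; rewrite mule_ge0.
  - by apply: measurable_funTS; exact: measurable_funeM.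
  - by move=> z _; rewrite mule_ge0.
  rewrite !ge0_integralZl//; try exact: measurable_funTS.
  have -> : 4%:E * I = 2%:E * I + 2%:E * I :> \bar R.
    by rewrite -ge0_muleDl// -EFinD -natrD.
  apply: leeD; apply: lee_wpmul2l => //.
    rewrite {1}DE (integral_mulgl_set hmu w mD)//.
    apply: ge0_subset_integral => //; first exact: measurable_funTS.
    by move=> x; rewrite /D /= => Vx; rewrite -(mulVKg w x); exact: V'V.
  by apply: ge0_subset_integral => //; exact: measurable_funTS.
have k2m : (0 < kappa ^+ 2 * m)%R by rewrite mulr_gt0// exprn_gt0.
have h3 : I <= ((kappa ^+ 2 * m)^-1)%:E * energy f.
  rewrite lee_pdivlMl//; apply: le_trans h1; rewrite -/I.
  by rewrite expr2 !EFinM !muleA [X in _ <= X]muleAC.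
have h4 : sq_diff f w <= m'^-1%:E * (4%:E * I) by rewrite lee_pdivlMl// muleC.
apply: (le_trans h4).
apply: (@le_trans _ _ (m'^-1%:E * (4%:E * (((kappa ^+ 2 * m)^-1)%:E * energy f)))).
  by rewrite lee_wpmul2l ?lee_fin ?invr_ge0 ?(ltW m'0)// lee_wpmul2l.
rewrite !muleA -!EFinM le_eqVlt; apply/orP; left; apply/eqP; congr (_%:E * _).
by field; rewrite !lt0r_neq0.
Qed.

Definition energy_controlled (C : R) (g : G) :=
  forall f, div_measurable f -> sq_diff f g <= C%:E * energy f.

Lemma energy_controlled_le C C' g : (C <= C')%R ->
  energy_controlled C g -> energy_controlled C' g.
Proof.
move=> CC' hC f mf; apply: le_trans (hC f mf) _.
by rewrite lee_wpmul2r ?energy_ge0// lee_fin.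
Qed.

Lemma energy_controlledM C C' g h : (0 <= C)%R -> (0 <= C')%R ->
  energy_controlled C g -> energy_controlled C' h ->
  energy_controlled (2 * C + 2 * C') (g * h)%g.
Proof.
move=> C0 C'0 hg hh f mf; apply: le_trans (sq_diffM _ _ _) _.
  exact: div_measurable_borel.
have -> : (2 * C + 2 * C')%:E * energy f =
    2%:E * (C%:E * energy f) + 2%:E * (C'%:E * energy f).
  by rewrite !muleA -!EFinM -ge0_muleDl ?lee_fin ?mulr_ge0// -EFinD.
by apply: leeD; apply: lee_wpmul2l => //; [exact: hg|exact: hh].
Qed.

Lemma energy_controlledV C g : energy_controlled C g -> energy_controlled C (g^-1)%g.
Proof.
by move=> hg f mf; rewrite sq_diffV; [exact: hg|exact: div_measurable_borel].
Qed.

(** The controlled elements form a subgroup, so it suffices to treat w in W. Such a w need not be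
    near 1; it is written as y * (y^-1 * (w * o)) * o^-1 with y and o in a set D near 1 for which w
    D lies in W. By [sq_diffM] the outer factors cost 6 C in total and the middle one has
    coefficient 4. Integrating over y and o in D leaves an integral over pairs in W x W, which the
    energy dominates. *)
Lemma energy_controlled_all g : exists2 C, (0 <= C)%R & energy_controlled C g.
Proof.
have [V [C [uV VW VU C0 hC]]] := sq_diff_small; have [oV V1 iV] := uV.
have : generated W g by case: hW => _ _ _ _ ->.
apply: (@smallest_sub _ _ _ [set g | exists2 C, (0 <= C)%R & energy_controlled C g]).
  split.
  - by exists C => // f mf; exact: hC.
  - move=> x y [C1 C10 h1] [C2 C20 h2]; exists (2 * C1 + 2 * C2)%R.
      by rewrite addr_ge0 ?mulr_ge0.
    exact: energy_controlledM.
  - by move=> x [C1 C10 h1]; exists C1 => //; exact: energy_controlledV.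
move=> w Ww.
pose D := V `&` [set x | W (w * x)%g].
have oD : open D by apply: openI => //; exact: open_mulgl.
have mD : measurable (D : set B) by exact: open_borel.
have D1 : D 1%g by split => //=; rewrite mulg1.
have : mu D \is a fin_num.
  rewrite ge0_fin_numE// (haar_nbhd hG hU hmu)//.
  by move=> x [/VU].
move=> /fineK muD; set d := fine (mu D) in muD.
have d0 : (0 < d)%R by rewrite -lte_fin muD (haar_open hU hmu)//; exists 1%g.
exists (6 * C + 4 / (kappa ^+ 2 * d * d))%R.
  by rewrite addr_ge0// ?mulr_ge0// invr_ge0 !mulr_ge0// ?sqr_ge0 ?ltW.
move=> f mf; have mfB := div_measurable_borel mf.
have mn : measurable_fun [set: B] (sq_diff f : B -> \bar R).
  by apply: div_measurable_borel; exact: div_measurable_sq_diff.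
have n0 x := sq_diff_ge0 f x.
have E0 := energy_ge0 f.
have h1 y o : D y -> D o -> sq_diff f w <=
    (6 * C)%:E * energy f + 4%:E * sq_diff f (y^-1 * (w * o))%g.
  move=> [Vy _] [Vo _].
  have wE : (w = y * ((y^-1 * (w * o)) * o^-1))%g by rewrite !mulgA mulgV mul1g mulgK.
  rewrite {1}wE.
  set x := (y^-1 * _)%g.
  apply: le_trans (sq_diffM _ _ mfB) _.
  apply: (@le_trans _ _ (2%:E * (C%:E * energy f) +
      2%:E * (2%:E * sq_diff f x + 2%:E * (C%:E * energy f)))).
    apply: leeD; apply: lee_wpmul2l => //; first exact: hC.
    apply: le_trans (sq_diffM _ _ mfB) _; apply: leeD => //.
    by apply: lee_wpmul2l => //; apply: hC => //; exact: iV.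
  have e (a b : \bar R) : 0 <= a -> 0 <= b ->
      2%:E * a + 2%:E * (2%:E * b + 2%:E * a) = 6%:E * a + 4%:E * b.
    move=> a0 b0; rewrite (ge0_muleDr 2%:E) ?mule_ge0// !muleA -!EFinM.
    rewrite addeCA -ge0_muleDl// -EFinD addeC.
    by congr (_%:E * _ + _%:E * _); ring.
  by rewrite e ?mule_ge0 ?lee_fin// muleA -EFinM.
pose a := (6 * C)%:E * energy f * d%:E.
have a0 : 0 <= a by rewrite !mule_ge0 ?lee_fin ?mulr_ge0// ltW.
have h2 y : D y -> sq_diff f w * d%:E <=
    a + 4%:E * \int[mu]_(x in W) sq_diff f (y^-1 * x)%g.
  move=> Dy; rewrite muD -(integral_cst mu mD).
  have mwo : measurable_fun [set: B] (fun o : B => sq_diff f (y^-1 * (w * o))%g).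
    by apply: (measurable_mulgl_comp (f := fun o => sq_diff f (y^-1 * o)%g));
      exact: measurable_mulgl_comp.
  apply: (@le_trans _ _ (\int[mu]_(o in D)
      ((6 * C)%:E * energy f + 4%:E * sq_diff f (y^-1 * (w * o))%g))).
    apply: ge0_le_integral => //.
    - by move=> o _ /=.
    - apply: measurable_funTS; apply: emeasurable_funD => //.
      exact: measurable_funeM.
    - by move=> o Do; exact: h1.
  rewrite ge0_integralD//; first last.
  - by apply: measurable_funTS; exact: measurable_funeM.
  - by move=> o _; rewrite mule_ge0.
  - by move=> o _; rewrite mule_ge0// lee_fin mulr_ge0.
  rewrite (integral_cst mu mD) -muD -/a; apply: leeD2l.
  rewrite ge0_integralZl//; last exact: measurable_funTS.
  apply: lee_wpmul2l => //.
  pose D' := [set x | D (w^-1 * x)%g].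
  have mD' : measurable (D' : set B) by apply: open_borel; exact: open_mulgl.
  have DE : D = (fun y => (w * y)%g) @^-1` D'.
    by apply/seteqP; split => x; rewrite /D' /= mulKg.
  rewrite DE (integral_mulgl_set hmu w mD' (f := fun x => sq_diff f (y^-1 * x)%g))//.
    apply: ge0_subset_integral => //.
    - by apply: measurable_funTS; exact: measurable_mulgl_comp.
    - by move=> x [_ /=]; rewrite mulVKg.
  exact: measurable_mulgl_comp.
have k40 : (0 <= 4 / kappa)%R by rewrite divr_ge0// ltW.
(* Multiplication by kappa / 4 turns the coefficient 4 of [h2] into the coefficient kappa required
   by [energy_lower]. *)
have h3 : kappa%:E * ((kappa / 4)%:E * (sq_diff f w * d%:E) * d%:E) <=
    kappa%:E * ((kappa / 4)%:E * a * d%:E) + energy f.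
  rewrite muD; apply: energy_lower => //.
  - by move=> x [/VW].
  - by rewrite mule_ge0// lee_fin divr_ge0// ltW.
  - move=> y Dy; apply: (@le_trans _ _ ((kappa / 4)%:E *
        (a + 4%:E * \int[mu]_(x in W) sq_diff f (y^-1 * x)%g))).
      apply: lee_wpmul2l; first by rewrite lee_fin divr_ge0// ltW.
      by rewrite -muD; exact: h2.
    have Iy0 : 0 <= \int[mu]_(x in W) sq_diff f (y^-1 * x)%g by exact: integral_ge0.
    have I40 : 0 <= 4%:E * \int[mu]_(x in W) sq_diff f (y^-1 * x)%g.
      exact: mule_ge0.
    rewrite (ge0_muleDr _ a0 I40).
    by apply: leeD2l; rewrite muleA -EFinM divfK.
have c0 : (0 < kappa ^+ 2 / 4 * d * d)%R by rewrite !mulr_gt0// ?exprn_gt0.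
have h4 : sq_diff f w <= (kappa ^+ 2 / 4 * d * d)^-1%:E *
    (kappa%:E * ((kappa / 4)%:E * a * d%:E) + energy f).
  rewrite lee_pdivlMl//; apply: le_trans h3.
  rewrite le_eqVlt; apply/orP; left; apply/eqP.
  rewrite muleAC -!muleA (muleC (sq_diff _ _)) !muleA -!EFinM.
  by congr (_%:E * _); field.
apply: (le_trans h4); rewrite ge0_muleDr//; last first.
  apply: mule_ge0; first by rewrite lee_fin ltW.
  apply: mule_ge0; last by rewrite lee_fin ltW.
  by apply: mule_ge0 => //; rewrite lee_fin divr_ge0// ltW.
rewrite /a -!muleA (muleCA (energy f)) (muleC (energy f)) !muleA -!EFinM.
rewrite -ge0_muleDl ?lee_fin; last 2 first.
- have k0 := ltW kappa0; have d0' := ltW d0.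
  by rewrite !(mulr_ge0, invr_ge0, sqr_ge0)// ler0n.
- by rewrite invr_ge0 ltW.
rewrite -EFinD le_eqVlt; apply/orP; left; apply/eqP; congr (_%:E * _).
by field; rewrite !lt0r_neq0.
Qed.

(** U and W are unrelated, and U is in general not small: its closure is covered by finitely many
    translates y V, with [energy_controlled_all] for the points y and [sq_diff_small] on V. *)
Lemma spectral_gap : exists2 C, (0 <= C)%R &
  forall f, div_measurable f -> forall u, U u -> sq_diff f u <= C%:E * energy f.
Proof.
have [V [C [uV VW VU C0 hC]]] := sq_diff_small; have [oV V1 iV] := uV.
have cU : compact (closure U) by rewrite -precompactE; case: hU.
have [t ht] : exists t : seq G, forall x, closure U x ->
    exists2 y, y \in t /\ closure U y & V (y^-1 * x)%g.
  apply: (@compact_finite_cover G (closure U) (fun y x => V (y^-1 * x)%g)) => // x _.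
  by apply: open_nbhs_nbhs; split; [exact: open_mulgl|rewrite /= mulVg].
have [C' C'0 hC'] : exists2 C, (0 <= C)%R & forall y, y \in t -> energy_controlled C y.
  elim: (t) => [|x s [C' C'0 IH]]; first by exists 0%R.
  have [C2 C20 h2] := energy_controlled_all x; exists (C' + C2)%R.
    by rewrite addr_ge0.
  move=> y; rewrite inE => /predU1P[->|/IH].
    by apply: energy_controlled_le h2; rewrite lerDr.
  by apply: energy_controlled_le; rewrite lerDl.
exists (2 * C' + 2 * C)%R; first by rewrite addr_ge0 ?mulr_ge0.
move=> f mf u Uu; have [y [yt _] Vy] := ht u (subset_closure Uu).
rewrite -(mulVKg y u); apply: energy_controlledM => //; first exact: hC'.
by move=> f' mf'; exact: hC.
Qed.

End SpectralGap.

(** * The linear term *)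

Section LinearTerm.
Variables (R : realType) (G : topologicalGroupType).
Implicit Types (g h x y z : G) (phi psi : G -> R).
Local Notation B := (borel G).
Hypothesis hG : hausdorff_space G.
Variable U : set G.
Hypothesis hU : generating_nbhd U.
Variable mu : {measure set B -> \bar R}.
Hypothesis hmu : left_haar_measure mu.
Local Open Scope ereal_scope.

Let U1 : U 1%g. Proof. by case: hU. Qed.
Let iU : forall x, U x -> U (x^-1)%g. Proof. by case: hU. Qed.

Lemma integral_mulgl_signed x (f : B -> \bar R) : measurable_fun setT f ->
  \int[mu]_g f (x * g)%g = \int[mu]_g f g.
Proof.
move=> mf; rewrite integralE [RHS]integralE; congr (_ - _).
- rewrite -(integral_mulgl hmu x (measurable_funepos mf))//.
  by apply: eq_integral => g _; rewrite !funeposE.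
- rewrite -(integral_mulgl hmu x (measurable_funeneg mf))//.
  by apply: eq_integral => g _; rewrite !funenegE.
Qed.

(** The content of a bound A for Gamma_oo: the exceptional null set may depend on u, so no pointwise
    Lipschitz condition is implied. *)
Definition lipschitz_ae (A : R) psi := forall u, U u ->
  {ae mu, forall g : B, (`|psi (u^-1 * g)%g - psi g| <= A)%R}.

Lemma lipschitz_ae_pow A psi n x : lipschitz_ae A psi -> set_pow U n x ->
  {ae mu, forall g : B, (`|psi (x^-1 * g)%g - psi g| <= n%:R * A)%R}.
Proof.
move=> hpsi; elim: n x => [|n IH] x.
  by move=> ->; apply: nearW => g; rewrite invg1 mul1g subrr normr0 mul0r.
move=> [u Uu [v Uv <-]].
have := ae_mulgl hmu (u^-1)%g (IH v Uv); have := hpsi u Uu.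
apply: filterS2 => g /= h1 h2; rewrite invgM -mulgA.
have -> : (psi (v^-1 * (u^-1 * g))%g - psi g = (psi (v^-1 * (u^-1 * g))%g -
  psi (u^-1 * g)%g) + (psi (u^-1 * g)%g - psi g))%R by ring.
rewrite (le_trans (ler_normD _ _))// -natr1 mulrDl mul1r; exact: lerD.
Qed.

Definition l1_diff phi x : \bar R := \int[mu]_g `|(phi (x^-1 * g)%g - phi g)%:E|.

Lemma measurable_diff phi x : measurable_fun [set: B] (phi : B -> R) ->
  measurable_fun [set: B] (fun g : B => phi (x * g)%g - phi g)%R.
Proof. by move=> mf; apply: measurable_funB => //; exact: measurable_mulgl_comp. Qed.

Lemma l1_diff_pow (A : R) phi n x : measurable_fun [set: B] (phi : B -> R) ->
  (forall u, U u -> l1_diff phi u <= A%:E) -> set_pow U n x ->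
  l1_diff phi x <= (n%:R * A)%:E.
Proof.
move=> mphi hphi; elim: n x => [|n IH] x.
  move=> ->; rewrite mul0r /l1_diff.
  under eq_integral do rewrite invg1 mul1g subrr abse0.
  by rewrite integral0.
have mE y : measurable_fun [set: B] (fun g : B => `|(phi (y * g)%g - phi g)%:E|).
  by apply: measurableT_comp => //; apply/measurable_EFinP; exact: measurable_diff.
move=> [u Uu [v Uv <-]].
apply: (@le_trans _ _ (\int[mu]_g (`|(phi (v^-1 * (u^-1 * g))%g - phi (u^-1 * g)%g)%:E| +
    `|(phi (u^-1 * g)%g - phi g)%:E|))).
  apply: ge0_le_integral => //.
  - apply: emeasurable_funD; last exact: mE.
    exact: (measurable_mulgl_comp (u^-1)%g (mE (v^-1)%g)).
  - move=> g _; rewrite invgM -mulgA !abse_EFin -EFinD lee_fin.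
    set a := phi _; set b := phi (u^-1 * g)%g; set c := phi g.
    have -> : (a - c = (a - b) + (b - c))%R by ring.
    exact: ler_normD.
have mEvu := measurable_mulgl_comp (u^-1)%g (mE (v^-1)%g).
rewrite (ge0_integralD mu measurableT _ mEvu _ (mE (u^-1)%g))//.
rewrite -natr1 mulrDl mul1r EFinD; apply: leeD; last exact: hphi.
by rewrite (integral_mulgl hmu (u^-1)%g (mE (v^-1)%g))//; exact: IH.
Qed.

(** The map F of the overview, extended-valued until integrability is known. *)
Definition pair_diff phi psi x : \bar R :=
  \int[mu]_g (phi g * (psi (x^-1 * g)%g - psi g))%:E.

Section pair.
Variables (phi psi : G -> R) (A D : R).
Hypothesis A0 : (0 <= A)%R.
Hypothesis iphi : mu.-integrable setT (fun g : B => (phi g)%:E).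
Hypothesis hphi : forall u, U u -> l1_diff phi u <= D%:E.
Hypothesis mpsi : measurable_fun [set: B] (psi : B -> R).
Hypothesis hpsi : lipschitz_ae A psi.

Let mphi : measurable_fun [set: B] (phi : B -> R).
Proof. by have /measurable_int/measurable_EFinP := iphi. Qed.

Lemma int_mul_diff_le (f : G -> R) n x : measurable_fun [set: B] (f : B -> R) ->
  set_pow U n x ->
  \int[mu]_g `|(f g * (psi (x^-1 * g)%g - psi g))%:E| <=
  (n%:R * A)%:E * \int[mu]_g `|(f g)%:E|.
Proof.
move=> mf Ux; rewrite -ge0_integralZl//; last 2 first.
- by apply: measurableT_comp => //; exact/measurable_EFinP.
- by rewrite lee_fin mulr_ge0.
apply: ae_ge0_le_integral => //.
- apply: measurableT_comp => //; apply/measurable_EFinP.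
  by apply: measurable_funM => //; exact: measurable_diff.
- by move=> g _; rewrite mule_ge0// lee_fin mulr_ge0.
- by apply: measurable_funeM; apply: measurableT_comp => //; exact/measurable_EFinP.
- have := lipschitz_ae_pow hpsi Ux; apply: filterS => g hg _.
  by rewrite !abse_EFin -EFinM lee_fin normrM mulrC ler_wpM2r.
Qed.

Lemma integrable_mul_diff (f : G -> R) x :
  mu.-integrable setT (fun g : B => (f g)%:E) ->
  mu.-integrable setT (fun g : B => (f g * (psi (x^-1 * g)%g - psi g))%:E).
Proof.
move=> /integrableP[mf foo]; have [n Ux] := set_pow_cover hU x.
have mf' : measurable_fun [set: B] (f : B -> R) by exact/measurable_EFinP.
apply/integrableP; split.
  by apply/measurable_EFinP; apply: measurable_funM => //; exact: measurable_diff.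
apply: le_lt_trans (int_mul_diff_le mf' Ux) _.
by rewrite lte_mul_pinfty// lee_fin mulr_ge0.
Qed.

Lemma pair_diff_fin x : pair_diff phi psi x \is a fin_num.
Proof. by apply: integrable_fin_num => //; exact: integrable_mul_diff. Qed.

Lemma pair_diff_le n x : set_pow U n x ->
  `|pair_diff phi psi x| <= (n%:R * A)%:E * \int[mu]_g `|(phi g)%:E|.
Proof.
move=> Ux; apply: le_trans (le_abse_integral _ _ _) _ => //.
  by have /measurable_int := integrable_mul_diff x iphi.
exact: int_mul_diff_le.
Qed.

(** L(xy) psi - psi is the sum of L(x) (L(y) psi - psi) and L(x) psi - psi. Left invariance moves
    L(x) from the first summand to phi, and subtracting the term of y leaves a product of two
    differences, small in L^1 and in L^oo respectively. *)
Lemma pair_diffM x y : pair_diff phi psi (x * y)%g - pair_diff phi psi x -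
  pair_diff phi psi y =
  \int[mu]_g ((phi (x * g)%g - phi g) * (psi (y^-1 * g)%g - psi g))%:E.
Proof.
have i1 := integrable_mul_diff x iphi.
have iphix : mu.-integrable setT (fun g : B => (phi (x * g)%g)%:E).
  have /integrableP[m1 h1] := iphi; apply/integrableP; split.
    exact: (measurable_mulgl_comp x m1).
  rewrite (integral_mulgl hmu x (f := fun g => `|(phi g)%:E|))//.
  exact: measurableT_comp.
have i2 := integrable_mul_diff y iphi.
have i3 := integrable_mul_diff y iphix.
have E : pair_diff phi psi (x * y)%g =
    \int[mu]_g (phi (x * g)%g * (psi (y^-1 * g)%g - psi g))%:E + pair_diff phi psi x.
  rewrite -(integral_mulgl_signed (x^-1)%g (measurable_int _ i3)) /=.
  under [X in _ = X + _]eq_integral do rewrite mulVKg.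
  rewrite -integralD//.
    apply: eq_integral => g _; rewrite -EFinD invgM -mulgA; congr (_%:E); ring.
  have /integrableP[m3 h3] := i3; apply/integrableP; split.
    have := measurable_mulgl_comp (x^-1)%g m3.
    by apply: eq_measurable_fun => g _; rewrite mulVKg.
  have m3' : measurable_fun [set: B] (fun g : B =>
      `|(phi (x * g)%g * (psi (y^-1 * g)%g - psi g))%:E|) by exact: measurableT_comp.
  have := integral_mulgl hmu (x^-1)%g m3'; rewrite /=.
  by under eq_integral do rewrite mulVKg; move=> ->.
rewrite E addeK ?pair_diff_fin//.
under [RHS]eq_integral do rewrite mulrBl EFinB.
by rewrite integralB_EFin.
Qed.

Lemma pair_diff_quasi_hom :
  quasi_hom U (A * D) (fun x => fine (pair_diff phi psi x)).
Proof.
move=> i j x y Ux Uy.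
rewrite -lee_fin -abse_EFin !EFinB !fineK ?pair_diff_fin// pair_diffM.
have md : measurable_fun [set: B] (fun g : B => phi (x * g)%g - phi g)%R.
  exact: measurable_diff.
apply: le_trans (le_abse_integral _ _ _) _ => //.
  apply/measurable_EFinP; apply: measurable_funM => //; exact: measurable_diff.
apply: le_trans (int_mul_diff_le md Uy) _.
have := l1_diff_pow mphi hphi (set_pow_inv iU Ux); rewrite /l1_diff invgK => h.
apply: (@le_trans _ _ ((j%:R * A)%:E * (i%:R * D)%:E)).
  by rewrite lee_wpmul2l// lee_fin mulr_ge0.
by rewrite -EFinM lee_fin le_eqVlt; apply/orP; left; apply/eqP; ring.
Qed.

End pair.

Variable s : splitting R G.
Variable K : G -> R.
Hypothesis mK : measurable_fun [set: B] (K : B -> R).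
Hypothesis K0 : (forall g, 0 <= K g)%R.
Hypothesis K1 : \int[mu]_g (K g)%:E = 1.
Hypothesis hK : centered mu s K.
Variable m : nat.
Hypothesis Km : forall g, K g != 0%R -> set_pow U m g.
Local Notation nu := (density_measure mu mK).

Lemma integral_law_signed (f : B -> R) : measurable_fun setT f ->
  \int[nu]_x (f x)%:E = \int[mu]_x (K x * f x)%:E.
Proof.
move=> mf; have mfE : measurable_fun setT (fun x : B => (f x)%:E) by exact/measurable_EFinP.
rewrite integralE [RHS]integralE !(@integral_law R G mu K mK K0)//.
- congr (_ - _); apply: eq_integral => x _.
    by rewrite !funeposE maxe_pMr ?lee_fin// mule0.
  by rewrite !funenegE maxe_pMr ?lee_fin// mule0 muleN.
- exact: measurable_funeneg.
- exact: measurable_funepos.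
Qed.

Lemma measurable_split_component i :
  measurable_fun [set: B] (split_component s i : B -> R).
Proof. by apply: continuous_borelR; exact: split_component_continuous. Qed.

Lemma integrable_law_bounded (f : B -> R) M : measurable_fun setT f ->
  (forall x, K x != 0%R -> `|f x| <= M)%R -> nu.-integrable setT (fun x : B => (f x)%:E).
Proof.
move=> mf fM; apply/integrableP; split; first exact/measurable_EFinP.
apply: (@le_lt_trans _ _ (\int[nu]_x (`|M|%:E))).
  apply: le_integral_law => //.
  - by apply: measurableT_comp => //; exact/measurable_EFinP.
  - by move=> x Kx; rewrite lee_fin (le_trans (fM x Kx))// ler_norm.
by rewrite integral_law_cst// ltry.
Qed.

Lemma split_component_law i : nu.-integrable setT (fun x : B => (split_component s i x)%:E).
Proof.
have [C [cC _ UC _]] := sigma_compact hU.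
have [M hM] := compact_norm_bounded (cC m) (@split_component_continuous R G s i).
apply: (@integrable_law_bounded _ M); first exact: measurable_split_component.
by move=> x /Km/UC; exact: hM.
Qed.

Lemma split_component_mean0 i : \int[nu]_x (split_component s i x)%:E = 0.
Proof. by rewrite integral_law_signed ?hK//; exact: measurable_split_component. Qed.

Lemma measurable_pair_diff phi psi : measurable_fun [set: B] (phi : B -> R) ->
  div_measurable psi -> measurable_fun [set: B] (pair_diff phi psi : B -> \bar R).
Proof.
move=> mphi mpsi.
pose f (p : B * B) := (phi p.2 * (psi (p.1^-1 * p.2)%g - psi p.2))%:E.
have mf : measurable_fun setT f.
  apply/measurable_EFinP; apply: measurable_funM.
    exact: (measurableT_comp mphi measurable_snd).
  apply: measurable_funB; first exact: mpsi.
  exact: (measurableT_comp (div_measurable_borel mpsi) measurable_snd).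
have -> : pair_diff phi psi = (fun x : G =>
    \int[mu]_g f^\+ (x, g) - \int[mu]_g f^\- (x, g)).
  apply/funext => x; rewrite /pair_diff integralE.
  by congr (_ - _); apply: eq_integral => g _; rewrite ?funeposE ?funenegE.
apply: emeasurable_funB.
- by apply: (measurable_int_haar hG hU hmu); first exact: measurable_funepos.
- by apply: (measurable_int_haar hG hU hmu); first exact: measurable_funeneg.
Qed.

Lemma mean_quasi_hom : exists2 C, (0 <= C)%R & forall D (F : G -> R), (0 <= D)%R ->
  quasi_hom U D F -> (exists M, forall u, U u -> `|F u| <= M)%R ->
  measurable_fun [set: B] (F : B -> R) ->
  `|\int[nu]_x (F x)%:E| <= (C * D)%:E.
Proof.
have /choice[e eE] : forall i, exists g, split_coord s g = basis_coord i.
  by move=> i; exact: split_coord_surj.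
have [C C0 hC] := quasi_hom_stability hU eE.
exists (C * m%:R ^+ 2)%R; first by rewrite mulr_ge0// ?exprn_ge0// ltW.
move=> D F D0 hF [M FM] mF.
pose L := linear_part e F.
have iL : nu.-integrable setT (fun x : B => (L x)%:E).
  rewrite /L /linear_part; under eq_fun do rewrite -sumEFin.
  apply: integrable_sum => // i _; under eq_fun do rewrite EFinM.
  by apply: integrableZl => //; exact: split_component_law.
have L0 : \int[nu]_x (L x)%:E = 0.
  rewrite /L /linear_part; under eq_integral do rewrite -sumEFin.
  rewrite integral_sum//.
    rewrite big1// => i _; under eq_integral do rewrite EFinM.
    by rewrite integralZl ?split_component_mean0 ?mule0//; exact: split_component_law.
  move=> i; under eq_fun do rewrite EFinM.
  by apply: integrableZl => //; exact: split_component_law.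
have mL : measurable_fun [set: B] (L : B -> R).
  by have /measurable_int/measurable_EFinP := iL.
have hFL x : K x != 0%R -> (`|F x - L x| <= C * m%:R ^+ 2 * D)%R.
  move=> Kx; rewrite mulrAC; apply: hC => //; first by exists M.
  exact: Km.
have iFL := @integrable_law_bounded (fun x => F x - L x)%R _ (measurable_funB mF mL) hFL.
have -> : \int[nu]_x (F x)%:E = \int[nu]_x (F x - L x)%:E.
  rewrite -[RHS]adde0 -L0 -integralD//.
  by apply: eq_integral => x _; rewrite -EFinD subrK.
apply: le_trans (le_abse_integral _ _ _) _ => //; first exact: measurable_int iFL.
rewrite -[leRHS](integral_law_cst mK K0 K1).
apply: le_integral_law => //.
- by apply: measurableT_comp => //; exact: measurable_int iFL.
- by move=> _; rewrite lee_fin !mulr_ge0 ?exprn_ge0// ltW.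
Qed.

Lemma quasi_homV D (F : G -> R) : quasi_hom U D F ->
  quasi_hom U D (fun x => F (x^-1)%g).
Proof.
move=> hF i j x y Ux Uy; rewrite invgM.
have := hF j i _ _ (set_pow_inv iU Uy) (set_pow_inv iU Ux).
by rewrite [(j%:R * _)%R]mulrC; congr (`|_| <= _)%R; ring.
Qed.

(* The only place where centering is used. *)
Lemma mean_pair_diff : exists2 C, (0 <= C)%R & forall phi psi (A D : R),
  (0 <= A)%R -> (0 <= D)%R -> mu.-integrable setT (fun g : B => (phi g)%:E) ->
  (forall u, U u -> l1_diff phi u <= D%:E) -> div_measurable psi ->
  lipschitz_ae A psi ->
  `|\int[nu]_x pair_diff phi psi x| <= (C * (A * D))%:E /\
  `|\int[nu]_x pair_diff phi psi (x^-1)%g| <= (C * (A * D))%:E.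
Proof.
have [C C0 hC] := mean_quasi_hom; exists C => //.
move=> phi psi A D A0 D0 iphi hphi mpsi hpsi.
have mpsiB := div_measurable_borel mpsi.
have mphi : measurable_fun [set: B] (phi : B -> R).
  by have /measurable_int/measurable_EFinP := iphi.
have fin x := pair_diff_fin A0 iphi mpsiB hpsi x.
have qF := pair_diff_quasi_hom A0 iphi hphi mpsiB hpsi.
have mF : measurable_fun [set: B] (fun x : B => fine (pair_diff phi psi x)).
  by apply: (measurableT_comp _ (measurable_pair_diff mphi mpsi)); exact: fine_measurable.
have FM : exists M, forall u, U u -> (`|fine (pair_diff phi psi u)| <= M)%R.
  exists (fine (A%:E * \int[mu]_g `|(phi g)%:E|)) => u Uu.
  rewrite -lee_fin -abse_EFin fineK// fineK.
    have := @pair_diff_le phi psi A A0 iphi mpsiB hpsi 1%N u.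
    by rewrite set_pow1 mul1r; exact.
  rewrite ge0_fin_numE ?mule_ge0 ?integral_ge0//.
  by have /integrableP[_ h] := iphi; rewrite lte_mul_pinfty.
have FM' : exists M, forall u, U u -> (`|fine (pair_diff phi psi (u^-1)%g)| <= M)%R.
  by have [M hM] := FM; exists M => u /iU; exact: hM.
split.
- under eq_integral => x _ do rewrite -(fineK (fin x)).
  by apply: hC => //; rewrite mulr_ge0.
- under eq_integral => x _ do rewrite -(fineK (fin (x^-1)%g)).
  apply: (hC _ (fun x => fine (pair_diff phi psi (x^-1)%g))) => //.
  + by rewrite mulr_ge0.
  + exact: (quasi_homV qF).
  + exact: (measurableT_comp mF (@measurable_invg G)).
Qed.

End LinearTerm.

(** * The weighted estimate on L^2 *)

Section ExponentialBounds.
Variable R : realType.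
Implicit Types t M : R.

Lemma expR_sub1_le t : expR t - 1 <= t * expR t.
Proof.
have := expR_ge1Dx (- t); rewrite -(ler_pM2r (expR_gt0 t)) -expRD addNr expR0.
lra.
Qed.

Lemma expR_linear_bound t M : `|t| <= M -> `|expR t - 1| <= `|t| * expR M.
Proof.
move=> tM; have M0 : 0 <= M by apply: le_trans tM.
have eM : 1 <= expR M by rewrite -expR0 ler_expR.
have h1 := expR_sub1_le t; have h2 := expR_ge1Dx t.
have [t0|t0] := leP 0 t.
  have et : expR t <= expR M by rewrite ler_expR (le_trans _ tM)// ler_norm.
  have e1 : 1 <= expR t by rewrite -expR0 ler_expR.
  rewrite (ger0_norm t0) ger0_norm ?subr_ge0//.
  by apply: le_trans h1 _; rewrite ler_wpM2l.
have et : expR t <= 1 by rewrite -expR0 ler_expR ltW.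
rewrite (ltr0_norm t0) ler0_norm; last by rewrite subr_le0.
apply: (@le_trans _ _ (- t)); first by lra.
by rewrite ler_peMr// oppr_ge0 ltW.
Qed.

Lemma expR_quadratic_bound t M : `|t| <= M -> expR t <= 1 + t + expR M * t ^+ 2.
Proof.
move=> tM; have M0 : 0 <= M by apply: le_trans tM.
have eM : 1 <= expR M by rewrite -expR0 ler_expR.
have h1 := expR_sub1_le t; have h2 := expR_ge1Dx t.
have [t0|t0] := leP 0 t.
  have et : expR t <= expR M by rewrite ler_expR (le_trans _ tM)// ler_norm.
  have h3 : t * (expR t - 1) <= t * (t * expR M).
    by rewrite ler_wpM2l//; apply: le_trans h1 _; rewrite ler_wpM2l.
  rewrite expr2; lra.
have h3 : t * (expR t - 1) <= t * t.
  by rewrite ler_wnM2l//; lra.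
have h4 : t * t <= expR M * (t * t) by rewrite ler_peMl// -expr2 sqr_ge0.
rewrite expr2; lra.
Qed.

End ExponentialBounds.

Section Variance.
Local Open Scope ereal_scope.
Context d (T : measurableType d) (R : realType).
Variable nu : {measure set T -> \bar R}.
Hypothesis nu1 : nu setT = 1.

Let nu_sf : sigma_finite setT nu.
Proof.
exists (fun=> setT); first by rewrite bigcup_const.
by move=> _; split => //; rewrite nu1 ltry.
Qed.

(** The cross term stays on the left, so that all integrands are nonnegative and the identity holds
    even when the moments are infinite. *)
Lemma variance_identity (X : T -> R) : measurable_fun setT X ->
  (forall x, (0 <= X x)%R) ->
  \int[nu]_k \int[nu]_h ((X h - X k) ^+ 2)%:E +
    2%:E * (\int[nu]_h (X h)%:E * \int[nu]_h (X h)%:E) =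
  2%:E * \int[nu]_h ((X h) ^+ 2)%:E.
Proof.
move=> mX X0.
have mXE : measurable_fun setT (fun x => (X x)%:E) by exact/measurable_EFinP.
have mX2 : measurable_fun setT (fun x => (X x ^+ 2)%:E).
  by apply/measurable_EFinP; exact: measurable_funX.
have mD k : measurable_fun setT (fun h => ((X h - X k) ^+ 2)%:E).
  by apply/measurable_EFinP; apply: measurable_funX; exact: measurable_funB.
have mDD : measurable_fun setT (fun k => \int[nu]_h ((X h - X k) ^+ 2)%:E).
  apply: (measurable_tonelli1 nu_sf (f := fun p : T * T => ((X p.2 - X p.1) ^+ 2)%:E)).
    apply/measurable_EFinP; apply: measurable_funX; apply: measurable_funB.
      exact: (measurableT_comp mX measurable_snd).
    exact: (measurableT_comp mX measurable_fst).
  by move=> p; rewrite lee_fin sqr_ge0.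
set I := \int[nu]_h (X h)%:E; set J := \int[nu]_h (X h ^+ 2)%:E.
have I0 : 0 <= I by apply: integral_ge0 => x _; rewrite lee_fin.
have J0 : 0 <= J by apply: integral_ge0 => x _; rewrite lee_fin sqr_ge0.
have inner k : \int[nu]_h ((X h - X k) ^+ 2)%:E + (2 * X k)%:E * I =
    J + (X k ^+ 2)%:E.
  have k0 : 0 <= (2 * X k)%:E by rewrite lee_fin mulr_ge0.
  have X2 : (X k ^+ 2)%:E = \int[nu]_h (cst (X k ^+ 2)%:E h).
    by rewrite integral_cst// nu1 mule1.
  rewrite X2 -ge0_integralZl//; last by move=> x _; rewrite lee_fin.
  rewrite -!ge0_integralD//.
  - by apply: eq_integral => h _; rewrite /= -EFinM -!EFinD; congr (_%:E); ring.
  - by move=> x _; rewrite lee_fin sqr_ge0.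
  - by move=> x _; rewrite lee_fin sqr_ge0.
  - by move=> x _; rewrite lee_fin sqr_ge0.
  - by move=> x _; rewrite mule_ge0// lee_fin.
  - exact: measurable_funeM.
have -> : 2%:E * (I * I) = \int[nu]_k ((2 * X k)%:E * I).
  rewrite ge0_integralZr//; last 2 first.
  - by apply/measurable_EFinP; exact: measurable_funM.
  - by move=> x _; rewrite lee_fin mulr_ge0.
  under eq_integral do rewrite EFinM.
  by rewrite ge0_integralZl ?muleA//; move=> x _; rewrite lee_fin.
rewrite -ge0_integralD//; last 3 first.
- by move=> k _; apply: integral_ge0 => h _; rewrite lee_fin sqr_ge0.
- by move=> k _; rewrite mule_ge0// lee_fin mulr_ge0.
- apply: emeasurable_funM => //.
  by apply/measurable_EFinP; exact: measurable_funM.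
under eq_integral do rewrite inner.
rewrite ge0_integralD//; last by move=> x _; rewrite lee_fin sqr_ge0.
rewrite (integral_cst nu measurableT) nu1 mule1 -/J.
by rewrite -[X in X + X]mul1e -ge0_muleDl// -EFinD.
Qed.

End Variance.

(** * The variance of one weighted convolution step *)

Section WeightedL2.
Variables (R : realType) (G : topologicalGroupType).
Implicit Types (g h k x y z : G).
Local Notation B := (borel G).
Hypothesis hG : hausdorff_space G.
Variable U : set G.
Hypothesis hU : generating_nbhd U.
Variable mu : {measure set B -> \bar R}.
Hypothesis hmu : left_haar_measure mu.
Variable K : G -> R.
Hypothesis mK : measurable_fun [set: B] (K : B -> R).
Hypothesis K0 : (forall g, 0 <= K g)%R.
Local Open Scope ereal_scope.
Hypothesis K1 : \int[mu]_g (K g)%:E = 1.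
Variable m : nat.
Hypothesis Km : forall g, K g != 0%R -> set_pow U m g.
Local Notation nu := (density_measure mu mK).
Local Notation M := (m%:R : R).

Lemma ae_law_support : {ae nu, forall h : B, K h != 0%R}.
Proof.
have mN : measurable ([set h | K h = 0%R] : set B).
  by have := mK measurableT (measurable_set1 0%R); rewrite setTI.
exists [set h | K h = 0%R]; split => //=.
- rewrite /with_density integral_mkcond integral0_eq// => x _.
  by rewrite patchE; case: ifPn => // /set_mem /= ->; rewrite normr0.
- by move=> h /= /negP; rewrite negbK => /eqP.
Qed.

Section fixed_function.
Variables (lambda : R) (psi f : G -> R).
Hypothesis mpsi : div_measurable psi.
Hypothesis hpsi : lipschitz_ae U mu 1 psi.
Hypothesis mf : div_measurable f.
Hypothesis f0 : forall x, (0 <= f x)%R.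
Variable I2 : R.
Hypothesis fI2 : \int[mu]_g ((f g) ^+ 2)%:E = I2%:E.

Let mpsiB := div_measurable_borel mpsi.
Let mfB := div_measurable_borel mf.

Let I20 : (0 <= I2)%R.
Proof. by rewrite -lee_fin -fI2; apply: integral_ge0 => x _; rewrite lee_fin sqr_ge0. Qed.

Definition weighted (h g : G) : R :=
  (expR (lambda * (psi g - psi (h^-1 * g)%g)) * f (h^-1 * g)%g)%R.
Local Notation X := weighted.

Let X0 h g : (0 <= X h g)%R.
Proof. by rewrite mulr_ge0// expR_ge0. Qed.

Lemma measurable_weighted : measurable_fun setT (fun p : B * B => X p.1 p.2).
Proof.
apply: measurable_funM; last exact: mf.
apply: (measurableT_comp (@measurable_expR R)); apply: measurable_funM => //.
apply: measurable_funB.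
  exact: (measurableT_comp mpsiB measurable_snd).
exact: mpsi.
Qed.
Local Notation mX := measurable_weighted.

Let mXg g : measurable_fun [set: B] (fun h : B => X h g).
Proof. exact: (measurable_fun_pair1 (f := fun p : B * B => X p.1 p.2) g mX). Qed.

Let mXh h : measurable_fun [set: B] (fun g : B => X h g).
Proof. exact: (measurable_fun_pair2 (f := fun p : B * B => X p.1 p.2) h mX). Qed.

Definition second_moment : \bar R := \int[mu]_g \int[nu]_h ((X h g) ^+ 2)%:E.
(** The squared L^2 norm of e^(lambda psi) T e^(- lambda psi) f: the mean over h is taken first and
    then squared. *)
Definition first_moment : \bar R :=
  \int[mu]_g (\int[nu]_h (X h g)%:E * \int[nu]_h (X h g)%:E).
Definition variance_int : \bar R :=
  \int[nu]_k \int[nu]_h \int[mu]_g ((X h g - X k g) ^+ 2)%:E.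

Let mD3 : measurable_fun setT (fun p : (B * B) * B =>
  ((X p.2 p.1.2 - X p.1.1 p.1.2) ^+ 2)%:E).
Proof.
apply/measurable_EFinP; apply: measurable_funX; apply: measurable_funB.
  apply: (measurableT_comp mX (g := fun p : (B * B) * B => (p.2, p.1.2))).
  apply: measurable_fun_pair => //.
  exact: (measurableT_comp measurable_snd measurable_fst).
exact: (measurableT_comp mX measurable_fst).
Qed.

Lemma moment_identity : variance_int + 2%:E * first_moment = 2%:E * second_moment.
Proof.
have nu_sf := law_sigma_finite mK K0 K1.
have mu_sf := haar_sigma_finite hG hU hmu.
have m1 : measurable_fun setT (fun p : B * B =>
    \int[nu]_h ((X h p.2 - X p.1 p.2) ^+ 2)%:E).
  by apply: (measurable_tonelli1 nu_sf mD3) => p; rewrite lee_fin sqr_ge0.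
have V : variance_int =
    \int[mu]_g \int[nu]_k \int[nu]_h ((X h g - X k g) ^+ 2)%:E.
  rewrite -(tonelli nu_sf mu_sf (f := fun p : B * B =>
    \int[nu]_h ((X h p.2 - X p.1 p.2) ^+ 2)%:E))//; last first.
    by move=> p; apply: integral_ge0 => h _; rewrite lee_fin sqr_ge0.
  apply: eq_integral => k _.
  apply: (tonelli nu_sf mu_sf (f := fun p : B * B =>
    ((X p.1 p.2 - X k p.2) ^+ 2)%:E)).
    apply/measurable_EFinP; apply: measurable_funX; apply: measurable_funB => //.
      exact: mX.
    exact: (measurableT_comp (mXh k) measurable_snd).
  by move=> p; rewrite lee_fin sqr_ge0.
have mEX : measurable_fun [set: B] (fun g : B => \int[nu]_h (X h g)%:E).
  apply: (measurable_tonelli2 nu_sf (f := fun p : B * B => (X p.1 p.2)%:E)).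
    by apply/measurable_EFinP; exact: mX.
  by move=> p; rewrite lee_fin.
have EX0 g : 0 <= \int[nu]_h (X h g)%:E by apply: integral_ge0 => h _; rewrite lee_fin.
have mEX2 : measurable_fun [set: B] (fun g : B => \int[nu]_h (X h g ^+ 2)%:E).
  apply: (measurable_tonelli2 nu_sf (f := fun p : B * B => (X p.1 p.2 ^+ 2)%:E)).
    by apply/measurable_EFinP; apply: measurable_funX; exact: mX.
  by move=> p; rewrite lee_fin sqr_ge0.
have mII := emeasurable_funM mEX mEX.
have II0 g : 0 <= \int[nu]_h (X h g)%:E * \int[nu]_h (X h g)%:E by exact: mule_ge0.
have EX20 g : 0 <= \int[nu]_h (X h g ^+ 2)%:E.
  by apply: integral_ge0 => h _; rewrite lee_fin sqr_ge0.
have DD0 g : 0 <= \int[nu]_k \int[nu]_h ((X h g - X k g) ^+ 2)%:E.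
  apply: integral_ge0 => k _; apply: integral_ge0 => h _.
  by rewrite lee_fin sqr_ge0.
have mDD : measurable_fun [set: B]
    (fun g : B => \int[nu]_k \int[nu]_h ((X h g - X k g) ^+ 2)%:E).
  apply: (measurable_tonelli2 nu_sf (f := fun p : B * B =>
    \int[nu]_h ((X h p.2 - X p.1 p.2) ^+ 2)%:E)) => // p.
  by apply: integral_ge0 => h _; rewrite lee_fin sqr_ge0.
rewrite V -(ge0_integralZl mu measurableT mII) //.
rewrite -(ge0_integralZl mu measurableT mEX2) //.
rewrite -(ge0_integralD mu measurableT _ mDD _ (measurable_funeM _ mII)) //; last first.
  by move=> g _; rewrite mule_ge0.
apply: eq_integral => g _; apply: variance_identity => //.
exact: (lawT mK K0 K1).
Qed.

(** Substituting h * g for g frees f from h, so that f^2 can play the role of phi. The difference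
    psi (h * g) - psi g that results is the one of L(h^-1), which is why [pair_diff] is later taken
    at h^-1. *)
Lemma second_momentE : second_moment =
  \int[nu]_h \int[mu]_g (expR (2 * lambda * (psi (h * g)%g - psi g)) * f g ^+ 2)%:E.
Proof.
rewrite /second_moment (tonelli_law hG hU hmu mK K0 K1
  (f := fun p : B * B => (X p.1 p.2 ^+ 2)%:E)); last 2 first.
- by apply/measurable_EFinP; apply: measurable_funX; exact: mX.
- by move=> p; rewrite lee_fin sqr_ge0.
apply: eq_integral => h _.
rewrite -(integral_mulgl hmu h (f := fun g => (X h g ^+ 2)%:E))//; last 2 first.
- by apply/measurable_EFinP; exact: measurable_funX.
- by move=> p; rewrite lee_fin sqr_ge0.
apply: eq_integral => g _; rewrite /weighted mulKg exprMn -expRM_natl.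
by rewrite mulrA.
Qed.

Let hlip h : K h != 0%R ->
  {ae mu, forall g : B, (`|psi (h^-1 * g)%g - psi g| <= M)%R}.
Proof.
move=> /Km Uh; have := lipschitz_ae_pow hmu hpsi Uh.
by apply: filterS => g; rewrite mulr1.
Qed.

Let hlipV h : K h != 0%R ->
  {ae mu, forall g : B, (`|psi (h * g)%g - psi g| <= M)%R}.
Proof.
move=> Kh; have := ae_mulgl hmu h (hlip Kh).
by apply: filterS => g; rewrite mulKg distrC.
Qed.

Let f2E0 g : 0 <= (f g ^+ 2)%:E.
Proof. by rewrite lee_fin sqr_ge0. Qed.

Let mf2 : measurable_fun [set: B] (fun g : B => (f g ^+ 2)%:E).
Proof. by apply/measurable_EFinP; exact: measurable_funX. Qed.

Lemma div_measurable_mulg : measurable_fun setT (fun p : B * B => psi (p.1 * p.2)%g).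
Proof.
have h : measurable_fun setT (fun p : B * B => ((p.1^-1)%g : B, p.2)).
  apply: measurable_fun_pair => //.
  exact: (measurableT_comp (@measurable_invg G) measurable_fst).
by apply: eq_measurable_fun (measurableT_comp mpsi h) => p _; rewrite /= invgK.
Qed.

Lemma measurable_exp_moment : measurable_fun [set: B] (fun h : B =>
  \int[mu]_g (expR (2 * lambda * (psi (h * g)%g - psi g)) * f g ^+ 2)%:E).
Proof.
apply: (measurable_int_haar hG hU hmu (f := fun p : B * B =>
  (expR (2 * lambda * (psi (p.1 * p.2)%g - psi p.2)) * f p.2 ^+ 2)%:E)).
  apply/measurable_EFinP; apply: measurable_funM; last first.
    apply: measurable_funX; exact: (measurableT_comp mfB measurable_snd).
  apply: (measurableT_comp (@measurable_expR R)); apply: measurable_funM => //.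
  apply: measurable_funB; first exact: div_measurable_mulg.
  exact: (measurableT_comp mpsiB measurable_snd).
by move=> p; rewrite lee_fin mulr_ge0 ?expR_ge0 ?sqr_ge0.
Qed.

(** A crude bound without restriction on lambda, since psi varies by at most M under translation by
    the support of K. It gives finiteness for small lambda and is the whole estimate for |lambda| >
    1. *)
Lemma second_moment_le : second_moment <= (expR (2 * `|lambda| * M) * I2)%:E.
Proof.
rewrite second_momentE -(integral_law_cst mK K0 K1 (expR (2 * `|lambda| * M) * I2)%:E).
have mdp h : measurable_fun [set: B] (fun g : B => psi (h * g)%g - psi g)%R.
  exact: measurable_diff.
apply: le_integral_law => //.
- exact: measurable_exp_moment.
- by move=> h; apply: integral_ge0 => g _; rewrite lee_fin mulr_ge0 ?expR_ge0 ?sqr_ge0.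
- by move=> _; rewrite lee_fin mulr_ge0 ?expR_ge0.
move=> h Kh; rewrite EFinM -fI2.
rewrite -(ge0_integralZl mu measurableT mf2) ?lee_fin ?expR_ge0//.
apply: ae_ge0_le_integral => //.
- by move=> g _; rewrite lee_fin mulr_ge0 ?expR_ge0 ?sqr_ge0.
- apply/measurable_EFinP; apply: measurable_funM; last exact: measurable_funX.
  by apply: (measurableT_comp (@measurable_expR R)); exact: measurable_funM.
- by move=> g _; rewrite mule_ge0// lee_fin expR_ge0.
- exact: measurable_funeM.
have := hlipV Kh; apply: filterS => g hg _.
rewrite -EFinM lee_fin ler_wpM2r ?sqr_ge0// ler_expR.
apply: le_trans (ler_norm _) _; rewrite !normrM ger0_norm//.
by rewrite ler_wpM2l// mulr_ge0.
Qed.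

Hypothesis lambda1 : (`|lambda| <= 1)%R.

Lemma f2_integrable : mu.-integrable setT (fun g : B => (f g ^+ 2)%:E).
Proof.
apply/integrableP; split => //.
by under eq_integral do rewrite gee0_abs//; rewrite fI2 ltry.
Qed.

Let p (h : G) : R := fine (pair_diff mu (fun g => f g ^+ 2)%R psi (h^-1)%g).

Let pE h : pair_diff mu (fun g => f g ^+ 2)%R psi (h^-1)%g = (p h)%:E.
Proof.
by rewrite fineK//; apply: (pair_diff_fin hU hmu ler01 f2_integrable mpsiB hpsi).
Qed.

Lemma second_moment_taylor : second_moment <=
  ((1 + 4 * lambda ^+ 2 * (M ^+ 2 * expR (2 * M))) * I2)%:E +
  (2 * lambda)%:E * \int[nu]_h pair_diff mu (fun g => f g ^+ 2)%R psi (h^-1)%g.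
Proof.
rewrite second_momentE.
(* With t the increment of psi, |t| <= M and |lambda| <= 1 give |2 lambda t| <= 2 M; the quadratic
   term of [expR_quadratic_bound] is then at most expR (2 * M) * 4 lambda^2 M^2. *)
set c := (1 + _)%R.
have c0 : (0 <= c)%R.
  apply: addr_ge0 => //; apply: mulr_ge0.
    by rewrite mulr_ge0// sqr_ge0.
  by rewrite mulr_ge0// ?sqr_ge0 ?expR_ge0.
have mY := measurable_exp_moment.
have mp : measurable_fun [set: B] (p : B -> R).
  apply: (measurableT_comp (fine_measurable _)) => //.
  have mf2R : measurable_fun [set: B] (fun g : B => f g ^+ 2)%R.
    exact: measurable_funX.
  exact: (measurableT_comp (measurable_pair_diff hG hU hmu mf2R mpsi)
    (@measurable_invg G)).
under [X in _ <= _ + _ * X]eq_integral do rewrite pE.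
pose Y h := \int[mu]_g (expR (2 * lambda * (psi (h * g)%g - psi g)) * f g ^+ 2)%:E.
have Y0 h : 0 <= Y h.
  by apply: integral_ge0 => g _; rewrite lee_fin mulr_ge0 ?expR_ge0 ?sqr_ge0.
have YE h : K h != 0%R -> Y h <= (c * I2 + 2 * lambda * p h)%:E.
  move=> Kh.
  have i1 : mu.-integrable setT (fun g : B => (c * f g ^+ 2)%:E).
    by under eq_fun do rewrite EFinM; apply: integrableZl => //; exact: f2_integrable.
  have i2 := integrable_mul_diff hU hmu ler01 mpsiB hpsi (h^-1)%g f2_integrable.
  have i3 : mu.-integrable setT (fun g : B =>
      (2 * lambda * (f g ^+ 2 * (psi (h^-1^-1 * g)%g - psi g)))%:E).
    by under eq_fun do rewrite EFinM; exact: integrableZl.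
  have -> : (c * I2 + 2 * lambda * p h)%:E = \int[mu]_g ((c * f g ^+ 2)%:E +
      (2 * lambda * (f g ^+ 2 * (psi (h^-1^-1 * g)%g - psi g)))%:E).
    rewrite integralD//; under eq_integral do rewrite EFinM.
    rewrite integralZl//; last exact: f2_integrable.
    under [X in _ = _ + X]eq_integral do rewrite EFinM.
    by rewrite integralZl// fI2 -/(pair_diff _ _ _ _) pE.
  have mdp : measurable_fun [set: B] (fun g : B => psi (h * g)%g - psi g)%R.
    exact: measurable_diff.
  have hae : {ae mu, forall g : B, (expR (2 * lambda * (psi (h * g)%g - psi g)) *
      f g ^+ 2 <= c * f g ^+ 2 +
      2 * lambda * (f g ^+ 2 * (psi (h^-1^-1 * g)%g - psi g)))%R}.
    have := hlipV Kh; apply: filterS => g; rewrite invgK.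
    set t := (psi _ - psi g)%R => ht.
    have hq : (expR (2 * lambda * t) <= 1 + 2 * lambda * t +
        expR (2 * M) * (2 * lambda * t) ^+ 2)%R.
      apply: expR_quadratic_bound; rewrite !normrM ger0_norm// -mulrA.
      by rewrite ler_wpM2l// -[leRHS]mul1r ler_pM.
    have t2 : (t ^+ 2 <= M ^+ 2)%R by rewrite -[leLHS]real_normK ?num_real// lerXn2r ?nnegrE.
    have hc : (expR (2 * lambda * t) <= c + 2 * lambda * t)%R.
      apply: le_trans hq _; rewrite /c -!addrA lerD2l [leRHS]addrC lerD2l.
      rewrite !exprMn; have -> : (4 * lambda ^+ 2 * (M ^+ 2 * expR (2 * M)) =
        expR (2 * M) * (2 ^+ 2 * lambda ^+ 2 * M ^+ 2))%R by ring.
      by rewrite ler_wpM2l ?expR_ge0// ler_wpM2l// mulr_ge0 ?sqr_ge0.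
    have := ler_wpM2r (sqr_ge0 (f g)) hc; rewrite mulrDl; lra.
  apply: ge0_ae_le_integral => //.
  - apply/measurable_EFinP; apply: measurable_funM; last exact: measurable_funX.
    by apply: (measurableT_comp (@measurable_expR R)); exact: measurable_funM.
  - by apply: emeasurable_funD; [exact: measurable_int i1|exact: measurable_int i3].
  - by move=> g; rewrite lee_fin mulr_ge0 ?expR_ge0 ?sqr_ge0.
have ip : nu.-integrable setT (fun h : B => (p h)%:E).
  apply: (integrable_law_bounded mK K0 K1 (M := (M * I2)%R)) => // h Kh.
  rewrite -lee_fin -abse_EFin -pE.
  have := pair_diff_le hU hmu ler01 f2_integrable mpsiB hpsi
    (set_pow_inv (let: And5 _ _ _ a _ := hU in a) (Km Kh)).
  rewrite mulr1 => /le_trans; apply.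
  by rewrite EFinM -fI2; under eq_integral do rewrite gee0_abs//.
apply: (@le_trans _ _ (\int[nu]_h ((c * I2)%:E + (2 * lambda)%:E * (p h)%:E))).
  apply: ge0_ae_le_integral => //.
  - by apply: emeasurable_funD => //; apply: measurable_funeM; exact/measurable_EFinP.
  - by have := ae_law_support; apply: filterS => h Kh; rewrite -EFinM -EFinD; exact: YE.
rewrite integralD//; last 2 first.
- apply/integrableP; split => //; rewrite /= (integral_law_cst mK K0 K1).
  by rewrite ltry.
- exact: integrableZl.
by rewrite integralZl// (integral_law_cst mK K0 K1).
Qed.

Let W3 (k h : G) : \bar R := \int[mu]_g ((X h g - X k g) ^+ 2)%:E.

Let W30 k h : 0 <= W3 k h.
Proof. by apply: integral_ge0 => g _; rewrite lee_fin sqr_ge0. Qed.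

Let mW3 : measurable_fun setT (fun p : B * B => W3 p.1 p.2).
Proof.
apply: (measurable_tonelli1 (haar_sigma_finite hG hU hmu)
  (f := fun p : (B * B) * B => ((X p.1.2 p.2 - X p.1.1 p.2) ^+ 2)%:E)).
  apply/measurable_EFinP; apply: measurable_funX; apply: measurable_funB.
    apply: (measurableT_comp mX (g := fun p : (B * B) * B => (p.1.2, p.2))).
    apply: measurable_fun_pair => //.
    exact: (measurableT_comp measurable_snd measurable_fst).
  apply: (measurableT_comp mX (g := fun p : (B * B) * B => (p.1.1, p.2))).
  apply: measurable_fun_pair => //.
  exact: (measurableT_comp measurable_fst measurable_fst).
by move=> z; rewrite lee_fin sqr_ge0.
Qed.

Let mf_div h : measurable_fun [set: B] (fun g : B => f (h^-1 * g)%g).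
Proof. exact: measurable_mulgl_comp. Qed.

Lemma integral_f2_translate h : \int[mu]_g (f (h^-1 * g)%g ^+ 2)%:E = I2%:E.
Proof. by rewrite (integral_mulgl hmu (h^-1)%g mf2). Qed.

Lemma weighted_close h g : (`|psi (h^-1 * g)%g - psi g| <= M)%R ->
  (`|X h g - f (h^-1 * g)%g| <= `|lambda| * M * expR M * f (h^-1 * g)%g)%R.
Proof.
move=> hg; rewrite /weighted -[X in (`|_ - X| <= _)%R]mul1r -mulrBl normrM.
rewrite [X in (_ * X <= _)%R]ger0_norm//.
rewrite ler_wpM2r//.
have ht : (`|lambda * (psi g - psi (h^-1 * g)%g)| <= `|lambda| * M)%R.
  by rewrite normrM ler_wpM2l// distrC.
apply: le_trans (expR_linear_bound (M := M) _) _.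
  by apply: le_trans ht _; rewrite -[leRHS]mul1r ler_wpM2r.
by rewrite ler_wpM2r// expR_ge0.
Qed.

(** By [weighted_close] the weighted function X_h differs from the translate of f by a small
    multiple of that translate. Two applications of the inequality for the square of a sum give the
    coefficients 2 and 4, and the 4 falls on two translates of squared norm I2, whence 8. *)
Lemma sq_diff_weighted_le (k h : G) : K k != 0%R -> K h != 0%R ->
  sq_diff mu f (k^-1 * h)%g <=
  2%:E * W3 k h + (8 * (`|lambda| * M * expR M) ^+ 2 * I2)%:E.
Proof.
move=> Kk Kh; set dl := (`|lambda| * M * expR M)%R.
rewrite -sq_diff_pair//.
have -> : (8 * dl ^+ 2 * I2)%:E =
    (4 * dl ^+ 2)%:E * (\int[mu]_g (f (h^-1 * g)%g ^+ 2)%:E +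
                        \int[mu]_g (f (k^-1 * g)%g ^+ 2)%:E).
  by rewrite !integral_f2_translate -EFinD -EFinM; congr (_%:E); ring.
have mfk (l : G) : measurable_fun [set: B] (fun g : B => (f (l^-1 * g)%g ^+ 2)%:E).
  by apply/measurable_EFinP; exact: measurable_funX.
have mS : measurable_fun [set: B]
    (fun g : B => (f (h^-1 * g)%g ^+ 2)%:E + (f (k^-1 * g)%g ^+ 2)%:E).
  exact: emeasurable_funD.
have mXX : measurable_fun [set: B] (fun g : B => ((X h g - X k g) ^+ 2)%:E).
  by apply: measurable_sqB.
have n0 (l : G) g : 0 <= (f (l^-1 * g)%g ^+ 2)%:E by rewrite lee_fin sqr_ge0.
have dl0 : 0 <= (4 * dl ^+ 2)%:E by rewrite lee_fin mulr_ge0// sqr_ge0.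
rewrite -ge0_integralD// -ge0_integralZl//; last by move=> g _; rewrite adde_ge0.
rewrite /W3 -ge0_integralZl//; last by move=> g _; rewrite lee_fin sqr_ge0.
rewrite -ge0_integralD//; last 4 first.
- by move=> g _; rewrite mule_ge0// lee_fin sqr_ge0.
- exact: measurable_funeM.
- by move=> g _; rewrite mule_ge0// adde_ge0.
- exact: measurable_funeM.
apply: ge0_ae_le_integral => //.
- exact: measurable_sqB.
- by apply: emeasurable_funD; exact: measurable_funeM.
- by move=> g; rewrite lee_fin sqr_ge0.
have := hlip Kh; have := hlip Kk; apply: filterS2 => g /weighted_close hk /weighted_close hh.
rewrite -!EFinM -EFinD lee_fin.
move: hk hh; rewrite -/dl.
set a := f _; set b := f (h^-1 * g)%g; set x := X k g; set y := X h g => hk hh.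
have hk2 : ((x - a) ^+ 2 <= (dl * a) ^+ 2)%R.
  by rewrite -[leLHS]real_normK ?num_real// lerXn2r ?nnegrE// (le_trans _ hk).
have hh2 : ((y - b) ^+ 2 <= (dl * b) ^+ 2)%R.
  by rewrite -[leLHS]real_normK ?num_real// lerXn2r ?nnegrE// (le_trans _ hh).
rewrite exprMn in hk2; rewrite exprMn in hh2.
have e1 := sqr_ge0 ((y - x) + ((y - b) - (x - a)))%R.
have e2 := sqr_ge0 ((y - b) + (x - a))%R.
move: hk2 hh2 e1 e2; lra.
Qed.

Lemma energy_le : energy mu mK f <=
  2%:E * variance_int + (8 * (`|lambda| * M * expR M) ^+ 2 * I2)%:E.
Proof.
set c := (8 * _ * I2)%R.
have c0 : 0 <= c%:E by rewrite lee_fin mulr_ge0// mulr_ge0// sqr_ge0.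
have msd := div_measurable_sq_diff hG hU hmu mf.
have nu_sf := law_sigma_finite mK K0 K1.
have mW3k k : measurable_fun [set: B] (fun h : B => W3 k h).
  exact: (measurable_fun_pair2 (f := fun p : B * B => W3 p.1 p.2) k mW3).
have mVk : measurable_fun [set: B] (fun k : B => \int[nu]_h W3 k h).
  exact: (measurable_tonelli1 nu_sf (f := fun p : B * B => W3 p.1 p.2)).
have V0 k : 0 <= \int[nu]_h W3 k h by exact: integral_ge0.
have inner k : K k != 0%R ->
    \int[nu]_h sq_diff mu f (k^-1 * h)%g <= 2%:E * (\int[nu]_h W3 k h) + c%:E.
  move=> Kk.
  apply: (@le_trans _ _ (\int[nu]_h (2%:E * W3 k h + c%:E))).
    apply: le_integral_law => //.
    - by apply: measurable_mulgl_comp; exact: div_measurable_borel.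
    - by apply: emeasurable_funD => //; exact: measurable_funeM.
    - by move=> h; exact: sq_diff_ge0.
    - by move=> h; rewrite adde_ge0 ?mule_ge0.
    - by move=> h Kh; exact: sq_diff_weighted_le.
  rewrite ge0_integralD//; last 2 first.
  - by move=> h _; rewrite mule_ge0.
  - exact: measurable_funeM.
  by rewrite ge0_integralZl// (integral_law_cst mK K0 K1).
rewrite /energy /variance_int.
apply: (@le_trans _ _ (\int[nu]_k (2%:E * \int[nu]_h W3 k h + c%:E))).
  apply: le_integral_law => //.
  - apply: (measurable_tonelli1 nu_sf
      (f := fun p : B * B => sq_diff mu f (p.1^-1 * p.2)%g)) => // z.
    exact: sq_diff_ge0.
  - by apply: emeasurable_funD => //; exact: measurable_funeM.
  - by move=> k; apply: integral_ge0 => h _; exact: sq_diff_ge0.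
  - by move=> k; rewrite adde_ge0 ?mule_ge0.
rewrite ge0_integralD//; last 2 first.
- by move=> h _; rewrite mule_ge0.
- exact: measurable_funeM.
by rewrite ge0_integralZl// (integral_law_cst mK K0 K1).
Qed.

(** Factor a^2 - b^2 and apply |a - b| |a + b| <= t/2 (a - b)^2 + 1/(2t) (a + b)^2. The free
    parameter t will be of order 1/|lambda|, which makes the second term O(lambda^2) once multiplied
    by lambda. *)
Lemma l1_diff_sq_le (t : R) u : (0 < t)%R ->
  l1_diff mu (fun g => f g ^+ 2)%R u <=
  (t / 2)%:E * sq_diff mu f u + (2 / t * I2)%:E.
Proof.
move=> t0.
have -> : (2 / t * I2)%:E = (t^-1)%:E * (\int[mu]_g (f (u^-1 * g)%g ^+ 2)%:E +
    \int[mu]_g (f g ^+ 2)%:E).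
  by rewrite integral_f2_translate fI2 -EFinD -EFinM; congr (_%:E); ring.
have mfu : measurable_fun [set: B] (fun g : B => (f (u^-1 * g)%g ^+ 2)%:E).
  by apply/measurable_EFinP; exact: measurable_funX.
have msd : measurable_fun [set: B] (fun g : B => ((f (u^-1 * g)%g - f g) ^+ 2)%:E).
  exact: measurable_sqB.
have mS := emeasurable_funD mfu mf2.
have u0 g : 0 <= (f (u^-1 * g)%g ^+ 2)%:E by rewrite lee_fin sqr_ge0.
have t20 : 0 <= (t / 2)%:E by rewrite lee_fin divr_ge0// ltW.
have ti0 : 0 <= (t^-1)%:E by rewrite lee_fin invr_ge0 ltW.
rewrite -ge0_integralD// -ge0_integralZl//; last by move=> g _; rewrite adde_ge0.
rewrite /sq_diff -ge0_integralZl//; last by move=> g _; rewrite lee_fin sqr_ge0.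
rewrite -ge0_integralD//; last 4 first.
- by move=> g _; rewrite mule_ge0// lee_fin sqr_ge0.
- exact: measurable_funeM.
- by move=> g _; rewrite mule_ge0// adde_ge0.
- exact: measurable_funeM.
apply: ge0_le_integral => //.
- apply: measurableT_comp => //; apply/measurable_EFinP.
  by apply: (measurable_diff (phi := fun g => f g ^+ 2)%R); exact: measurable_funX.
- by apply: emeasurable_funD; exact: measurable_funeM.
- move=> g _; rewrite -!EFinM -EFinD lee_fin.
  set a := f _; set b := f g.
  rewrite subr_sqr normrM.
  have e1 := sqr_ge0 (t * `|a - b| - `|a + b|)%R.
  have ab : (`|a + b| ^+ 2 <= 2 * (a ^+ 2 + b ^+ 2))%R.
    by rewrite real_normK ?num_real//; have := sqr_ge0 (a - b)%R; nra.
  rewrite -(ler_pM2l t0) mulrDr mulVKf ?lt0r_neq0//.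
  rewrite -(real_normK (num_real (a - b))).
  move: e1 ab; nra.
Qed.

(** Write Q for M^2 * expR (2 * M) and P for the integral of [pair_diff]. By [moment_identity] and
    Taylor's formula, the first moment plus half the variance is at most (1 + 4 lambda^2 Q) I2 + 2
    lambda P. The last term costs at most a quarter of the energy plus 16 C1^2 C3 lambda^2 I2, and
    by [energy_le] a quarter of the energy is at most half the variance plus 2 lambda^2 Q I2. The
    half variances cancel, and 4 + 2 = 6. *)
Lemma first_moment_le_small (C1 C3 : R) : (0 < C1)%R -> (0 < C3)%R ->
  (forall D : R, (0 <= D)%R ->
    (forall u, U u -> l1_diff mu (fun g => f g ^+ 2)%R u <= D%:E) ->
    `|\int[nu]_h pair_diff mu (fun g => f g ^+ 2)%R psi (h^-1)%g| <= (C1 * D)%:E) ->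
  (forall u, U u -> sq_diff mu f u <= C3%:E * energy mu mK f) ->
  first_moment <=
  (expR ((6 * (M ^+ 2 * expR (2 * M)) + 16 * C1 ^+ 2 * C3) * lambda ^+ 2) * I2)%:E.
Proof.
move=> C10 C30 hmean hgap.
have L0 : 0 <= first_moment.
  by apply: integral_ge0 => g _; apply: mule_ge0; apply: integral_ge0 => h _;
    rewrite lee_fin.
have V0 : 0 <= variance_int.
  by apply: integral_ge0 => k _; apply: integral_ge0 => h _; exact: W30.
have S0 : 0 <= second_moment.
  by apply: integral_ge0 => g _; apply: integral_ge0 => h _; rewrite lee_fin sqr_ge0.
(* Finiteness passes from the second moment to the variance, the first moment and the energy; the
   cancellation is then carried out in the reals. *)
have fin (x : \bar R) (c : R) : 0 <= x -> x <= c%:E -> exists2 r : R, (0 <= r)%R & x = r%:E.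
  by case: x => // r; rewrite lee_fin => r0 _; exists r.
have [sS sS0 SE] := fin _ _ S0 second_moment_le.
have id := moment_identity.
have [v v0 VE] : exists2 r : R, (0 <= r)%R & variance_int = r%:E.
  by apply: (fin _ (2 * sS)%R V0); rewrite EFinM -SE -id leeDl// mule_ge0.
have [l l0 LE] : exists2 r : R, (0 <= r)%R & first_moment = r%:E.
  case: (first_moment) L0 id => // [r r0 _|_]; first by exists r.
  by rewrite SE VE mulry gtr0_sg// mul1e.
have E0 := energy_ge0 mu mK f.
have hE := energy_le; rewrite VE -EFinM -EFinD in hE.
have [en en0 EE] := fin _ _ E0 hE.
rewrite EE lee_fin in hE.
rewrite SE VE LE -!EFinM -EFinD in id; case: id => id.
(* For lambda nonzero t is 1 / (4 |lambda| C1 C3), which gives the energy the coefficient 1/4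
   exactly; for lambda = 0 any t will do. *)
have [t t0 [ht1 ht2]] : exists2 t : R, (0 < t)%R &
    (`|lambda| * C1 * C3 * t <= 1 / 4 /\ `|lambda| * t^-1 <= 4 * C1 * C3 * lambda ^+ 2)%R.
  have [->|ln0] := eqVneq lambda 0%R.
    by exists 1%R => //; rewrite normr0 !mul0r expr0n/= mulr0; split.
  have ln : (0 < `|lambda|)%R by rewrite normr_gt0.
  exists ((4 * `|lambda| * C1 * C3)^-1)%R; first by rewrite invr_gt0 !mulr_gt0.
  split.
    rewrite le_eqVlt; apply/orP; left; apply/eqP; field.
    by rewrite !lt0r_neq0.
  rewrite invrK -(real_normK (num_real lambda)) le_eqVlt; apply/orP; left; apply/eqP.
  ring.
have hp : `|\int[nu]_h pair_diff mu (fun g => f g ^+ 2)%R psi (h^-1)%g| <=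
    (C1 * (t / 2 * (C3 * en) + 2 / t * I2))%:E.
  apply: hmean.
    have t0' := ltW t0; have C30' := ltW C30.
    by rewrite addr_ge0 ?mulr_ge0 ?invr_ge0// mulr_ge0.
  move=> u Uu; apply: le_trans (l1_diff_sq_le u t0) _.
  rewrite [leRHS]EFinD; apply: leeD2r; rewrite [leRHS]EFinM; apply: lee_wpmul2l.
    by rewrite lee_fin divr_ge0// ltW.
  by have := hgap u Uu; rewrite EE.
have hT := second_moment_taylor.
move: hp hT; case: (\int[nu]_h _) => [P|//|//]; rewrite abse_EFin lee_fin => hp.
rewrite SE -EFinM -EFinD lee_fin => hT.
rewrite LE lee_fin.
set Q := (M ^+ 2 * expR (2 * M))%R in hT *.
have dlE : ((`|lambda| * M * expR M) ^+ 2 = lambda ^+ 2 * Q)%R.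
  rewrite !exprMn real_normK ?num_real// -expRM_natl /Q mulrA.
  by [].
rewrite dlE in hE.
have hlP : (lambda * P <= `|lambda| * (C1 * (t / 2 * (C3 * en) + 2 / t * I2)))%R.
  by apply: le_trans (ler_norm _) _; rewrite normrM ler_wpM2l.
apply: (@le_trans _ _ ((1 + (6 * Q + 16 * C1 ^+ 2 * C3) * lambda ^+ 2) * I2)%R); last first.
  by rewrite ler_wpM2r// expR_ge1Dx.
have h1 := ler_wpM2r en0 ht1.
have h2 := ler_wpM2r (mulr_ge0 (ltW C10) I20) ht2.
move: id hE hT hlP h1 h2.
have -> : (`|lambda| * (C1 * (t / 2 * (C3 * en) + 2 / t * I2)) =
  2^-1 * (`|lambda| * C1 * C3 * t * en) + 2 * (`|lambda| / t * (C1 * I2)))%R by ring.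
set x := (`|lambda| * C1 * C3 * t * en)%R; set y := (`|lambda| / t * (C1 * I2))%R.
lra.
Qed.

Lemma first_moment_le_second : first_moment <= second_moment.
Proof.
have V0 : 0 <= variance_int.
  by apply: integral_ge0 => k _; apply: integral_ge0 => h _; exact: W30.
have h : 2%:E * first_moment <= 2%:E * second_moment.
  by rewrite -moment_identity leeDr.
by move: h; rewrite lee_pmul2l.
Qed.

End fixed_function.
End WeightedL2.

(** * Iteration of the weighted estimate *)

Section WeightedIterates.
Variables (R : realType) (G : topologicalGroupType).
Implicit Types (g h k x y z : G).
Local Notation B := (borel G).
Hypothesis hG : hausdorff_space G.
Variable U : set G.
Hypothesis hU : generating_nbhd U.
Variable mu : {measure set B -> \bar R}.
Hypothesis hmu : left_haar_measure mu.
Variable Delta : G -> R.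
Hypothesis hDelta : modular_function mu Delta.
Variable K : G -> R.
Hypothesis mK : measurable_fun [set: B] (K : B -> R).
Hypothesis K0 : (forall g, 0 <= K g)%R.
Local Open Scope ereal_scope.
Hypothesis K1 : \int[mu]_g (K g)%:E = 1.
Local Notation nu := (density_measure mu mK).
Local Notation avg := (avg mu mK).
Local Notation measb f := (measurable_fun [set: B] (f : B -> \bar R)).

Lemma le_avg (f f' : G -> \bar R) g : measb f -> measb f' ->
  (forall x, 0 <= f x) -> (forall x, f x <= f' x) -> avg f g <= avg f' g.
Proof.
move=> mf mf' f0 ff'; apply: ge0_le_integral => //.
- exact: (measurable_divg g mf).
- exact: (measurable_divg g mf').
Qed.

Lemma avgD (f f' : G -> \bar R) g : measb f -> measb f' ->
  (forall x, 0 <= f x) -> (forall x, 0 <= f' x) ->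
  avg (fun x => f x + f' x) g = avg f g + avg f' g.
Proof.
move=> mf mf' f0 f'0;
by rewrite /avg ge0_integralD//; exact: measurable_divg.
Qed.

Lemma avgZ (c : R) (f : G -> \bar R) g : (0 <= c)%R -> measb f ->
  (forall x, 0 <= f x) -> avg (fun x => c%:E * f x) g = c%:E * avg f g.
Proof.
by move=> c0 mf f0; rewrite /avg ge0_integralZl//; exact: measurable_divg.
Qed.

Lemma avg1 g : avg (fun=> 1) g = 1.
Proof. exact: (integral_law_cst mK K0 K1). Qed.

Local Notation avgn n f := (iter n avg f).

Lemma avgn_ge0 n (f : G -> \bar R) g : (forall x, 0 <= f x) -> 0 <= avgn n f g.
Proof. by move=> f0; elim: n g => //= n IH g; exact: avg_ge0. Qed.

Lemma measurable_avgn n (f : G -> \bar R) : measb f -> (forall x, 0 <= f x) ->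
  measb (avgn n f).
Proof.
move=> mf f0; elim: n => //= n IH; apply: (measurable_avg hG hU hmu hDelta) => //.
by move=> x; exact: avgn_ge0.
Qed.

Lemma le_avgn n (f f' : G -> \bar R) g : measb f -> measb f' ->
  (forall x, 0 <= f x) -> (forall x, f x <= f' x) -> avgn n f g <= avgn n f' g.
Proof.
move=> mf mf' f0 ff'; have f'0 x : 0 <= f' x by exact: le_trans (ff' x).
elim: n g => //= n IH g; apply: le_avg => // [||x].
- exact: measurable_avgn.
- exact: measurable_avgn.
- exact: avgn_ge0.
Qed.

Lemma avgnD n (f f' : G -> \bar R) g : measb f -> measb f' ->
  (forall x, 0 <= f x) -> (forall x, 0 <= f' x) ->
  avgn n (fun x => f x + f' x) g = avgn n f g + avgn n f' g.
Proof.
move=> mf mf' f0 f'0; elim: n g => //= n IH g.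
rewrite -avgD//; try exact: measurable_avgn; try by move=> x; exact: avgn_ge0.
by congr (avg _ g); apply/funext.
Qed.

Lemma avgnZ n (c : R) (f : G -> \bar R) g : (0 <= c)%R -> measb f ->
  (forall x, 0 <= f x) -> avgn n (fun x => c%:E * f x) g = c%:E * avgn n f g.
Proof.
move=> c0 mf f0; elim: n g => //= n IH g.
rewrite -avgZ//; try exact: measurable_avgn; try by move=> x; exact: avgn_ge0.
by congr (avg _ g); apply/funext.
Qed.

Lemma avgn1 n g : avgn n (fun=> 1) g = 1.
Proof.
elim: n g => //= n IH g; rewrite -[RHS](avg1 g).
by congr (avg _ g); apply/funext.
Qed.

Lemma integral_avgn n (f : G -> \bar R) : measb f -> (forall x, 0 <= f x) ->
  \int[mu]_g avgn n f g = \int[mu]_g f g.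
Proof.
move=> mf f0; elim: n => //= n IH.
rewrite (integral_avg hG hU hmu hDelta mK K0 K1) ?IH//.
  exact: measurable_avgn.
by move=> x; exact: avgn_ge0.
Qed.

Variable s : splitting R G.
Hypothesis hK : centered mu s K.
Variable m : nat.
Hypothesis Km : forall g, K g != 0%R -> set_pow U m g.
Variables (W : set G) (kappa : R).
Hypothesis hW : generating_nbhd W.
Hypothesis kappa0 : (0 < kappa)%R.
Hypothesis kappaW : forall g, W g -> (kappa <= K g)%R.

Lemma first_moment_le : exists2 omega : R, (0 < omega)%R &
  forall lambda (psi f : G -> R) I2,
    div_measurable psi -> lipschitz_ae U mu 1 psi ->
    div_measurable f -> (forall x, (0 <= f x)%R) ->
    \int[mu]_g ((f g) ^+ 2)%:E = I2%:E ->
    first_moment mu mK lambda psi f <= (expR (omega * lambda ^+ 2) * I2)%:E.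
Proof.
have [C1 C10 hC1] := mean_pair_diff hG hU hmu mK K0 K1 hK Km.
have [C3 C30 hC3] := spectral_gap hG hU hmu mK K0 K1 hW kappa0 kappaW.
(* C1 and C3 are only known to be nonnegative; the choice of t divides by them, so they are
   increased by 1. *)
pose w1 := (6 * (m%:R ^+ 2 * expR (2 * m%:R)) + 16 * (C1 + 1) ^+ 2 * (C3 + 1) : R)%R.
have w10 : (0 <= w1)%R.
  apply: addr_ge0; first by rewrite !mulr_ge0.
  by apply: mulr_ge0; [apply: mulr_ge0 => //; exact: sqr_ge0|exact: addr_ge0].
(* The part w1 serves |lambda| <= 1, and 2 m serves |lambda| > 1, where |lambda| <= lambda^2 makes
   the crude bound sufficient; the 1 makes omega positive. *)
exists (w1 + 2 * m%:R + 1)%R; first by have := ler0n R m; lra.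
move=> lambda psi f I2 mpsi hpsi mf f0 fI2.
have I20 : (0 <= I2)%R.
  by rewrite -lee_fin -fI2; apply: integral_ge0 => x _; rewrite lee_fin sqr_ge0.
have [l1|l1] := leP `|lambda|%R 1%R.
  have := @first_moment_le_small _ _ hG _ hU _ hmu _ mK K0 K1 _ Km lambda psi f mpsi
    hpsi mf f0 _ fI2 l1 (C1 + 1)%R (C3 + 1)%R.
  move=> /(_ (ltr_wpDl C10 ltr01) (ltr_wpDl C30 ltr01)) h.
  apply: le_trans (h _ _) _.
  - move=> D D0 hD.
    have [||||||_ hm] := hC1 (fun g => f g ^+ 2)%R psi 1%R D => //.
    + exact: (f2_integrable mf fI2).
    + apply: (le_trans hm); rewrite lee_fin mul1r ler_wpM2r//.
      by rewrite lerDl.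
  - move=> u Uu; apply: le_trans (hC3 f mf u Uu) _.
    by apply: lee_wpmul2r; [exact: energy_ge0|rewrite lee_fin lerDl].
  - rewrite lee_fin ler_wpM2r// ler_expR ler_wpM2r ?sqr_ge0//.
    by rewrite -addrA lerDl addr_ge0// mulr_ge0.
apply: le_trans (first_moment_le_second hG hU hmu mK K0 K1 lambda mpsi mf f0) _.
apply: le_trans (second_moment_le hG hU hmu mK K0 K1 Km lambda mpsi hpsi mf fI2) _.
rewrite lee_fin ler_wpM2r// ler_expR -(real_normK (num_real lambda)).
have ll : (`|lambda| <= `|lambda| ^+ 2)%R by rewrite ler_eXnr// ltW.
apply: (@le_trans _ _ (2 * m%:R * `|lambda| ^+ 2)%R).
  by rewrite mulrAC ler_wpM2l// mulr_ge0.
by rewrite ler_wpM2r ?exprn_ge0// addrAC lerDr addr_ge0.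
Qed.

Definition weighted_avgn lambda (psi : G -> R) n (f : G -> \bar R) (g : G) : \bar R :=
  (expR (lambda * psi g))%:E *
  avgn n (fun x => (expR (- lambda * psi x))%:E * f x) g.

Lemma measurable_exp_mul (c : R) (psi : G -> R) (f : G -> \bar R) :
  measurable_fun [set: B] (psi : B -> R) -> measb f ->
  measb (fun x => (expR (c * psi x))%:E * f x).
Proof.
move=> mpsi mf; apply: emeasurable_funM => //; apply/measurable_EFinP.
by apply: (measurableT_comp (@measurable_expR R)); exact: measurable_funM.
Qed.

Lemma lipschitz_ae_eq (A : R) (psi psi' : G -> R) :
  {ae mu, forall g : B, psi g = psi' g} ->
  lipschitz_ae U mu A psi -> lipschitz_ae U mu A psi'.
Proof.
move=> E h u Uu; have E' := ae_mulgl hmu (u^-1)%g E; have hu := h u Uu.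
by apply: filterS3 E E' hu => g -> ->.
Qed.

(** If f has infinite norm there is nothing to prove. Otherwise f is finite almost everywhere, and f
    and psi may be replaced by real versions measurable on the product, which changes neither the
    averages nor, almost everywhere, the weights. *)
Lemma weighted_avg_l2 : exists2 omega : R, (0 < omega)%R &
  forall lambda (psi : G -> R) (f : G -> \bar R),
    measurable_fun [set: B] (psi : B -> R) -> lipschitz_ae U mu 1 psi ->
    measb f -> (forall x, 0 <= f x) ->
    \int[mu]_g (weighted_avgn lambda psi 1 f g * weighted_avgn lambda psi 1 f g) <=
    (expR (omega * lambda ^+ 2))%:E * \int[mu]_g (f g * f g).
Proof.
have [omega omega0 hom] := first_moment_le; exists omega => //.
move=> lambda psi f mpsi hpsi mf f0.
have mff : measb (fun g => f g * f g) by exact: emeasurable_funM.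
have ff0 g : 0 <= f g * f g by exact: mule_ge0.
have [Ioo|Ioo] := eqVneq (\int[mu]_g (f g * f g)) +oo.
  by rewrite Ioo mulry gtr0_sg ?expR_gt0// mul1e leey.
have fin : \int[mu]_g (f g * f g) \is a fin_num.
  by rewrite ge0_fin_numE ?integral_ge0// lt_neqAle Ioo leey.
have iff : mu.-integrable setT (fun g : B => f g * f g).
  apply/integrableP; split => //.
  by under eq_integral do rewrite gee0_abs//; rewrite -ge0_fin_numE ?integral_ge0.
have ffin : {ae mu, forall g : B, f g = (fine (f g))%:E}.
  have := integrable_ae measurableT iff; apply: filterS => g /(_ I).
  case: (f g) (f0 g) => [r|_|//]; first by [].
  by rewrite mulyy.
have mff' : measurable_fun [set: B] (fun g : B => fine (f g)).
  exact: (measurableT_comp (fine_measurable _)).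
have [f' [mf' f'0 ff']] := ge0_real_ae_div_measurable hU hG hmu mff' (fun g => fine_ge0 (f0 g)).
have [psi' mpsi' pp'] := real_ae_div_measurable hU hG hmu mpsi.
have hpsi' := lipschitz_ae_eq pp' hpsi.
have aef : {ae mu, forall g : B, f g = (f' g)%:E}.
  by apply: filterS2 ffin ff' => g -> <-.
have mf'B := div_measurable_borel mf'; have mpsi'B := div_measurable_borel mpsi'.
have IE : \int[mu]_g (f g * f g) = \int[mu]_g (f' g ^+ 2)%:E.
  apply: ge0_ae_eq_integral => //.
  - by apply/measurable_EFinP; exact: measurable_funX.
  - by move=> x _; rewrite lee_fin sqr_ge0.
  - by apply: filterS aef => g -> _; rewrite -EFinM expr2.
have Ifin : \int[mu]_g (f' g ^+ 2)%:E = (fine (\int[mu]_g (f g * f g)))%:E.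
  by rewrite fineK// IE.
have := hom lambda psi' f' _ mpsi' hpsi' mf' f'0 Ifin.
rewrite EFinM fineK//; apply: le_trans; rewrite le_eqVlt; apply/orP; left; apply/eqP.
have mw : measb (weighted_avgn lambda psi 1 f).
  apply: measurable_exp_mul => //; apply: (measurable_avg hG hU hmu hDelta) => //.
    exact: measurable_exp_mul.
  by move=> x; rewrite mule_ge0// lee_fin expR_ge0.
have w0 g : 0 <= weighted_avgn lambda psi 1 f g.
  rewrite mule_ge0 ?lee_fin ?expR_ge0//; apply: avg_ge0 => x.
  by rewrite mule_ge0// lee_fin expR_ge0.
have mX : measb (fun g => \int[nu]_h (weighted lambda psi' f' h g)%:E).
  apply: (measurable_int_law mK K0 K1 (f := fun p : B * B => (weighted lambda psi' f' p.1 p.2)%:E)).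
    by apply/measurable_EFinP; exact: measurable_weighted.
  by move=> p; rewrite lee_fin mulr_ge0// expR_ge0.
have X0 g : 0 <= \int[nu]_h (weighted lambda psi' f' h g)%:E.
  by apply: integral_ge0 => h _; rewrite lee_fin mulr_ge0// expR_ge0.
apply: ge0_ae_eq_integral => //.
- exact: emeasurable_funM.
- exact: emeasurable_funM.
- by move=> g _; exact: mule_ge0.
- by move=> g _; exact: mule_ge0.
have mh : measb (fun x => (expR (- lambda * psi' x))%:E * (f' x)%:E).
  by apply: measurable_exp_mul => //; exact/measurable_EFinP.
have pp2 := pp'.
have h0 x : 0 <= (expR (- lambda * psi' x))%:E * (f' x)%:E.
  by rewrite mule_ge0// lee_fin// expR_ge0.
apply: filterS (pp') => g pg _.
have -> : weighted_avgn lambda psi 1 f g = \int[nu]_h (weighted lambda psi' f' h g)%:E.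
  rewrite /weighted_avgn pg /=.
  rewrite (@ae_eq_avg _ _ mu hmu Delta hDelta _ mK _
    (fun x => (expR (- lambda * psi' x))%:E * (f' x)%:E))//.
  - have e0 : 0 <= (expR (lambda * psi' g))%:E by rewrite lee_fin expR_ge0.
    have mg := measurable_divg g mh.
    have hg0 h (_ : [set: B] h) := h0 (h^-1 * g)%g.
    rewrite /avg -(ge0_integralZl nu measurableT mg hg0 e0).
    apply: eq_integral => h _; rewrite -!EFinM /weighted mulrA -expRD.
    by congr (expR _ * _)%:E; ring.
  - exact: measurable_exp_mul.
  - by move=> x; rewrite mule_ge0// lee_fin expR_ge0.
  - by apply: filterS2 aef pp2 => x -> ->.
by [].
Qed.

Definition weighted_l2_bound (omega : R) :=
  forall lambda (psi : G -> R) n (f : G -> \bar R),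
    measurable_fun [set: B] (psi : B -> R) -> lipschitz_ae U mu 1 psi ->
    measb f -> (forall x, 0 <= f x) ->
    \int[mu]_g (weighted_avgn lambda psi n f g * weighted_avgn lambda psi n f g) <=
    (expR (omega * lambda ^+ 2 * n%:R))%:E * \int[mu]_g (f g * f g).

(** Inner weights cancel, so the conjugate of the n-th iterate is the n-th iterate of the conjugate
    and the one-step bounds multiply. *)
Lemma weighted_avgn_l2 : exists2 omega : R, (0 < omega)%R & weighted_l2_bound omega.
Proof.
have [omega omega0 hom] := weighted_avg_l2; exists omega => //.
move=> lambda psi n f mpsi hpsi mf f0.
have ee x (y : \bar R) : (expR (- lambda * psi x))%:E * ((expR (lambda * psi x))%:E * y) = y.
  by rewrite muleA -EFinM mulNr -expRD addNr expR0 mul1e.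
have ee' x (y : \bar R) : (expR (lambda * psi x))%:E * ((expR (- lambda * psi x))%:E * y) = y.
  by rewrite muleA -EFinM mulNr -expRD subrr expR0 mul1e.
have mef := measurable_exp_mul (- lambda)%R mpsi mf.
have ef0 x : 0 <= (expR (- lambda * psi x))%:E * f x.
  by rewrite mule_ge0// lee_fin expR_ge0.
elim: n => [|n IH].
  rewrite mulr0 expR0 mul1e; under eq_integral do rewrite /weighted_avgn /= ee'.
  by [].
have -> : weighted_avgn lambda psi n.+1 f =
    weighted_avgn lambda psi 1 (weighted_avgn lambda psi n f).
  apply/funext => g; rewrite /weighted_avgn /=; congr (_ * avg _ g).
  by apply/funext => x; rewrite ee.
have mwn : measb (weighted_avgn lambda psi n f).
  by apply: measurable_exp_mul => //; exact: measurable_avgn.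
apply: le_trans (hom lambda psi _ mpsi hpsi mwn _) _.
  by move=> x; rewrite mule_ge0 ?lee_fin ?expR_ge0//; exact: avgn_ge0.
rewrite -natr1 mulrDr mulr1 addrC expRD EFinM -muleA.
by rewrite lee_wpmul2l// lee_fin expR_ge0.
Qed.

End WeightedIterates.

(** * Off-diagonal estimates *)

Section WordDistance.
Variables (R : realType) (G : topologicalGroupType).
Implicit Types (g h u x : G) (F : set G).
Local Notation B := (borel G).
Variable U : set G.
Hypothesis hU : generating_nbhd U.

Let U1 : U 1%g. Proof. by case: hU. Qed.
Let iU : forall x, U x -> U (x^-1)%g. Proof. by case: hU. Qed.
Let oU : open U. Proof. by case: hU. Qed.

Definition reach F n : set G := [set g | exists2 h, F h & set_pow U n (g * h^-1)%g].

(* [0] if [F] is empty; at least [1] otherwise, as for [rho]. *)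
Definition dist_nat F g : nat :=
  match pselect (exists n, `[< reach F n.+1 g >]) with
  | left ex => (ex_minn ex).+1
  | right _ => 0%N
  end.

Lemma dist_natP F g : F !=set0 ->
  [/\ (0 < dist_nat F g)%N, reach F (dist_nat F g) g
    & forall n, (0 < n)%N -> reach F n g -> (dist_nat F g <= n)%N].
Proof.
move=> [h Fh]; rewrite /dist_nat; case: pselect => [ex|]; last first.
  have [n Un] := set_pow_cover hU (g * h^-1)%g.
  by case; exists n; apply/asboolP; exists h.
case: ex_minnP => k /asboolP rk kmin; split => // -[//|n] _ rn.
by rewrite ltnS; apply: kmin; apply/asboolP.
Qed.

Lemma dist_nat_on F g : F g -> dist_nat F g = 1%N.
Proof.
move=> Fg; have [d0 _ dm] := @dist_natP F g (ex_intro _ g Fg).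
apply/eqP; rewrite eqn_leq d0 andbT dm//.
by exists g => //; rewrite mulgV set_pow1.
Qed.

Lemma dist_nat_le_mul F u g : F !=set0 -> U u ->
  (dist_nat F (u * g)%g <= (dist_nat F g).+1)%N.
Proof.
move=> F0 Uu; have [_ [h Fh rh] _] := dist_natP g F0.
have [_ _ ->//] := dist_natP (u * g)%g F0.
by exists h => //; exists u => //; exists (g * h^-1)%g => //; rewrite mulgA.
Qed.

Lemma dist_nat_lipschitz F u g : F !=set0 -> U u ->
  `|(dist_nat F (u^-1 * g)%g)%:R - (dist_nat F g)%:R| <= 1 :> R.
Proof.
move=> F0 Uu; have h1 := dist_nat_le_mul g F0 (iU Uu).
have := dist_nat_le_mul (u^-1 * g)%g F0 Uu; rewrite mulVKg => h2.
rewrite ler_norml; apply/andP; split.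
  by rewrite lerBrDr addrC lerBlDr natr1 ler_nat.
by rewrite lerBlDr addrC natr1 ler_nat.
Qed.

Lemma open_reach F n : open (reach F n.+1).
Proof.
have -> : reach F n.+1 = \bigcup_(h in F) [set g | set_pow U n.+1 (g * h^-1)%g].
  by apply/seteqP; split => g [h Fh hg]; exists h.
by apply: bigcup_open => h _; apply: open_mulgr; exact: open_set_pow.
Qed.

Lemma measurable_dist_nat F : F !=set0 ->
  measurable_fun [set: B] (fun g : B => (dist_nat F g)%:R : R).
Proof.
move=> F0.
have mle n : measurable ([set g | (dist_nat F g <= n)%N] : set B).
  have -> : [set g | (dist_nat F g <= n)%N] =
      \bigcup_(k in [set k | (k < n)%N]) reach F k.+1.
    apply/seteqP; split => [g /= gn|g [k /= kn rk] /=].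
      have [] := dist_natP g F0; case E : (dist_nat F g) => [//|k] _ rk _.
      by exists k => //=; rewrite -E.
    by have [_ _ /(_ k.+1 isT rk)] := dist_natP g F0 => /leq_trans; apply.
  by apply: bigcup_measurable => k _; apply: open_borel; exact: open_reach.
have meq n : measurable ([set g | dist_nat F g = n] : set B).
  case: n => [|n].
    rewrite (_ : [set _ | _] = set0)//; apply/seteqP; split => // g /= E.
    by have [] := dist_natP g F0; rewrite E.
  have -> : [set g | dist_nat F g = n.+1] =
      [set g | (dist_nat F g <= n.+1)%N] `\` [set g | (dist_nat F g <= n)%N].
    apply/seteqP; split => g /=.
      by move=> ->; split; [exact: leqnn|rewrite ltnn].
    by move=> [h1 /negP h2]; apply/eqP; rewrite eqn_leq h1 ltnNge.
  exact: measurableD.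
move=> _ Y mY; rewrite setTI.
have -> : (fun g : B => (dist_nat F g)%:R : R) @^-1` Y =
    \bigcup_(n in [set n : nat | Y n%:R]) [set g | dist_nat F g = n].
  apply/seteqP; split => [g /= Yg|g [n /= Yn ->]//].
  by exists (dist_nat F g).
by apply: bigcup_measurable => n _; exact: meq.
Qed.

Lemma dist_nat_lipschitz_ae F (mu : {measure set B -> \bar R}) : F !=set0 ->
  lipschitz_ae U mu 1 (fun g => (dist_nat F g)%:R).
Proof. by move=> F0 u Uu; apply: nearW => g; exact: dist_nat_lipschitz. Qed.

Lemma set_dist_le E F g : E g -> F !=set0 ->
  (set_dist R U E F <= (dist_nat F g)%:R%:E)%E.
Proof.
move=> Eg F0; have [d0 [h Fh rh] _] := dist_natP g F0.
apply: le_trans (_ : rho R U (g * h^-1)%g <= _)%E.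
  by apply: ereal_inf_lbound; exists g => //; exists h.
by apply: ereal_inf_lbound; exists (dist_nat F g).
Qed.

Lemma rho_dist_nat g : rho R U g = (dist_nat [set 1%g] g)%:R%:E.
Proof.
have F0 : [set 1%g : G] !=set0 by exists 1%g.
have [d0 [h -> rh] dm] := dist_natP g F0.
apply/eqP; rewrite eq_le; apply/andP; split.
  apply: ereal_inf_lbound; exists (dist_nat [set 1%g] g) => //; split => //.
  by move: rh; rewrite invg1 mulg1.
apply: le_ereal_inf_tmp => _ [n [n0 Un] <-]; rewrite lee_fin ler_nat dm//.
by exists 1%g => //; rewrite invg1 mulg1.
Qed.

Lemma set_dist0l F : set_dist R U set0 F = +oo%E.
Proof.
rewrite /set_dist (_ : [set _ | _ in _ & _ in _] = set0) ?ereal_inf0//.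
by apply/seteqP; split => // x [].
Qed.

Lemma set_dist0r E : set_dist R U E set0 = +oo%E.
Proof.
rewrite /set_dist (_ : [set _ | _ in _ & _ in _] = set0) ?ereal_inf0//.
by apply/seteqP; split => // x [? _ []].
Qed.

Lemma set_dist_fin E F : E !=set0 -> F !=set0 ->
  exists2 d : R, 0 <= d & set_dist R U E F = d%:E.
Proof.
move=> [g Eg] F0; have h1 := set_dist_le Eg F0.
have h0 : (0 <= set_dist R U E F)%E.
  apply: le_ereal_inf_tmp => _ [x _ [y _ <-]]; apply: le_ereal_inf_tmp => _ [n _ <-].
  by rewrite lee_fin.
case: (set_dist R U E F) h0 h1 => // d; rewrite lee_fin => d0 _.
by exists d.
Qed.

End WordDistance.

(** * Convexity inequalities for real powers *)

Section Powers.
Variable R : realType.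
Implicit Types a b x y z u v r s p : R.

(** With u = exp s and v = exp t, the exponential lies above its tangent at m = a s + (1 - a) t; in
    the weighted sum of the two bounds the first-order terms cancel. *)
Lemma young_powR a u v : 0 < a -> a < 1 -> 0 <= u -> 0 <= v ->
  u `^ a * v `^ (1 - a) <= a * u + (1 - a) * v.
Proof.
move=> a0 a1; have b0 : 0 < 1 - a by rewrite subr_gt0.
rewrite le_eqVlt => /predU1P[<- v0|u0].
  by rewrite powR0 ?gt_eqF// mul0r mulr0 add0r mulr_ge0// ltW.
rewrite le_eqVlt => /predU1P[<-|v0].
  by rewrite [in leLHS]powR0 ?gt_eqF// !mulr0 addr0 mulr_ge0// ltW.
rewrite /powR !gt_eqF//= -expRD.
set s := ln u; set t := ln v; set m := a * s + (1 - a) * t.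
have h1 : expR m * (1 + (s - m)) <= expR s.
  rewrite -[leRHS](_ : expR m * expR (s - m) = _); last by rewrite -expRD; congr expR; ring.
  by rewrite ler_wpM2l ?expR_ge0// expR_ge1Dx.
have h2 : expR m * (1 + (t - m)) <= expR t.
  rewrite -[leRHS](_ : expR m * expR (t - m) = _); last by rewrite -expRD; congr expR; ring.
  by rewrite ler_wpM2l ?expR_ge0// expR_ge1Dx.
rewrite lnK// in h1; rewrite lnK// in h2.
have k1 := ler_wpM2l (ltW a0) h1; have k2 := ler_wpM2l (ltW b0) h2.
rewrite [leLHS](_ : _ = a * (expR m * (1 + (s - m))) + (1 - a) * (expR m * (1 + (t - m)))); last by rewrite /m; ring.
exact: lerD k1 k2.
Qed.

(** The graph of the r-th power lies above its tangent at y, rearranged so that no term is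
    subtracted. It is Young's inequality for t^r and y^r with weight 1/r. *)
Lemma powR_tangent r t y : 1 <= r -> 0 <= t -> 0 <= y ->
  y `^ r + r * y `^ (r - 1) * t <= t `^ r + r * y `^ r.
Proof.
move=> r1 t0 y0; have [<-|rn] := eqVneq 1 r.
  by rewrite subrr powRr0 !mul1r !powRr1// addrC.
have {}r1 : 1 < r by rewrite lt_neqAle rn.
have r0 : 0 < r by rewrite (lt_trans ltr01).
have := @young_powR r^-1 (t `^ r) (y `^ r); rewrite invr_gt0 invf_lt1// => /(_ r0 r1).
rewrite -!powRrM mulfV ?gt_eqF// powRr1// mulrBr mulr1 mulfV ?gt_eqF//.
move=> /(_ (powR_ge0 _ _) (powR_ge0 _ _)) h.
have := ler_wpM2l (ltW r0) h.
rewrite mulrDr !mulrA mulrBr mulr1 mulfV ?gt_eqF// mul1r; lra.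
Qed.

(* Hoelder's inequality between the exponents [p] and [p / 2] in a form that is
   linear in [t `^ p] and [t `^ (p / 2)]; [A] and [B] are free. *)
Lemma powR_interpolation p t A B : 1 < p -> p < 2 -> 0 <= t -> 0 < A -> 0 < B ->
  t <= (A `^ ((2 - p) / p) * B `^ (2 * (p - 1) / p)) *
       ((2 - p) / p * (t `^ p / A) + 2 * (p - 1) / p * (t `^ (p / 2) / B)).
Proof.
move=> p1 p2 t0 A0 B0; have p0 : 0 < p by rewrite (lt_trans ltr01).
have a0 : 0 < (2 - p) / p by rewrite divr_gt0// subr_gt0.
have bE : 2 * (p - 1) / p = 1 - (2 - p) / p by field; rewrite gt_eqF.
have a1 : (2 - p) / p < 1.
  by rewrite -subr_gt0 -bE divr_gt0// mulr_gt0// subr_gt0.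
have At : 0 <= t `^ p / A by rewrite divr_ge0 ?powR_ge0// ltW.
have Bt : 0 <= t `^ (p / 2) / B by rewrite divr_ge0 ?powR_ge0// ltW.
have := young_powR a0 a1 At Bt; rewrite -bE.
have AD := powR_gt0 ((2 - p) / p) A0; have BD := powR_gt0 (2 * (p - 1) / p) B0.
move=> h; have := ler_wpM2l (ltW (mulr_gt0 AD BD)) h; apply: le_trans.
have pV (X r : R) : 0 < X -> (X^-1) `^ r = (X `^ r)^-1.
  by move=> X0; rewrite -powR_inv1 ?ltW// -powRrM mulN1r powRN.
have ip := powR_ge0 t p; have ip2 := powR_ge0 t (p / 2).
have iA : 0 <= A^-1 by rewrite invr_ge0 ltW.
have iB : 0 <= B^-1 by rewrite invr_ge0 ltW.
rewrite (powRM _ ip iA) (powRM _ ip2 iB) !pV// -!powRrM.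
rewrite [X in _ <= X](_ : _ = t `^ (p * ((2 - p) / p)) * t `^ (p / 2 * (2 * (p - 1) / p))); last first.
  by move: AD BD; set X := A `^ _; set Y := B `^ _ => AD BD; field; rewrite !gt_eqF.
have -> : p * ((2 - p) / p) = 2 - p by field; rewrite gt_eqF.
have -> : p / 2 * (2 * (p - 1) / p) = p - 1 by field; rewrite gt_eqF.
rewrite -powRD; first by rewrite (_ : 2 - p + (p - 1) = 1) ?powRr1//; ring.
by apply/implyP => /eqP; lra.
Qed.

(** The left-hand side is A^(2-p) * (B^2)^(p-1), to which Young's inequality with weights 2 - p and
    p - 1 applies. The exponent of sig in the second term is the one that makes the powers of sig
    cancel in the product. *)
Lemma powR_interpolation_sum p sig A B : 1 < p -> p < 2 -> 0 < sig -> 0 < A -> 0 < B ->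
  (A `^ ((2 - p) / p) * B `^ (2 * (p - 1) / p)) `^ p <=
  (2 - p) * sig * A + (p - 1) * sig `^ (- ((2 - p) / (p - 1))) * B ^+ 2.
Proof.
move=> p1 p2 s0 A0 B0; have p0 : 0 < p by rewrite (lt_trans ltr01).
have q0 : 0 < p - 1 by rewrite subr_gt0.
set tau := sig `^ _; have tau0 : 0 < tau by exact: powR_gt0.
have a0 : 0 < 2 - p by rewrite subr_gt0.
have a1 : 2 - p < 1 by rewrite ltrBlDr -ltrBlDl; lra.
have As : 0 <= sig * A by rewrite mulr_ge0 ?ltW.
have Bs : 0 <= tau * B ^+ 2 by rewrite mulr_ge0 ?exprn_ge0 ?ltW.
have := young_powR a0 a1 As Bs.
have -> : 1 - (2 - p) = p - 1 by ring.
rewrite -[(2 - p) * sig * A]mulrA -[(p - 1) * tau * _]mulrA; apply: le_trans.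
have B2 : 0 <= B ^+ 2 by exact: exprn_ge0 (ltW B0).
rewrite (powRM _ (powR_ge0 _ _) (powR_ge0 _ _)) -!powRrM (powRM _ (ltW s0) (ltW A0)).
rewrite (powRM _ (ltW tau0) B2) -(powR_mulrn 2 (ltW B0)) -powRrM /tau -powRrM.
have -> : (2 - p) / p * p = 2 - p by field; rewrite gt_eqF.
have -> : 2 * (p - 1) / p * p = 2 * (p - 1) by field; rewrite gt_eqF.
have -> : - ((2 - p) / (p - 1)) * (p - 1) = - (2 - p) by field; rewrite gt_eqF.
have s2 := powR_gt0 (2 - p) s0; rewrite powRN.
rewrite le_eqVlt; apply/orP; left; apply/eqP; field.
by rewrite gt_eqF.
Qed.

(** Serves [avgn_interpolation]: the free parameters there must be positive while the averages y and
    z may vanish, so both are perturbed by e and e tends to 0. *)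
Lemma le_quadratic_right x a b y z : 0 <= a -> 0 <= b -> 0 <= z ->
  (forall e, 0 < e -> x <= a * (y + e) + b * (z + e) ^+ 2) -> x <= a * y + b * z ^+ 2.
Proof.
move=> a0 b0 z0 h; apply/ler_addgt0Pr => e e0.
set c := a + b * (2 * z + 1).
have c0 : 0 <= c by rewrite addr_ge0// mulr_ge0// addr_ge0// mulr_ge0.
have ce : 0 < c + e by rewrite ltr_wpDl.
have d0 : 0 < e / (c + e) by rewrite divr_gt0.
have d1 : e / (c + e) <= 1 by rewrite ler_pdivrMr// mul1r lerDr.
apply: le_trans (h _ d0) _; set d := e / _ in d0 d1 *.
have dc : d * c <= e.
  by rewrite /d mulrAC ler_pdivrMr// ler_pM2l// lerDl ltW.
have dd : b * (d * d) <= b * d by rewrite ler_wpM2l// ler_piMr// ltW.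
move: dc dd; rewrite /c; lra.
Qed.

End Powers.

(** * Jensen and Hoelder inequalities for averages *)

Section OffDiagonal.
Variables (R : realType) (G : topologicalGroupType).
Implicit Types (g h k x y z : G).
Local Notation B := (borel G).
Hypothesis hG : hausdorff_space G.
Variable U : set G.
Hypothesis hU : generating_nbhd U.
Variable mu : {measure set B -> \bar R}.
Hypothesis hmu : left_haar_measure mu.
Variable Delta : G -> R.
Hypothesis hDelta : modular_function mu Delta.
Variable K : G -> R.
Hypothesis mK : measurable_fun [set: B] (K : B -> R).
Hypothesis K0 : (forall g, 0 <= K g)%R.
Local Open Scope ereal_scope.
Hypothesis K1 : \int[mu]_g (K g)%:E = 1.
Local Notation avg := (avg mu mK).
Local Notation avgn n f := (iter n avg f).
Local Notation measb f := (measurable_fun [set: B] (f : B -> \bar R)).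

Lemma avgn_cst n (c : R) g : (0 <= c)%R -> avgn n (fun=> c%:E) g = c%:E.
Proof.
move=> c0; have := @avgnZ _ _ hG _ hU _ hmu _ hDelta _ mK K0 K1 n c (fun=> 1) g c0.
by rewrite (avgn1 mK K0 K1) mule1; apply.
Qed.

Lemma measurable_powR_EFin r (phi : G -> R) : measurable_fun [set: B] (phi : B -> R) ->
  measb (fun x => (phi x `^ r)%:E).
Proof. by move=> mphi; apply/measurable_EFinP; exact: (measurableT_comp (measurable_powR r)). Qed.

(* Only linearity and monotonicity of [avg] are available: the convex function is
   replaced by its tangent at the value of the average. *)
Lemma avgn_jensen n r (phi : G -> R) g : (1 <= r)%R ->
  measurable_fun [set: B] (phi : B -> R) -> (forall x, 0 <= phi x)%R ->
  avgn n (fun x => (phi x)%:E) g `^ r <= avgn n (fun x => (phi x `^ r)%:E) g.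
Proof.
move=> r1 mphi phi0; set x := avgn n _ g; set z := avgn n _ g.
have r0 : (0 < r)%R by rewrite (lt_le_trans ltr01).
have mE : measb (fun x => (phi x)%:E) by exact/measurable_EFinP.
have mr := measurable_powR_EFin r mphi.
have x0 : 0 <= x by apply: avgn_ge0 => y; rewrite lee_fin.
have z0 : 0 <= z by apply: avgn_ge0 => y; rewrite lee_fin powR_ge0.
have key (y : R) : (0 <= y)%R ->
    (y `^ r)%:E + (r * y `^ (r - 1))%:E * x <= z + (r * y `^ r)%:E.
  move=> y0; have c0 : (0 <= r * y `^ (r - 1))%R by rewrite mulr_ge0 ?powR_ge0// ltW.
  have d0 : (0 <= r * y `^ r)%R by rewrite mulr_ge0 ?powR_ge0// ltW.
  have yr0 := powR_ge0 y r.
  have mc := measurable_funeM (r * y `^ (r - 1))%R%:E mE.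
  have cp0 w : 0 <= (r * y `^ (r - 1))%:E * (phi w)%:E by rewrite mule_ge0// lee_fin.
  rewrite -(avgnZ hG hU hmu hDelta mK K0 K1 n g c0 mE)// -(avgn_cst n g yr0).
  rewrite -(avgn_cst n g d0) -!(avgnD hG hU hmu hDelta mK K0 K1)//;
    try by move=> w; rewrite ?lee_fin ?powR_ge0.
  apply: (le_avgn hG hU hmu hDelta mK K0 K1).
  - exact: emeasurable_funD.
  - exact: emeasurable_funD.
  - by move=> w; rewrite adde_ge0.
  - by move=> w; rewrite -EFinM -!EFinD lee_fin powR_tangent.
case: x x0 key => [x|_|//].
- rewrite lee_fin => x0 /(_ x x0); rewrite -EFinM -mulrA [(_ `^ (r - 1) * x)%R]mulrC.
  rewrite mulr_powRB1// poweR_EFin.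
  by rewrite leeD2rE.
(* There is no tangent at an infinite average; the tangent at 1 already forces the right-hand side
   to be infinite. *)
- move=> /(_ 1%R ler01); rewrite !powR1 mulr1 mulry gtr0_sg// mul1e addey// leye_eq.
  by case: z z0 => [zr|_ _|//]; [|exact: leey].
Qed.

(** Below p = 2 the power p / 2 is concave and Jensen's inequality goes the wrong way. Instead phi
    is interpolated between phi^p and phi^(p/2): the pointwise linear inequality is averaged, and
    its parameters are then chosen as the two averages themselves. The average of phi^(p/2) is the
    quantity that the L^2 estimate controls. *)
Lemma avgn_interpolation n p sig (phi : G -> R) g : (1 < p)%R -> (p < 2)%R -> (0 < sig)%R ->
  measurable_fun [set: B] (phi : B -> R) -> (forall x, 0 <= phi x)%R ->
  avgn n (fun x => (phi x)%:E) g `^ p <=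
  ((2 - p) * sig)%:E * avgn n (fun x => (phi x `^ p)%:E) g +
  ((p - 1) * sig `^ (- ((2 - p) / (p - 1))))%:E *
    (avgn n (fun x => (phi x `^ (p / 2))%:E) g * avgn n (fun x => (phi x `^ (p / 2))%:E) g).
Proof.
move=> p1 p2 s0 mphi phi0.
set x := avgn n _ g; set y := avgn n _ g; set z := avgn n _ g.
have p0 : (0 < p)%R by rewrite (lt_trans ltr01).
have c1 : (0 < (2 - p) * sig)%R by rewrite mulr_gt0// subr_gt0.
set tau := (sig `^ _)%R; have tau0 : (0 < tau)%R by exact: powR_gt0.
have c2 : (0 < (p - 1) * tau)%R by rewrite mulr_gt0// subr_gt0.
have mE : measb (fun x => (phi x)%:E) by exact/measurable_EFinP.
have mp := measurable_powR_EFin p mphi; have mp2 := measurable_powR_EFin (p / 2) mphi.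
have x0 : 0 <= x by apply: avgn_ge0 => w; rewrite lee_fin.
have y0 : 0 <= y by apply: avgn_ge0 => w; rewrite lee_fin powR_ge0.
have z0 : 0 <= z by apply: avgn_ge0 => w; rewrite lee_fin powR_ge0.
have key (A C : R) : (0 < A)%R -> (0 < C)%R ->
    let D := (A `^ ((2 - p) / p) * C `^ (2 * (p - 1) / p))%R in
    x <= (D * ((2 - p) / p / A))%:E * y + (D * (2 * (p - 1) / p / C))%:E * z.
  move=> A0 C0 /=; set D := (A `^ _ * _)%R; have D0 : (0 < D)%R by rewrite /D mulr_gt0 ?powR_gt0.
  have e1 : (0 <= D * ((2 - p) / p / A))%R.
    by rewrite ltW// mulr_gt0// !divr_gt0// subr_gt0.
  have e2 : (0 <= D * (2 * (p - 1) / p / C))%R.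
    by rewrite ltW// mulr_gt0// !divr_gt0// mulr_gt0// subr_gt0.
  have mc1 := measurable_funeM (D * ((2 - p) / p / A))%R%:E mp.
  have mc2 := measurable_funeM (D * (2 * (p - 1) / p / C))%R%:E mp2.
  rewrite -(avgnZ hG hU hmu hDelta mK K0 K1 n g e1 mp); last first.
    by move=> w; rewrite lee_fin powR_ge0.
  rewrite -(avgnZ hG hU hmu hDelta mK K0 K1 n g e2 mp2); last first.
    by move=> w; rewrite lee_fin powR_ge0.
  rewrite -(avgnD hG hU hmu hDelta mK K0 K1)//; last 2 first.
  - by move=> w; rewrite -EFinM lee_fin mulr_ge0 ?powR_ge0.
  - by move=> w; rewrite -EFinM lee_fin mulr_ge0 ?powR_ge0.
  apply: (le_avgn hG hU hmu hDelta mK K0 K1) => // [|w].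
  - exact: emeasurable_funD.
  - rewrite -!EFinM -EFinD lee_fin.
    apply: le_trans (powR_interpolation p1 p2 (phi0 w) A0 C0) _.
    rewrite -/D le_eqVlt; apply/orP; left; apply/eqP; field.
    by rewrite !gt_eqF.
case: y y0 key => [y|_ _|//]; last first.
  rewrite [X in X + _]mulry gtr0_sg// mul1e addye ?leey//.
  by rewrite gt_eqF// (lt_le_trans (ltNyr 0%R))// mule_ge0 ?lee_fin ?mule_ge0// ltW.
case: z z0 => [z|_ _ _|//]; last first.
  by rewrite mulyy [X in _ + X]mulry gtr0_sg// mul1e addey ?leey.
rewrite !lee_fin => z0 y0 key.
have xf : x \is a fin_num.
  rewrite ge0_fin_numE//; apply: le_lt_trans (key 1%R 1%R ltr01 ltr01) _.
  by rewrite -!EFinM -EFinD ltry.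
rewrite -(fineK xf) poweR_EFin -!EFinM -EFinD lee_fin -expr2.
have {}x0 := fine_ge0 x0; move: key; rewrite -(fineK xf); move: (fine x) x0 => {xf}x x0 key.
apply: le_quadratic_right => //; [exact: ltW|exact: ltW|].
move=> e e0; have A0 : (0 < y + e)%R by rewrite ltr_wpDl.
have C0 : (0 < z + e)%R by rewrite ltr_wpDl.
apply: le_trans (powR_interpolation_sum p1 p2 s0 A0 C0).
have /= := key _ _ A0 C0; set D := (_ `^ _ * _ `^ _)%R; rewrite -!EFinM -EFinD lee_fin.
have D0 : (0 <= D)%R by rewrite mulr_ge0 ?powR_ge0.
move=> h; apply: ge0_ler_powR; rewrite ?nnegrE ?(ltW p0)//.
have h1 : (y / (y + e) <= 1)%R by rewrite ler_pdivrMr// mul1r lerDl ltW.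
have h2 : (z / (z + e) <= 1)%R by rewrite ler_pdivrMr// mul1r lerDl ltW.
have q1 : (0 <= (2 - p) / p)%R by rewrite divr_ge0 ?subr_ge0 ?ltW.
have q2 : (0 <= 2 * (p - 1) / p)%R by rewrite divr_ge0 ?mulr_ge0 ?subr_ge0 ?ltW.
have := lerD (ler_wpM2l q1 h1) (ler_wpM2l q2 h2); rewrite !mulr1 => h3.
apply: le_trans h _; rewrite [leLHS](_ : _ = D *
  ((2 - p) / p * (y / (y + e)) + 2 * (p - 1) / p * (z / (z + e))))%R; last first.
  by field; rewrite !gt_eqF.
rewrite ler_piMr//; apply: le_trans h3 _; rewrite le_eqVlt; apply/orP; left.
by apply/eqP; field; rewrite gt_eqF.
Qed.

End OffDiagonal.

(** * Decay away from the support *)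

Section Decay.
Variables (R : realType) (G : topologicalGroupType).
Implicit Types (g h k x y z : G).
Local Notation B := (borel G).
Hypothesis hG : hausdorff_space G.
Variable U : set G.
Hypothesis hU : generating_nbhd U.
Variable mu : {measure set B -> \bar R}.
Hypothesis hmu : left_haar_measure mu.
Variable Delta : G -> R.
Hypothesis hDelta : modular_function mu Delta.
Variable K : G -> R.
Hypothesis mK : measurable_fun [set: B] (K : B -> R).
Hypothesis K0 : (forall g, 0 <= K g)%R.
Local Open Scope ereal_scope.
Hypothesis K1 : \int[mu]_g (K g)%:E = 1.
Local Notation avg := (avg mu mK).
Local Notation avgn n f := (iter n avg f).
Local Notation measb f := (measurable_fun [set: B] (f : B -> \bar R)).
Variable omega : R.
Hypothesis omega0 : (0 < omega)%R.
Hypothesis weighted_le : weighted_l2_bound U mu mK omega.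

Lemma avgn_l2_decay n (E F : set G) (d : R) (phi : G -> \bar R) :
  (0 < n)%N -> measurable (E : set B) -> F !=set0 -> (0 <= d)%R ->
  (forall g, E g -> d <= (dist_nat U F g)%:R)%R ->
  measb phi -> (forall x, 0 <= phi x) -> (forall x, ~ F x -> phi x = 0) ->
  \int[mu]_(g in E) (avgn n phi g * avgn n phi g) <=
  (expR (1 - d ^+ 2 / ((omega + 1) * n%:R)))%:E * \int[mu]_g (phi g * phi g).
Proof.
move=> n0 mE F0 d0 Ed mphi phi0 phiF.
pose psi g : R := (dist_nat U F g)%:R.
have mpsi : measurable_fun [set: B] (psi : B -> R).
  by exact: measurable_dist_nat.
have hpsi : lipschitz_ae U mu 1 psi by exact: dist_nat_lipschitz_ae.
have n1 : (1 <= n%:R :> R)%R by rewrite ler1n.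
have o0 : (0 < omega + 1)%R by rewrite addr_gt0.
have on0 : (0 < (omega + 1) * n%:R)%R by rewrite mulr_gt0// (lt_le_trans ltr01).
(* The optimal choice would have omega in place of omega + 1. The added 1 leaves a spare term la^2 *
   n, which together with the constant 1 of the conclusion absorbs the 2 * la caused by the next
   line. *)
pose la : R := (d / ((omega + 1) * n%:R))%R.
have la0 : (0 <= la)%R by rewrite divr_ge0// ltW.
(* On F the distance [psi] is 1 and not 0; the factor expR la compensates this, so that the inner
   weight turns f back into phi. *)
pose f g := (expR la)%:E * phi g.
have mf : measb f by exact: measurable_funeM.
have f0 g : 0 <= f g by rewrite mule_ge0// lee_fin expR_ge0.
have efE : (fun x => (expR (- la * psi x))%:E * f x) = phi.
  apply/funext => x; rewrite /f; have [Fx|nFx] := pselect (F x).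
    by rewrite /psi dist_nat_on// mulr1 muleA -EFinM -expRD addNr expR0 mul1e.
  by rewrite phiF// !mule0.
have hw := weighted_le la n mpsi hpsi mf f0.
have IE : \int[mu]_g (f g * f g) = (expR (2 * la))%:E * \int[mu]_g (phi g * phi g).
  have mpp : measb (fun g => phi g * phi g) by exact: emeasurable_funM.
  have pp0 g : [set: B] g -> 0 <= phi g * phi g by move=> _; exact: mule_ge0.
  have e0 : 0 <= (expR (2 * la))%:E by rewrite lee_fin expR_ge0.
  rewrite -(ge0_integralZl mu measurableT mpp pp0 e0).
  apply: eq_integral => g _; rewrite /f muleACA -EFinM -expRD.
  by congr ((expR _)%:E * _); ring.
have mA := measurable_avgn hG hU hmu hDelta mK K0 K1 n mphi phi0.
have A0 g : 0 <= avgn n phi g by exact: avgn_ge0.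
have mAA : measb (fun g => avgn n phi g * avgn n phi g) by exact: emeasurable_funM.
have wE g : weighted_avgn mu mK la psi n f g = (expR (la * psi g))%:E * avgn n phi g.
  by rewrite /weighted_avgn efE.
have step : (expR (2 * la * d))%:E * \int[mu]_(g in E) (avgn n phi g * avgn n phi g) <=
    (expR (omega * la ^+ 2 * n%:R))%:E * \int[mu]_g (f g * f g).
  have mAAE : measurable_fun (E : set B) (fun g : B => avgn n phi g * avgn n phi g).
    exact: measurable_funTS.
  have pp0 g : E g -> 0 <= avgn n phi g * avgn n phi g by move=> _; exact: mule_ge0.
  have e0 : 0 <= (expR (2 * la * d))%:E by rewrite lee_fin expR_ge0.
  apply: le_trans hw; rewrite -(ge0_integralZl mu mE mAAE pp0 e0).
  have mw : measb (fun g => weighted_avgn mu mK la psi n f g * weighted_avgn mu mK la psi n f g).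
    have mw1 : measb (weighted_avgn mu mK la psi n f).
      by rewrite (funext wE); exact: measurable_exp_mul.
    exact: emeasurable_funM.
  have w0 g : 0 <= weighted_avgn mu mK la psi n f g * weighted_avgn mu mK la psi n f g.
    by rewrite wE; apply: mule_ge0; rewrite mule_ge0// lee_fin expR_ge0.
  apply: (@le_trans _ _ (\int[mu]_(g in E)
    (weighted_avgn mu mK la psi n f g * weighted_avgn mu mK la psi n f g))); last first.
    exact: ge0_subset_integral.
  apply: ge0_le_integral => //.
  - by move=> g _; rewrite mule_ge0 ?lee_fin ?expR_ge0// mule_ge0.
  - by apply: measurable_funeM; exact: measurable_funTS.
  - exact: measurable_funTS.
  - move=> g Eg; rewrite wE muleACA -EFinM -expRD; apply: lee_wpmul2r.
      exact: mule_ge0.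
    rewrite lee_fin ler_expR; have := ler_wpM2l la0 (Ed g Eg); rewrite -/(psi g).
    set c := (la * psi g)%R; set c' := (la * d)%R; rewrite -mulrA -/c'; lra.
have e0 : (0 < expR (2 * la * d))%R by exact: expR_gt0.
rewrite -(@lee_pmul2l _ (expR (2 * la * d))%:E)//.
apply: le_trans step _; rewrite IE !muleA -!EFinM; apply: lee_wpmul2r.
  by apply: integral_ge0 => g _; exact: mule_ge0.
rewrite lee_fin -!expRD ler_expR.
have lad : (d = la * ((omega + 1) * n%:R))%R by rewrite /la divfK// gt_eqF.
have -> : (d ^+ 2 / ((omega + 1) * n%:R) = la * d)%R by rewrite /la; ring.
rewrite lad; set N := (n%:R : R)%R in n1 *.
have := sqr_ge0 (la - 1)%R; have : (la ^+ 2 <= la ^+ 2 * N)%R by rewrite ler_peMr// sqr_ge0.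
nra.
Qed.

(** The L^2 decay is applied to phi^(p/2), whose squared L^2 norm is the integral of phi^p. For p >=
    2 Jensen's inequality with exponent p / 2 suffices and nothing is lost; for p < 2 the
    interpolation with the plain L^1 contraction for phi^p keeps only the share p - 1 of the
    exponent. *)
Lemma avgn_lp_decay p n (E F : set G) (d : R) (phi : G -> R) :
  (1 < p)%R -> (0 < n)%N -> measurable (E : set B) -> F !=set0 -> (0 <= d)%R ->
  (forall g, E g -> d <= (dist_nat U F g)%:R)%R ->
  measurable_fun [set: B] (phi : B -> R) -> (forall x, 0 <= phi x)%R ->
  (forall x, ~ F x -> phi x = 0%R) ->
  \int[mu]_(g in E) (avgn n (fun x => (phi x)%:E) g `^ p) <=
  (expR (Num.min 1 (p - 1) * (1 - d ^+ 2 / ((omega + 1) * n%:R))))%:E *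
  \int[mu]_g (phi g `^ p)%:E.
Proof.
move=> p1 n0 mE F0 d0 Ed mphi phi0 phiF; set e := (1 - _)%R.
have p0 : (0 < p)%R by rewrite (lt_trans ltr01).
have mE1 : measb (fun x => (phi x)%:E) by exact/measurable_EFinP.
have mp := measurable_powR_EFin p mphi; have mp2 := measurable_powR_EFin (p / 2) mphi.
have q20 x : 0 <= (phi x `^ (p / 2))%:E by rewrite lee_fin powR_ge0.
have qp0 x : 0 <= (phi x `^ p)%:E by rewrite lee_fin powR_ge0.
have q2F x : ~ F x -> (phi x `^ (p / 2))%:E = 0.
  by move=> /phiF ->; rewrite powR0// gt_eqF// divr_gt0.
have mx := measurable_avgn hG hU hmu hDelta mK K0 K1 n mE1 (fun x => phi0 x).
have my := measurable_avgn hG hU hmu hDelta mK K0 K1 n mp qp0.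
have mz := measurable_avgn hG hU hmu hDelta mK K0 K1 n mp2 q20.
have mxp : measb (fun g => avgn n (fun x => (phi x)%:E) g `^ p).
  exact: (measurableT_comp (measurable_poweR _)).
have y0 g : 0 <= avgn n (fun x => (phi x `^ p)%:E) g by exact: avgn_ge0.
have z0 g : 0 <= avgn n (fun x => (phi x `^ (p / 2))%:E) g by exact: avgn_ge0.
have mzz := emeasurable_funM mz mz.
have l2 := avgn_l2_decay n0 mE F0 d0 Ed mp2 q20 q2F.
have halves g : (phi g `^ (p / 2))%:E * (phi g `^ (p / 2))%:E = (phi g `^ p)%:E.
  rewrite -EFinM -powRD; first by congr (_ `^ _)%:E; field.
  by apply/implyP => /eqP; lra.
have {}l2 : \int[mu]_(g in E) (avgn n (fun x => (phi x `^ (p / 2))%:E) g *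
      avgn n (fun x => (phi x `^ (p / 2))%:E) g) <=
    (expR e)%:E * \int[mu]_g (phi g `^ p)%:E.
  by apply: le_trans l2 _; under eq_integral do rewrite halves.
have [p2|p2] := leP 2%R p.
  have -> : Num.min 1%R (p - 1)%R = 1%R by apply/min_idPl; lra.
  rewrite mul1r; apply: le_trans l2; apply: ge0_le_integral => //.
  - by move=> g _; exact: poweR_ge0.
  - exact: measurable_funTS.
  - exact: measurable_funTS.
  move=> g _; have r1 : (1 <= p / 2)%R by rewrite ler_pdivlMr// mul1r.
  have h := avgn_jensen hG hU hmu hDelta mK K0 K1 n g r1 mphi phi0.
  have -> : avgn n (fun x => (phi x)%:E) g `^ p =
      (avgn n (fun x => (phi x)%:E) g `^ (p / 2)) * (avgn n (fun x => (phi x)%:E) g `^ (p / 2)).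
    have pE : (p / 2 + p / 2 = p)%R by field.
    by rewrite -poweRD ?pE//; apply: add_neq0_poweRD_def; rewrite pE gt_eqF.
  by apply: lee_pmul => //; exact: poweR_ge0.
have -> : Num.min 1%R (p - 1)%R = (p - 1)%R by apply/min_idPr; lra.
(* This value balances the two terms: [tau * expR e] equals [sig], and the weights 2 - p and p - 1
   add up to 1. *)
pose sig : R := expR ((p - 1) * e); have s0 : (0 < sig)%R by exact: expR_gt0.
rewrite -/sig; set I := \int[mu]_g (phi g `^ p)%:E in l2 *.
have I0 : 0 <= I by exact: integral_ge0.
set tau := (sig `^ (- ((2 - p) / (p - 1))))%R; have tau0 : (0 < tau)%R by exact: powR_gt0.
have tauE : (tau * expR e = sig)%R.
  rewrite /tau /sig /powR gt_eqF ?expR_gt0// expRK -expRD; congr expR; field.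
  by rewrite gt_eqF// subr_gt0.
have a0 : (0 <= (2 - p) * sig)%R by rewrite mulr_ge0 ?subr_ge0 ?ltW.
have b0 : (0 <= (p - 1) * tau)%R by rewrite mulr_ge0 ?subr_ge0 ?ltW.
have ly : \int[mu]_(g in E) avgn n (fun x => (phi x `^ p)%:E) g <= I.
  rewrite /I -(integral_avgn hG hU hmu hDelta mK K0 K1 n mp qp0).
  exact: ge0_subset_integral.
have zz0 g : 0 <= avgn n (fun x => (phi x `^ (p / 2))%:E) g *
   avgn n (fun x => (phi x `^ (p / 2))%:E) g by exact: mule_ge0.
apply: (@le_trans _ _ (\int[mu]_(g in E)
  (((2 - p) * sig)%:E * avgn n (fun x => (phi x `^ p)%:E) g +
  ((p - 1) * tau)%:E * (avgn n (fun x => (phi x `^ (p / 2))%:E) g *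
     avgn n (fun x => (phi x `^ (p / 2))%:E) g)))).
  apply: ge0_le_integral => //.
  - by move=> g _; exact: poweR_ge0.
  - exact: measurable_funTS.
  - by apply: measurable_funTS; apply: emeasurable_funD; exact: measurable_funeM.
  - by move=> g _; exact: (avgn_interpolation hG hU hmu hDelta mK K0 K1).
have t1 g : E g -> 0 <= ((2 - p) * sig)%:E * avgn n (fun x => (phi x `^ p)%:E) g.
  by move=> _; apply: mule_ge0.
have t2 g : E g -> 0 <= ((p - 1) * tau)%:E * (avgn n (fun x => (phi x `^ (p / 2))%:E) g *
     avgn n (fun x => (phi x `^ (p / 2))%:E) g).
  by move=> _; apply: mule_ge0.
rewrite ge0_integralD//; last 2 first.
- by apply: measurable_funTS; exact: measurable_funeM.
- by apply: measurable_funTS; exact: measurable_funeM.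
rewrite ge0_integralZl//; last exact: measurable_funTS.
rewrite ge0_integralZl//; last exact: measurable_funTS.
apply: (@le_trans _ _ (((2 - p) * sig)%:E * I + ((p - 1) * tau)%:E * ((expR e)%:E * I))).
  by apply: leeD; apply: lee_wpmul2l; rewrite // lee_fin.
rewrite muleA -EFinM -mulrA tauE -ge0_muleDl; last 2 first.
- by rewrite lee_fin.
- by rewrite lee_fin mulr_ge0 ?subr_ge0 ?ltW.
by rewrite -EFinD -mulrDl (_ : 2 - p + (p - 1) = 1)%R ?mul1r//; ring.
Qed.

End Decay.

(** * Pointwise Gaussian bounds *)

Section PointwiseBound.
Variables (R : realType) (G : topologicalGroupType).
Implicit Types (g h k x y z : G).
Local Notation B := (borel G).
Hypothesis hG : hausdorff_space G.
Variable U : set G.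
Hypothesis hU : generating_nbhd U.
Variable mu : {measure set B -> \bar R}.
Hypothesis hmu : left_haar_measure mu.
Variable Delta : G -> R.
Hypothesis hDelta : modular_function mu Delta.
Variable K : G -> R.
Hypothesis mK : measurable_fun [set: B] (K : B -> R).
Hypothesis K0 : (forall g, 0 <= K g)%R.
Local Open Scope ereal_scope.
Hypothesis K1 : \int[mu]_g (K g)%:E = 1.
Local Notation avg := (avg mu mK).
Local Notation avgn n f := (iter n avg f).
Local Notation measb f := (measurable_fun [set: B] (f : B -> \bar R)).

Lemma avg_conv (f : G -> \bar R) g : measb f -> (forall x, 0 <= f x) ->
  avg f g = \int[mu]_h ((K (g * h)%g)%:E * f (h^-1)%g).
Proof.
move=> mf f0; have mfg := measurable_divg g mf.
have mKE : measb (fun x => (K x)%:E) by exact/measurable_EFinP.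
rewrite /avg (integral_law mu mK K0 mfg)//.
rewrite -(integral_mulgl hmu g (f := fun h : B => (K h)%:E * f (h^-1 * g)%g)); last 2 first.
- exact: emeasurable_funM.
- by move=> h; rewrite mule_ge0// lee_fin.
by apply: eq_integral => h _; rewrite invgM -mulgA mulVg mulg1.
Qed.

Lemma convolutionE (f : G -> R) g : measurable_fun [set: B] (f : B -> R) ->
  (forall x, 0 <= f x)%R -> convolution mu K f g = fine (avg (fun x => (f x)%:E) g).
Proof.
move=> mf f0.
have mfg : measb (fun h => (f (h^-1 * g)%g)%:E) by apply/measurable_EFinP; exact: measurable_divg.
have f0g h : 0 <= (f (h^-1 * g)%g)%:E by rewrite lee_fin.
by rewrite /convolution /Rintegral /avg (integral_law mu mK K0 mfg f0g).
Qed.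

(** [convolution] is a real integral in which an infinite value reads as 0, hence an inequality and
    not an equality. The power n + 1 corresponds to n averages of K. *)
Lemma conv_power_le n g : ((conv_power mu K n.+1 g)%:E <= avgn n (fun x => (K x)%:E) g) /\
  (0 <= conv_power mu K n.+1 g)%R.
Proof.
suff [h1 h2 h3] : [/\ measurable_fun [set: B] (conv_power mu K n.+1 : B -> R),
    forall x, (0 <= conv_power mu K n.+1 x)%R
  & forall x, (conv_power mu K n.+1 x)%:E <= avgn n (fun x => (K x)%:E) x] by split.
have mKE : measb (fun x => (K x)%:E) by exact/measurable_EFinP.
elim: n => [|n [m1 p1 l1]]; first by split => // x /=.
have mE : measb (fun x => (conv_power mu K n.+1 x)%:E) by exact/measurable_EFinP.
have E x : conv_power mu K n.+2 x = fine (avg (fun x => (conv_power mu K n.+1 x)%:E) x).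
  by rewrite -convolutionE.
have a0 x : 0 <= avg (fun x => (conv_power mu K n.+1 x)%:E) x.
  by apply: avg_ge0 => y; rewrite lee_fin.
split.
- rewrite (funext E); apply: (measurableT_comp (fine_measurable measurableT)).
  exact: (measurable_avg hG hU hmu hDelta).
- by move=> x; rewrite E fine_ge0.
- move=> x; rewrite E; apply: (@le_trans _ _ (avg (fun x => (conv_power mu K n.+1 x)%:E) x)).
    by case: (avg _ x) (a0 x) => //= _; rewrite leey.
  have mA := measurable_avgn hG hU hmu hDelta mK K0 K1 n mKE (fun x => K0 x).
  by apply: le_avg => // y; rewrite lee_fin.
Qed.

Lemma amgm_ereal (k s : R) (y : \bar R) : (0 <= k)%R -> (0 < s)%R -> 0 <= y ->
  2%:E * (k%:E * y) <= (s * k ^+ 2)%:E + (s^-1)%:E * (y * y).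
Proof.
move=> k0 s0; case: y => [y|_|//]; last first.
  by rewrite mulyy [X in _ + X]gt0_muley ?lte_fin ?invr_gt0// addey// leey.
rewrite lee_fin => y0; rewrite -!EFinM -EFinD lee_fin.
rewrite -subr_ge0 [leRHS](_ : _ = s * (k - s^-1 * y) ^+ 2)%R.
  by rewrite mulr_ge0 ?sqr_ge0// ltW.
by field; rewrite gt_eqF.
Qed.

(** The Cauchy-Schwarz inequality in additive form, with the parameter t * Delta h depending on h.
    The inversion turns the integral of f (h^-1)^2 / Delta h into that of f^2, and translation by g
    takes the factor 1 / Delta g out of the integral of K (g * h)^2 * Delta h. Optimizing over t
    then produces Delta g to the power -1/2. *)
Lemma le_avg_amgm (f : G -> \bar R) g (t : R) : (0 < t)%R ->
  measb f -> (forall x, 0 <= f x) ->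
  2%:E * avg f g <= (t / Delta g)%:E * \int[mu]_h (K h ^+ 2 * Delta h)%:E +
    (t^-1)%:E * \int[mu]_h (f h * f h).
Proof.
move=> t0 mf f0; rewrite avg_conv//.
have mKE : measb (fun x => (K x)%:E) by exact/measurable_EFinP.
have mD := measurable_modular hDelta.
have D0 := modular_gt0 hDelta.
have mKg : measurable_fun [set: B] (fun h : B => K (g * h)%g).
  exact: (measurableT_comp mK (measurable_mulgl g)).
have mfV : measb (fun h => f (h^-1)%g) by exact: (measurableT_comp mf (@measurable_invg G)).
have mff : measb (fun h => f h * f h) by exact: emeasurable_funM.
have ff0 h : 0 <= f h * f h by exact: mule_ge0.
have mffV : measb (fun h => f (h^-1)%g * f (h^-1)%g) by exact: emeasurable_funM.
have mDE : measb (fun h => (Delta h)%:E) by exact/measurable_EFinP.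
have mDVE : measb (fun h => ((Delta h)^-1)%:E).
  by under eq_fun do rewrite -(modularV hDelta); apply/measurable_EFinP;
    exact: (measurable_modularV hDelta).
have mprod : measb (fun h => (K (g * h)%g)%:E * f (h^-1)%g).
  by apply: emeasurable_funM => //; exact/measurable_EFinP.
have mKD : measurable_fun [set: B] (fun h : B => K h ^+ 2 * Delta h)%R.
  by apply: measurable_funM => //; exact: measurable_funX.
have IK : \int[mu]_h (K h ^+ 2 * Delta h)%:E =
    (Delta g)%:E * \int[mu]_h (K (g * h)%g ^+ 2 * Delta h)%:E.
  rewrite -(integral_mulgl hmu g (f := fun h : B => (K h ^+ 2 * Delta h)%:E)); last 2 first.
  - exact/measurable_EFinP.
  - by move=> h; rewrite lee_fin mulr_ge0 ?sqr_ge0// ltW.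
  rewrite -ge0_integralZl//; last 3 first.
  - apply/measurable_EFinP; apply: measurable_funM => //; exact: measurable_funX.
  - by move=> h _; rewrite lee_fin mulr_ge0 ?sqr_ge0// ltW.
  - by rewrite lee_fin ltW.
  apply: eq_integral => h _; rewrite -EFinM (modularM hDelta).
  by congr (_%:E); ring.
have If : \int[mu]_h (f h * f h) = \int[mu]_h (((Delta h)^-1)%:E * (f (h^-1)%g * f (h^-1)%g)).
  have mm : measb (fun h => (Delta h)%:E * (f h * f h)) by exact: emeasurable_funM.
  have := integral_invg hDelta mm.
  have DE0 h : 0 <= (Delta h)%:E by rewrite lee_fin ltW.
  move=> /(_ (fun h => mule_ge0 (DE0 h) (ff0 h))).
  under eq_integral do rewrite (modularV hDelta).
  move=> ->; apply: eq_integral => h _.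
  by rewrite (modularV hDelta) muleA -EFinM mulVf ?mul1e// gt_eqF.
rewrite IK If muleA -EFinM divfK ?gt_eqF//.
have n1 h : 0 <= (K (g * h)%g ^+ 2 * Delta h)%:E by rewrite lee_fin mulr_ge0 ?sqr_ge0// ltW.
have n2 h : 0 <= ((Delta h)^-1)%:E * (f (h^-1)%g * f (h^-1)%g).
  by rewrite mule_ge0 ?mule_ge0// lee_fin invr_ge0 ltW.
have mn1 : measb (fun h => (K (g * h)%g ^+ 2 * Delta h)%:E).
  by apply/measurable_EFinP; apply: measurable_funM => //; exact: measurable_funX.
have mn2 : measb (fun h => ((Delta h)^-1)%:E * (f (h^-1)%g * f (h^-1)%g)).
  exact: emeasurable_funM.
have t0' : 0 <= t%:E by rewrite lee_fin ltW.
have ti0 : 0 <= (t^-1)%:E by rewrite lee_fin invr_ge0 ltW.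
have pn0 h : 0 <= (K (g * h)%g)%:E * f (h^-1)%g by rewrite mule_ge0// lee_fin.
rewrite -(ge0_integralZl mu measurableT mprod (fun h _ => pn0 h))//.
rewrite -(ge0_integralZl mu measurableT mn1 (fun h _ => n1 h) t0').
rewrite -(ge0_integralZl mu measurableT mn2 (fun h _ => n2 h) ti0).
rewrite -ge0_integralD//; last 4 first.
- by move=> h _; exact: mule_ge0.
- exact: measurable_funeM.
- by move=> h _; exact: mule_ge0.
- exact: measurable_funeM.
apply: ge0_le_integral => //.
- by move=> h _; rewrite mule_ge0// lee_fin.
- exact: measurable_funeM.
- by apply: emeasurable_funD; exact: measurable_funeM.
move=> h _; have s0 : (0 < t * Delta h)%R by rewrite mulr_gt0.
apply: le_trans (amgm_ereal (K0 _) s0 (f0 _)) _.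
by rewrite [X in _ <= _ + X]muleA -!EFinM -invfM -mulrA [(Delta h * _)%R]mulrC.
Qed.

Variable omega : R.
Hypothesis weighted_le : weighted_l2_bound U mu mK omega.
Variable m : nat.
Hypothesis m0 : (0 < m)%N.
Hypothesis Km : forall g, K g != 0%R -> set_pow U m g.
Variable C : R.
Hypothesis K2 : \int[mu]_h (K h * K h)%:E <= C%:E.
Hypothesis K2D : \int[mu]_h (K h ^+ 2 * Delta h)%:E <= C%:E.

Local Notation rho1 g := ((dist_nat U [set 1%g] g)%:R : R).

Let F1 : [set 1%g : G] !=set0. Proof. by exists 1%g. Qed.

Lemma dist_nat1P g n : (0 < n)%N -> set_pow U n g -> (rho1 g <= n%:R)%R.
Proof.
move=> n0 Un; have [_ _ h] := dist_natP hU g F1.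
by rewrite ler_nat; apply: h => //; exists 1%g => //; rewrite invg1 mulg1.
Qed.

Lemma dist_nat1_sub g h : K (g * h)%g != 0%R -> (rho1 g <= m%:R + rho1 (h^-1)%g)%R.
Proof.
move=> /Km Um; have [d0 [x -> hx] _] := dist_natP hU (h^-1)%g F1.
rewrite -natrD; apply: dist_nat1P; first by rewrite addn_gt0 m0.
rewrite -(mulgK h g) -mulgA; move: hx; rewrite invg1 mulg1 => hx.
by rewrite mulgA; exact: set_pow_mul.
Qed.

(** Of the two summands m, one is the loss from the distance of g to that of h^-1 when g * h is in
    the support of K, the other bounds the weight on the initial function K. The exponent of the L^2
    estimate is halved because only the norm, not its square, enters. *)
Lemma avgn_pointwise_le n (lambda : R) g : (0 <= lambda)%R ->
  avgn n.+1 (fun x => (K x)%:E) g <=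
  (C * Delta g `^ (- 2^-1) *
   expR (lambda * (2 * m%:R - rho1 g) + omega * lambda ^+ 2 * n%:R / 2))%:E.
Proof.
move=> la0; set F := avgn n (fun x => (K x)%:E).
have mKE : measb (fun x => (K x)%:E) by exact/measurable_EFinP.
have mF : measb F := measurable_avgn hG hU hmu hDelta mK K0 K1 n mKE (fun x => K0 x).
have F0 x : 0 <= F x by apply: avgn_ge0 => y; rewrite lee_fin.
pose psi g := rho1 g.
have mpsi : measurable_fun [set: B] (psi : B -> R) by exact: measurable_dist_nat.
have hpsi : lipschitz_ae U mu 1 psi by exact: dist_nat_lipschitz_ae.
pose H x := (expR (lambda * psi x))%:E * F x.
have mH : measb H by exact: measurable_exp_mul.
have H0 x : 0 <= H x by rewrite mule_ge0// lee_fin expR_ge0.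
have step1 : avg F g <= (expR (lambda * (m%:R - psi g)))%:E * avg H g.
  have mKg : measb (fun h => (K (g * h)%g)%:E).
    by apply/measurable_EFinP; exact: (measurableT_comp mK (measurable_mulgl g)).
  have mHV : measb (fun h => H (h^-1)%g) by exact: (measurableT_comp mH (@measurable_invg G)).
  have mFV : measb (fun h => F (h^-1)%g) by exact: (measurableT_comp mF (@measurable_invg G)).
  have mP := emeasurable_funM mKg mHV; have mQ := emeasurable_funM mKg mFV.
  have P0 h : 0 <= (K (g * h)%g)%:E * H (h^-1)%g by rewrite mule_ge0// lee_fin.
  have Q0 h : 0 <= (K (g * h)%g)%:E * F (h^-1)%g by rewrite mule_ge0// lee_fin.
  have e0 : 0 <= (expR (lambda * (m%:R - psi g)))%:E by rewrite lee_fin expR_ge0.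
  rewrite !avg_conv// -(ge0_integralZl mu measurableT mP (fun h _ => P0 h) e0).
  apply: ge0_le_integral => //; first exact: measurable_funeM.
  move=> h _; have [->|Kgh] := eqVneq (K (g * h)%g) 0%R; first by rewrite !mul0e mule0.
  rewrite [X in _ <= X]muleCA; apply: lee_wpmul2l; first by rewrite lee_fin.
  rewrite /H muleA -EFinM -expRD -[leLHS]mul1e; apply: lee_wpmul2r => //.
  rewrite lee_fin -[leLHS]expR0 ler_expR -mulrDr mulr_ge0//.
  have hd : (psi g <= m%:R + psi (h^-1)%g)%R := dist_nat1_sub Kgh.
  by rewrite addrAC subr_ge0.
have HH : \int[mu]_x (H x * H x) <=
    (expR (omega * lambda ^+ 2 * n%:R + 2 * (lambda * m%:R)) * C)%:E.
  pose f x := (expR (lambda * psi x) * K x)%:E.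
  have mf : measb f.
    by rewrite /f; under eq_fun do rewrite EFinM; exact: measurable_exp_mul.
  have f0 x : 0 <= f x by rewrite lee_fin mulr_ge0// expR_ge0.
  have wE x : weighted_avgn mu mK lambda psi n f x = H x.
    rewrite /weighted_avgn /H /F; congr (_ * iter n avg _ x); apply/funext => y.
    by rewrite /f -EFinM mulrA -expRD mulNr addNr expR0 mul1r.
  have := weighted_le lambda n mpsi hpsi mf f0; under eq_integral do rewrite !wE.
  move=> /le_trans; apply.
  have -> : (expR (omega * lambda ^+ 2 * n%:R + 2 * (lambda * m%:R)) * C)%:E =
      (expR (omega * lambda ^+ 2 * n%:R))%:E * (expR (2 * (lambda * m%:R)) * C)%:E.
    by rewrite -EFinM expRD; congr (_%:E); exact/esym/mulrA.
  apply: lee_wpmul2l.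
    by rewrite lee_fin expR_ge0.
  have mKK : measb (fun x => (K x * K x)%:E).
    by apply/measurable_EFinP; exact: measurable_funM.
  have KK0 x : 0 <= (K x * K x)%:E by rewrite lee_fin mulr_ge0.
  have e0 : 0 <= (expR (2 * (lambda * m%:R)))%:E by rewrite lee_fin expR_ge0.
  apply: (@le_trans _ _ (\int[mu]_x ((expR (2 * (lambda * m%:R)))%:E * (K x * K x)%:E))).
    apply: ge0_le_integral => //.
    - by move=> x _; exact: mule_ge0.
    - exact: emeasurable_funM.
    - exact: measurable_funeM.
    move=> x _; rewrite /f -!EFinM lee_fin mulrACA.
    have [->|Kx] := eqVneq (K x) 0%R; first by rewrite !mulr0.
    rewrite ler_wpM2r ?mulr_ge0// -expRD ler_expR.
    have := ler_wpM2l la0 (dist_nat1P m0 (Km Kx)); rewrite -/(psi x).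
    by move: (lambda * psi x)%R (lambda * m%:R)%R => a b; lra.
  rewrite (ge0_integralZl mu measurableT mKK (fun x _ => KK0 x) e0) EFinM.
  exact: lee_wpmul2l.
have Dg := modular_gt0 hDelta g.
set s := (omega * lambda ^+ 2 * n%:R / 2 + lambda * m%:R)%R.
(* With expR (2 s) * C bounding the squared norm of H, this t makes the two terms of [le_avg_amgm]
   equal. *)
pose t : R := (Delta g `^ (2^-1) * expR s)%R.
have D2 : (0 < Delta g `^ 2^-1)%R by exact: powR_gt0.
have t0 : (0 < t)%R by rewrite mulr_gt0// expR_gt0.
have hA := le_avg_amgm g t0 mH H0.
have DD : (Delta g = Delta g `^ 2^-1 * Delta g `^ 2^-1)%R.
  rewrite -powRD; last by apply/implyP => _; rewrite gt_eqF.
  by rewrite (_ : 2^-1 + 2^-1 = 1)%R ?powRr1 ?ltW//; field.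
have hH : avg H g <= (C * Delta g `^ (- 2^-1) * expR s)%:E.
  rewrite -(@lee_pmul2l _ 2%:E)//; apply: le_trans hA _.
  have tD : (t / Delta g = Delta g `^ (- 2^-1) * expR s)%R.
    by rewrite powRN /t {2}DD; field; rewrite gt_eqF.
  have tV : (t^-1 * (expR (omega * lambda ^+ 2 * n%:R + 2 * (lambda * m%:R)) * C) =
      Delta g `^ (- 2^-1) * expR s * C)%R.
    have -> : (omega * lambda ^+ 2 * n%:R + 2 * (lambda * m%:R) = s + s)%R.
      by rewrite /s; field.
    by rewrite powRN /t (expRD s s); field; rewrite !gt_eqF// expR_gt0.
  apply: (@le_trans _ _ ((t / Delta g)%:E * C%:E +
     (t^-1)%:E * (expR (omega * lambda ^+ 2 * n%:R + 2 * (lambda * m%:R)) * C)%:E)).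
    apply: leeD; apply: lee_wpmul2l => //; rewrite lee_fin.
      by rewrite divr_ge0// ltW.
    by rewrite invr_ge0 ltW.
  rewrite -!EFinM -EFinD lee_fin tV tD le_eqVlt; apply/orP; left; apply/eqP; ring.
rewrite iterS -/F; apply: le_trans step1 _.
apply: (@le_trans _ _ ((expR (lambda * (m%:R - psi g)))%:E *
  (C * Delta g `^ (- 2^-1) * expR s)%:E)).
  by apply: lee_wpmul2l => //; rewrite lee_fin expR_ge0.
rewrite -EFinM lee_fin le_eqVlt; apply/orP; left; apply/eqP.
rewrite mulrC -[LHS]mulrA -expRD.
by congr (_ * expR _)%R; rewrite /s /psi; field.
Qed.

End PointwiseBound.

Section GaussianBound.
Variables (R : realType) (G : topologicalGroupType).
Implicit Types (g h k x y z : G).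
Local Notation B := (borel G).
Hypothesis hG : hausdorff_space G.
Variable U : set G.
Hypothesis hU : generating_nbhd U.
Variable mu : {measure set B -> \bar R}.
Hypothesis hmu : left_haar_measure mu.
Variable Delta : G -> R.
Hypothesis hDelta : modular_function mu Delta.
Variable K : G -> R.
Hypothesis mK : measurable_fun [set: B] (K : B -> R).
Hypothesis K0 : (forall g, 0 <= K g)%R.
Local Open Scope ereal_scope.
Hypothesis K1 : \int[mu]_g (K g)%:E = 1.
Variable omega : R.
Hypothesis omega0 : (0 < omega)%R.
Hypothesis weighted_le : weighted_l2_bound U mu mK omega.
Variable m : nat.
Hypothesis m0 : (0 < m)%N.
Hypothesis Km : forall g, K g != 0%R -> set_pow U m g.
Variables KB D : R.
Hypothesis KB0 : (0 < KB)%R.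
Hypothesis D1 : (1 <= D)%R.
Hypothesis hKB : forall g, (K g <= KB)%R.
Hypothesis hD : forall g, K g != 0%R -> (Delta g <= D)%R.

Local Notation rho1 g := ((dist_nat U [set 1%g] g)%:R : R).

Let mKE : measurable_fun [set: B] (fun x : B => (K x)%:E).
Proof. exact/measurable_EFinP. Qed.

Let int_le (k : G -> R) : measurable_fun [set: B] (k : B -> R) ->
  (forall g, 0 <= k g)%R -> (forall g, k g <= KB * D * K g)%R ->
  \int[mu]_g (k g)%:E <= (KB * D)%:E.
Proof.
move=> mk k0 kK; have c0 : (0 <= KB * D)%R.
  by rewrite mulr_ge0 ?(ltW KB0)// (le_trans ler01).
have K0E g : [set: B] g -> 0 <= (K g)%:E by rewrite lee_fin.
rewrite -[leRHS]mule1 -K1 -(ge0_integralZl mu measurableT mKE K0E); last by rewrite lee_fin.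
have mkE : measurable_fun [set: B] (fun x : B => (k x)%:E) by exact/measurable_EFinP.
have mcK := measurable_funeM (KB * D)%R%:E mKE.
apply: ge0_le_integral => // x _; first by rewrite lee_fin.
by rewrite -EFinM lee_fin.
Qed.

Lemma gaussian_bound : exists c b : R, [/\ (0 < c)%R, (0 < b)%R &
  forall (n : nat) (g : G), (0 < n)%N ->
    (conv_power mu K n g)%:E
      <= (c * Delta g `^ (- 2^-1))%:E * gaussian b n (rho R U g)].
Proof.
have D0 : (0 < D)%R by rewrite (lt_le_trans ltr01).
have C0 : (0 < KB * D)%R by rewrite mulr_gt0.
have K2 : \int[mu]_h (K h * K h)%:E <= (KB * D)%:E.
  apply: int_le => [|g|g]; [exact: measurable_funM|exact: mulr_ge0|].
  by rewrite ler_wpM2r// (le_trans (hKB g))// ler_peMr// ltW.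
have Dg0 := modular_gt0 hDelta.
have K2D : \int[mu]_h (K h ^+ 2 * Delta h)%:E <= (KB * D)%:E.
  apply: int_le => [|g|g].
  - by apply: measurable_funM; [exact: measurable_funX|exact: (measurable_modular hDelta)].
  - by rewrite mulr_ge0 ?sqr_ge0// ltW.
  have [->|Kg] := eqVneq (K g) 0%R; first by rewrite expr0n/= mul0r mulr0.
  rewrite expr2 -mulrA mulrC ler_wpM2r// ler_pM//; first exact: ltW.
  exact: hD.
set a := (omega + 1)%R; have a0 : (0 < a)%R by rewrite addr_gt0.
pose b := ((8 * a)^-1)%R; have b0 : (0 < b)%R by rewrite invr_gt0 mulr_gt0.
set M := (m%:R : R); have M2 := sqr_ge0 M.
exists (KB * D * expR (M ^+ 2 + b * M ^+ 2))%R, b; split => //.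
  by rewrite mulr_gt0// expR_gt0.
move=> n g n0; rewrite (rho_dist_nat R hU) /gaussian -!EFinM /= lee_fin.
have P0 := powR_gt0 (- 2^-1) (Dg0 g).
have bM0 : (0 <= b * M ^+ 2)%R by rewrite mulr_ge0// ltW.
case: n n0 => [//|[_|n _]].
  (* For one factor nothing has been averaged: on the support of K the distance is at most M and
     Delta at most D, so the right-hand side is at least KB. The term b * M^2 in the constant is
     there for this case. *)
  rewrite /conv_power /=; have [->|Kg] := eqVneq (K g) 0%R.
    by rewrite !mulr_ge0// ?expR_ge0 ?powR_ge0 ?ltW.
  have rm : (rho1 g <= M)%R := dist_nat1P R hU m0 (Km Kg).
  have e1 : (1 <= expR (M ^+ 2 + b * M ^+ 2) * expR (- (b / 1 * (rho1 g * rho1 g))))%R.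
    rewrite -expRD divr1 -[leLHS]expR0 ler_expR -addrA addr_ge0// subr_ge0 ler_pM2l//.
    by rewrite -expr2 lerXn2r// nnegrE.
  have e2 : (1 <= D * Delta g `^ (- 2^-1))%R.
    rewrite powRN ler_pdivlMr ?powR_gt0// mul1r.
    apply: (@le_trans _ _ (D `^ 2^-1)%R).
      by apply: ge0_ler_powR; rewrite ?nnegrE ?invr_ge0 ?(ltW D0) ?(ltW (Dg0 g))// hD.
    by apply: ler1_powR => //; rewrite invf_le1// ler1n.
  apply: le_trans (hKB g) _.
  rewrite [leRHS](_ : _ = KB * ((D * Delta g `^ (- 2^-1)) *
    (expR (M ^+ 2 + b * M ^+ 2) * expR (- (b / 1 * (rho1 g * rho1 g))))))%R; last by ring.
  by rewrite ler_peMr ?(ltW KB0)// mulr_ege1.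
have [h _] := conv_power_le hG hU hmu hDelta mK K0 K1 n.+1 g.
set N := (n.+2%:R : R)%R; have N1 : (1 <= N)%R by rewrite ler1n.
have N0 : (0 < N)%R by rewrite (lt_le_trans ltr01).
have aN0 : (0 < 2 * a * N)%R by rewrite !mulr_gt0.
(* With this choice b * rho^2 / N equals a N la^2 / 2. In the exponent, 2 la M <= la^2 + M^2 and
   both la^2 and omega la^2 n are at most a N la^2, so that M^2 - a N la^2 / 2 remains; this
   explains b = 1 / (8 a). *)
pose la := (rho1 g / (2 * a * N))%R.
have la0 : (0 <= la)%R by rewrite divr_ge0// ltW.
have := avgn_pointwise_le hG hU hmu hDelta K0 K1 weighted_le m0 Km K2 K2D n g la0.
move=> /(le_trans h); rewrite lee_fin => /le_trans; apply.
rewrite [leRHS](_ : _ = KB * D * Delta g `^ (- 2^-1) *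
  (expR (M ^+ 2 + b * M ^+ 2) * expR (- (b / N * (rho1 g * rho1 g)))))%R; last by ring.
rewrite ler_wpM2l//; first by rewrite mulr_ge0// ltW.
rewrite -expRD ler_expR.
have rE : (rho1 g = 2 * a * N * la)%R by rewrite /la mulrC divfK// gt_eqF.
have bE : (b / N * (rho1 g * rho1 g) = a * N * la ^+ 2 / 2)%R.
  by rewrite rE /b; field; rewrite !gt_eqF.
rewrite bE; set r := rho1 g in rE *; rewrite -/M rE.
have nN : (n%:R <= N :> R)%R by rewrite ler_nat -addn2 leq_addr.
have n0 : (0 <= n%:R :> R)%R by [].
have aN1 : (1 <= a * N)%R by rewrite mulr_ege1// lerDr ltW.
have l2 := sqr_ge0 la.
have i1 : (la ^+ 2 <= a * N * la ^+ 2)%R by rewrite ler_peMl.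
have i2 : (omega * la ^+ 2 * n%:R <= a * N * la ^+ 2)%R.
  rewrite mulrAC ler_wpM2r// ler_pM ?(ltW omega0)// lerDl.
  by [].
have i3 := sqr_ge0 (la - M)%R.
move: i1 i2 i3 bM0; rewrite sqrrB => i1 i2 i3 bM0.
rewrite (_ : la * (2 * M - 2 * a * N * la) = 2 * (la * M) - 2 * (a * N * la ^+ 2))%R; last by ring.
lra.
Qed.

End GaussianBound.

(** * Operators on complex functions *)

Section Modulus.
Variable R : realType.
Implicit Types (z : R[i]) (a b r : R).

Lemma normcE z : Normc.normc z = Num.sqrt (complex.Re z ^+ 2 + complex.Im z ^+ 2).
Proof. by case: z. Qed.

Lemma normc_ge0 z : 0 <= Normc.normc z.
Proof. by rewrite normcE sqrtr_ge0. Qed.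

Lemma sqr_normcE z : Normc.normc z ^+ 2 = complex.Re z ^+ 2 + complex.Im z ^+ 2.
Proof. by rewrite normcE sqr_sqrtr// addr_ge0 ?sqr_ge0. Qed.

Lemma ReZ r z : complex.Re (r%:C * z)%C = r * complex.Re z.
Proof. by case: z => a b /=; rewrite mul0r subr0. Qed.

Lemma ImZ r z : complex.Im (r%:C * z)%C = r * complex.Im z.
Proof. by case: z => a b /=; rewrite mul0r addr0. Qed.

Lemma normcZ r z : 0 <= r -> Normc.normc (r%:C * z)%C = r * Normc.normc z.
Proof.
move=> r0; rewrite !normcE ReZ ImZ !exprMn -mulrDr sqrtrM ?sqr_ge0//.
by rewrite sqrtr_sqr ger0_norm.
Qed.

Lemma normc_dot z w : complex.Re z * complex.Re w + complex.Im z * complex.Im w <=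
  Normc.normc z * Normc.normc w.
Proof.
apply: le_trans (ler_norm _) _; rewrite -(ler_pXn2r (n := 2))// ?nnegrE//; last first.
  by rewrite mulr_ge0 ?normc_ge0.
rewrite real_normK ?num_real// exprMn !sqr_normcE.
have := sqr_ge0 (complex.Re z * complex.Im w - complex.Im z * complex.Re w); nra.
Qed.

Lemma normr_Re_le z : `|complex.Re z| <= Normc.normc z.
Proof.
rewrite -(ler_pXn2r (n := 2))// ?nnegrE ?normc_ge0//.
by rewrite sqr_normcE real_normK ?num_real// lerDl sqr_ge0.
Qed.

Lemma normr_Im_le z : `|complex.Im z| <= Normc.normc z.
Proof.
rewrite -(ler_pXn2r (n := 2))// ?nnegrE ?normc_ge0//.
by rewrite sqr_normcE real_normK ?num_real// lerDr sqr_ge0.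
Qed.

Lemma normc_le_ReIm z : Normc.normc z <= `|complex.Re z| + `|complex.Im z|.
Proof.
rewrite -(ler_pXn2r (n := 2))// ?nnegrE ?normc_ge0 ?addr_ge0//.
rewrite sqr_normcE sqrrD !real_normK ?num_real// -addrA lerD2l lerDr.
by rewrite mulrn_wge0// mulr_ge0.
Qed.

End Modulus.

Section ComplexIntegral.
Context d (T : measurableType d) (R : realType).
Variable mu : {measure set T -> \bar R}.
Local Open Scope ereal_scope.
Variable F : T -> R[i].
Hypothesis mRe : measurable_fun setT (fun x => complex.Re (F x)).
Hypothesis mIm : measurable_fun setT (fun x => complex.Im (F x)).

Lemma measurable_normc : measurable_fun setT (fun x => Normc.normc (F x)).
Proof.
rewrite (_ : (fun x => _) =
    (fun x => Num.sqrt (complex.Re (F x) ^+ 2 + complex.Im (F x) ^+ 2)%R)); last first.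
  by apply/funext => x; rewrite normcE.
apply: (measurableT_comp (continuous_measurable_fun (@sqrt_continuous R))).
by apply: measurable_funD; exact: measurable_funX.
Qed.

(** With z the integral of F, |z|^2 is the integral of Re z * Re F + Im z * Im F, whose integrand is
    at most |z| |F|; division by |z| concludes. If |F| is not integrable the bound is trivial,
    whatever value the real integrals take. *)
Lemma normc_integral_le :
  (Normc.normc (Complex (\int[mu]_x complex.Re (F x)) (\int[mu]_x complex.Im (F x))))%:E <=
  \int[mu]_x (Normc.normc (F x))%:E.
Proof.
have mN := measurable_normc.
have mNE : measurable_fun setT (fun x => (Normc.normc (F x))%:E) by exact/measurable_EFinP.
set I := \int[mu]_x _; have I0 : 0 <= I.
  by apply: integral_ge0 => x _; rewrite lee_fin normc_ge0.
have [->|Ioo] := eqVneq I +oo; first by rewrite leey.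
have iN : mu.-integrable setT (fun x => (Normc.normc (F x))%:E).
  apply/integrableP; split => //; under eq_integral do rewrite gee0_abs ?lee_fin ?normc_ge0//.
  by rewrite lt_neqAle Ioo leey.
have iRe : mu.-integrable setT (fun x => (complex.Re (F x))%:E).
  apply: le_integrable iN => //; first exact/measurable_EFinP.
  by move=> x _; rewrite !abse_EFin lee_fin (le_trans (normr_Re_le _))// ler_norm.
have iIm : mu.-integrable setT (fun x => (complex.Im (F x))%:E).
  apply: le_integrable iN => //; first exact/measurable_EFinP.
  by move=> x _; rewrite !abse_EFin lee_fin (le_trans (normr_Im_le _))// ler_norm.
set z := Complex _ _.
have ReE : \int[mu]_x (complex.Re (F x))%:E = (complex.Re z)%:E.
  by rewrite /z /= /Rintegral fineK//; exact: integrable_fin_num.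
have ImE : \int[mu]_x (complex.Im (F x))%:E = (complex.Im z)%:E.
  by rewrite /z /= /Rintegral fineK//; exact: integrable_fin_num.
have [z0|z0] := eqVneq (Normc.normc z) 0%R; first by rewrite z0.
have zp : (0 < Normc.normc z)%R by rewrite lt_neqAle eq_sym z0 normc_ge0.
rewrite -(@lee_pmul2l _ (Normc.normc z)%:E)// -EFinM -expr2 sqr_normcE.
have -> : (complex.Re z ^+ 2 + complex.Im z ^+ 2)%:E = \int[mu]_x
    ((complex.Re z)%:E * (complex.Re (F x))%:E + (complex.Im z)%:E * (complex.Im (F x))%:E).
  rewrite integralD//; [|exact: integrableZl|exact: integrableZl].
  by rewrite !integralZl// ReE ImE -!EFinM -EFinD !expr2.
rewrite -integralZl//; apply: le_integral => //.
- by apply: integrableD => //; exact: integrableZl.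
- exact: integrableZl.
- by move=> x _; rewrite -!EFinM -EFinD lee_fin normc_dot.
Qed.

End ComplexIntegral.

Section ComplexOperator.
Variables (R : realType) (G : topologicalGroupType).
Implicit Types (g h k x y z : G) (f : G -> R[i]).
Local Notation B := (borel G).
Hypothesis hG : hausdorff_space G.
Variable U : set G.
Hypothesis hU : generating_nbhd U.
Variable mu : {measure set B -> \bar R}.
Hypothesis hmu : left_haar_measure mu.
Variable Delta : G -> R.
Hypothesis hDelta : modular_function mu Delta.
Variable K : G -> R.
Hypothesis mK : measurable_fun [set: B] (K : B -> R).
Hypothesis K0 : (forall g, 0 <= K g)%R.
Local Open Scope ereal_scope.
Hypothesis K1 : \int[mu]_g (K g)%:E = 1.
Local Notation avg := (avg mu mK).
Local Notation avgn n f := (iter n avg f).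
Local Notation measb f := (measurable_fun [set: B] (f : B -> \bar R)).
Local Notation T := (conv_op mu K).

Lemma measurable_convolution (f : G -> R) : measurable_fun [set: B] (f : B -> R) ->
  measurable_fun [set: B] (fun g : B => (\int[mu]_h (K h * f (h^-1 * g)%g))%R).
Proof.
move=> mf; have mfE : measb (fun x => (f x)%:E) by exact/measurable_EFinP.
have mp : measb ((fun x => (f x)%:E)^\+) by exact: measurable_funepos.
have mn : measb ((fun x => (f x)%:E)^\-) by exact: measurable_funeneg.
rewrite (_ : (fun g => _) =
    (fun g => fine (avg ((fun x => (f x)%:E)^\+) g - avg ((fun x => (f x)%:E)^\-) g))).
  apply: (measurableT_comp (fine_measurable measurableT)).
  by apply: emeasurable_funB; exact: (measurable_avg hG hU hmu hDelta).
apply/funext => g; rewrite /Rintegral integralE; congr (fine (_ - _)).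
- rewrite /avg (integral_law mu mK K0 (measurable_divg g mp))//.
  apply: eq_integral => h _; rewrite !funeposE EFinM.
  by rewrite -[X in maxe _ X](mule0 (K h)%:E) -maxe_pMr// ?lee_fin.
- rewrite /avg (integral_law mu mK K0 (measurable_divg g mn))//.
  apply: eq_integral => h _; rewrite !funenegE EFinM.
  by rewrite -[X in maxe _ X](mule0 (K h)%:E) -muleN -maxe_pMr// ?lee_fin.
Qed.

Lemma cmeasurable_conv_op f : cmeasurable f -> cmeasurable (T f).
Proof.
move=> [mr mi]; split; rewrite /conv_op /cintegral /=.
- rewrite (_ : (fun g => _) =
    (fun g => (\int[mu]_h (K h * complex.Re (f (h^-1 * g)%g)))%R)).
    exact: (measurable_convolution (f := fun x => complex.Re (f x)) mr).
  by apply/funext => g; apply: eq_Rintegral => h _; rewrite ReZ.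
- rewrite (_ : (fun g => _) =
    (fun g => (\int[mu]_h (K h * complex.Im (f (h^-1 * g)%g)))%R)).
    exact: (measurable_convolution (f := fun x => complex.Im (f x)) mi).
  by apply/funext => g; apply: eq_Rintegral => h _; rewrite ImZ.
Qed.

Lemma cmeasurable_iter_conv_op n f : cmeasurable f -> cmeasurable (iter n T f).
Proof. by move=> mf; elim: n => //= n IH; exact: cmeasurable_conv_op. Qed.

Lemma measurable_normc_EFin f : cmeasurable f -> measb (fun x => (Normc.normc (f x))%:E).
Proof. by move=> [? ?]; apply/measurable_EFinP; exact: measurable_normc. Qed.

(** Since K >= 0, T is dominated by averaging the modulus, also at points where the integral
    defining T f diverges. All operator norm bounds reduce in this way to nonnegative functions. *)
Lemma normc_conv_op_le f g : cmeasurable f ->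
  (Normc.normc (T f g))%:E <= avg (fun x => (Normc.normc (f x))%:E) g.
Proof.
move=> mf; have mN := measurable_normc_EFin mf.
have [mr mi] := mf.
have mr' := measurable_divg g mr; have mi' := measurable_divg g mi.
apply: le_trans (@normc_integral_le _ _ _ mu (fun h => (K h)%:C%C * f (h^-1 * g)%g)%R _ _) _.
- by under eq_fun do rewrite ReZ; exact: measurable_funM.
- by under eq_fun do rewrite ImZ; exact: measurable_funM.
have N0 h : 0 <= (Normc.normc (f (h^-1 * g)%g))%:E by rewrite lee_fin normc_ge0.
rewrite /avg (integral_law mu mK K0 (measurable_divg g mN))// le_eqVlt; apply/orP; left.
by apply/eqP; apply: eq_integral => h _; rewrite normcZ.
Qed.

Lemma normc_iter_conv_op_le n f g : cmeasurable f ->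
  (Normc.normc (iter n T f g))%:E <= avgn n (fun x => (Normc.normc (f x))%:E) g.
Proof.
move=> mf; have mN := measurable_normc_EFin mf.
have N0 h : 0 <= (Normc.normc (f h))%:E by rewrite lee_fin normc_ge0.
elim: n g => //= n IH g; have mn := cmeasurable_iter_conv_op n mf.
apply: le_trans (normc_conv_op_le _ mn) _; apply: le_avg => //.
- exact: measurable_normc_EFin.
- exact: (measurable_avgn hG hU hmu hDelta).
- by move=> x; rewrite lee_fin normc_ge0.
Qed.

Lemma cmeasurable_mult_op (a : G -> R) f : measurable_fun [set: B] (a : B -> R) ->
  cmeasurable f -> cmeasurable (mult_op a f).
Proof.
move=> ma [mr mi]; split; rewrite /mult_op.
- by under eq_fun do rewrite ReZ; exact: measurable_funM.
- by under eq_fun do rewrite ImZ; exact: measurable_funM.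
Qed.

Lemma opnorm_le p (M : R) (A : (G -> R[i]) -> (G -> R[i])) : (0 < p)%R -> (0 <= M)%R ->
  (forall f, cmeasurable f -> cmeasurable (A f) /\
    \int[mu]_g ((Normc.normc (A f g)) `^ p)%:E <=
    (M `^ p)%:E * \int[mu]_g ((Normc.normc (f g)) `^ p)%:E) ->
  opnorm mu p%:E p%:E A <= M%:E.
Proof.
move=> p0 M0 hA.
have LE f : Lp_norm mu p%:E f = (\int[mu]_g ((Normc.normc (f g)) `^ p)%:E) `^ p^-1.
  rewrite /Lp_norm unlock; congr (_ `^ _); apply: eq_integral => g _.
  by rewrite abse_EFin ger0_norm ?normc_ge0.
have I0 f : 0 <= \int[mu]_g ((Normc.normc (f g)) `^ p)%:E.
  by apply: integral_ge0 => g _; rewrite lee_fin powR_ge0.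
apply: ereal_inf_lbound; exists M => //; split => // f [mf ff].
have [mAf le] := hA f mf.
have key : Lp_norm mu p%:E (A f) <= M%:E * Lp_norm mu p%:E f.
  have -> : M%:E = (M `^ p)%:E `^ p^-1.
    by rewrite poweR_EFin -powRrM mulfV ?gt_eqF// powRr1.
  rewrite !LE -poweRM ?lee_fin ?powR_ge0//.
  apply: gt0_ler_poweR => //; rewrite ?invr_ge0 ?(ltW p0)// ?in_itv/= ?leey ?andbT//.
  by rewrite mule_ge0// lee_fin powR_ge0.
split=> //; split => //; apply: le_lt_trans key _.
rewrite lte_mul_pinfty// ?lee_fin//.
Qed.

End ComplexOperator.

(** * Operator norm bounds *)

Section OperatorNorms.
Variables (R : realType) (G : topologicalGroupType).
Implicit Types (g h k x y z : G) (f : G -> R[i]).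
Local Notation B := (borel G).
Hypothesis hG : hausdorff_space G.
Variable U : set G.
Hypothesis hU : generating_nbhd U.
Variable mu : {measure set B -> \bar R}.
Hypothesis hmu : left_haar_measure mu.
Variable Delta : G -> R.
Hypothesis hDelta : modular_function mu Delta.
Variable K : G -> R.
Hypothesis mK : measurable_fun [set: B] (K : B -> R).
Hypothesis K0 : (forall g, 0 <= K g)%R.
Local Open Scope ereal_scope.
Hypothesis K1 : \int[mu]_g (K g)%:E = 1.
Local Notation avg := (avg mu mK).
Local Notation avgn n f := (iter n avg f).
Local Notation measb f := (measurable_fun [set: B] (f : B -> \bar R)).
Local Notation T := (conv_op mu K).

Lemma Lp_norm_pinfty_ae f (y : \bar R) : Lp_norm mu +oo f <= y ->
  {ae mu, forall g : B, (Normc.normc (f g))%:E <= y}.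
Proof.
(* The norm of index +oo is defined by cases on the positivity of the total mass, which holds for a
   Haar measure. *)
rewrite /Lp_norm unlock /=; case: hmu => _ -> _ /ess_supP.
by apply: filterS => g; rewrite /= ger0_norm// normc_ge0.
Qed.

Lemma weight_class_lipschitz psi : weight_class mu U psi -> lipschitz_ae U mu 1 psi.
Proof.
move=> [_ _ hpsi] u Uu.
have h : Lp_norm mu +oo (difference u (fun g => (psi g)%:C%C)) <= 1.
  by apply: le_trans hpsi; apply: ereal_sup_ubound; exists u.
have := Lp_norm_pinfty_ae h; apply: filterS => g; rewrite lee_fin; apply: le_trans.
rewrite le_eqVlt; apply/orP; left; apply/eqP.
by rewrite /difference /translate normcE /= subr0 expr0n addr0 sqrtr_sqr.
Qed.

Variable omega : R.
Hypothesis omega0 : (0 < omega)%R.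
Hypothesis weighted_le : weighted_l2_bound U mu mK omega.

Lemma weighted_opnorm_le n lambda psi : weight_class mu U psi ->
  opnorm mu 2%:E 2%:E
    (fun f => mult_op (fun g => expR (lambda * psi g)%R)
       (iter n T (mult_op (fun g => expR (- lambda * psi g)%R) f))) <=
  (expR (omega * lambda ^+ 2 * n%:R))%:E.
Proof.
move=> hpsi; have lpsi := weight_class_lipschitz hpsi.
have mpsi : measurable_fun [set: B] (psi : B -> R) by case: hpsi.
have mexp (c : R) : measurable_fun [set: B] (fun g : B => expR (c * psi g)).
  by apply: (measurableT_comp (@measurable_expR R)); exact: measurable_funM.
apply: opnorm_le => // f mf.
have mef := cmeasurable_mult_op (mexp (- lambda)%R) mf.
have mT := cmeasurable_iter_conv_op hG hU hmu hDelta mK K0 K1 n mef.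
have mA := cmeasurable_mult_op (mexp lambda) mT.
split=> //; set A := mult_op _ _ in mA *.
have mN := measurable_normc_EFin mf.
have N0 x : 0 <= (Normc.normc (f x))%:E by rewrite lee_fin normc_ge0.
have hA g : (Normc.normc (A g))%:E <=
    weighted_avgn mu mK lambda psi n (fun x => (Normc.normc (f x))%:E) g.
  rewrite /A /mult_op normcZ ?expR_ge0// EFinM; apply: lee_wpmul2l.
    by rewrite lee_fin expR_ge0.
  apply: le_trans (normc_iter_conv_op_le hG hU hmu hDelta mK K0 K1 n g mef) _.
  rewrite le_eqVlt; apply/orP; left; apply/eqP; congr (iter n avg _ g).
  by apply/funext => x; rewrite /mult_op normcZ ?expR_ge0.
have sq (F : G -> R[i]) g : (Normc.normc (F g) `^ 2)%:E = (Normc.normc (F g))%:E * (Normc.normc (F g))%:E.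
  by rewrite (powR_mulrn 2) ?normc_ge0// expr2 EFinM.
under eq_integral do rewrite sq; under [X in _ <= _ * X]eq_integral do rewrite sq.
have mAN := measurable_normc_EFin mA.
have me0 := measurable_exp_mul (- lambda)%R mpsi mN.
have e0 x : 0 <= (expR (- lambda * psi x))%:E * (Normc.normc (f x))%:E.
  by rewrite mule_ge0// lee_fin expR_ge0.
have mw : measb (weighted_avgn mu mK lambda psi n (fun x => (Normc.normc (f x))%:E)).
  by apply: measurable_exp_mul => //; exact: (measurable_avgn hG hU hmu hDelta).
have A0 g : 0 <= (Normc.normc (A g))%:E by rewrite lee_fin normc_ge0.
have mAA := emeasurable_funM mAN mAN; have mww := emeasurable_funM mw mw.
apply: (@le_trans _ _ (\int[mu]_g
  (weighted_avgn mu mK lambda psi n (fun x => (Normc.normc (f x))%:E) g *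
   weighted_avgn mu mK lambda psi n (fun x => (Normc.normc (f x))%:E) g))).
  apply: ge0_le_integral => // g _; first exact: mule_ge0.
  exact: lee_pmul.
apply: le_trans (weighted_le lambda n mpsi lpsi mN N0) _; apply: lee_wpmul2r.
  by apply: integral_ge0 => g _; exact: mule_ge0.
(* The estimate available bounds the squared norm by expR (omega * lambda^2 * n), while the square
   of the claimed bound has twice this exponent; the factor 2 is given away. *)
rewrite lee_fin (powR_mulrn 2) ?expR_ge0// -expRM_natl ler_expR mulr_natl mulr2n lerDl.
by rewrite mulr_ge0// mulr_ge0 ?sqr_ge0// ltW.
Qed.

Lemma opnorm_eq0 p A : (0 < p)%R -> (forall f, cmeasurable f -> forall g, A f g = 0%R) ->
  opnorm mu p%:E p%:E A <= 0.
Proof.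
move=> p0 A0; apply: opnorm_le => // f mf; split.
  by split; under eq_fun do rewrite A0//; exact: measurable_cst.
under eq_integral do rewrite A0// Normc.normc0 powR0 ?gt_eqF//.
by rewrite integral0 powR0 ?gt_eqF// mul0e.
Qed.

Lemma off_diagonal p : (1 < p)%R -> exists c b : R, [/\ (0 < c)%R, (0 < b)%R &
  forall (n : nat) (E F : set G), (0 < n)%N ->
    measurable (E : set B) -> measurable (F : set B) ->
    opnorm mu p%:E p%:E (fun f => mult_op \1_E (iter n T (mult_op \1_F f)))
      <= c%:E * gaussian b n (set_dist R U E F)].
Proof.
move=> p1; have p0 : (0 < p)%R by rewrite (lt_trans ltr01).
set kap := (Num.min 1 (p - 1))%R.
have kap0 : (0 < kap)%R by rewrite lt_min ltr01 subr_gt0.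
have om0 : (0 < omega + 1)%R by rewrite addr_gt0.
(* These come from the p-th root of expR (kap * (1 - d^2 / ((omega + 1) n))): the summand 1 yields
   c, the quotient yields b. *)
exists (expR (kap / p)), (kap / p / (omega + 1))%R; split.
- exact: expR_gt0.
- by rewrite !divr_gt0.
move=> n E F n0 mE mF.
have b0 : (0 < kap / p / (omega + 1) / n%:R)%R by rewrite !divr_gt0// ltr0n.
have goo : gaussian (kap / p / (omega + 1)) n +oo = 0 :> \bar R.
  by rewrite /gaussian mulyy gt0_muley ?lte_fin.
have m1 (D : set G) : measurable (D : set B) -> measurable_fun [set: B] (\1_D : B -> R).
  by move=> mD; exact: measurable_indic.
(* An empty set is at infinite distance and the Gaussian factor vanishes, so the operator has to be
   exactly 0; [dist_nat] is meaningful only for nonempty F. *)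
have [->|/set0P E0] := eqVneq E set0.
  rewrite set_dist0l goo mule0; apply: opnorm_eq0 => // f mf g.
  by rewrite /mult_op indic0/= mul0r.
have [->|/set0P F0] := eqVneq F set0.
  rewrite set_dist0r goo mule0; apply: opnorm_eq0 => // f mf g.
  have mz := cmeasurable_mult_op (m1 _ measurable0) mf.
  have := normc_iter_conv_op_le hG hU hmu hDelta mK K0 K1 n g mz.
  have -> : (fun x => (Normc.normc (mult_op \1_(set0 : set G) f x))%:E) = (fun=> 0%:E).
    by apply/funext => x; rewrite /mult_op indic0/= mul0r Normc.normc0.
  rewrite (avgn_cst hG hU hmu hDelta mK K0 K1)// lee_fin => h.
  have z0 : Normc.normc (iter n T (mult_op \1_(set0 : set G) f) g) = 0%R.
    by apply/eqP; rewrite eq_le h normc_ge0.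
  by rewrite /mult_op (Normc.eq0_normc z0) mulr0.
have [d d0 dE] := set_dist_fin R hU E0 F0.
have Ed g : E g -> (d <= (dist_nat U F g)%:R)%R.
  by move=> Eg; rewrite -lee_fin -dE; exact: set_dist_le.
have N0 : (0 < n%:R :> R)%R by rewrite ltr0n.
set e := (1 - d ^+ 2 / ((omega + 1) * n%:R))%R.
have -> : (expR (kap / p))%:E * gaussian (kap / p / (omega + 1)) n (set_dist R U E F) =
    (expR (kap / p * e))%:E.
  rewrite dE /gaussian /= -EFinM -expRD; congr (expR _)%:E.
  by rewrite /e; field; rewrite !gt_eqF.
apply: opnorm_le => // f mf.
have mef := cmeasurable_mult_op (m1 _ mF) mf.
have mT := cmeasurable_iter_conv_op hG hU hmu hDelta mK K0 K1 n mef.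
have mA := cmeasurable_mult_op (m1 _ mE) mT; split => //.
pose phi x := Normc.normc (mult_op \1_F f x).
have mphi : measurable_fun [set: B] (phi : B -> R) by case: mef => ? ?; exact: measurable_normc.
have phi0 x : (0 <= phi x)%R by exact: normc_ge0.
have phiF x : ~ F x -> phi x = 0%R.
  by move=> nF; rewrite /phi /mult_op indicE memNset//= mul0r Normc.normc0.
have phif x : (phi x <= Normc.normc (f x))%R.
  rewrite /phi /mult_op normcZ ?indicE ?ler0n//.
  by case: (_ \in _); rewrite ?mul1r ?mul0r ?normc_ge0.
have decay := avgn_lp_decay hG hU hmu hDelta K0 K1 omega0 weighted_le p1 n0 mE F0 d0 Ed mphi phi0 phiF.
have -> : (expR (kap / p * e) `^ p = expR (kap * e))%R.
  rewrite /powR gt_eqF ?expR_gt0// expRK; congr expR; field.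
  by rewrite gt_eqF.
have mpE (h : G -> R) : measurable_fun [set: B] (h : B -> R) -> measb (fun x => (h x `^ p)%:E).
  exact: measurable_powR_EFin.
have mfN : measurable_fun [set: B] (fun x : B => Normc.normc (f x)) by case: mf => ? ?; exact: measurable_normc.
apply: (@le_trans _ _ ((expR (kap * e))%:E * \int[mu]_g (phi g `^ p)%:E)); last first.
  apply: lee_wpmul2l; first by rewrite lee_fin expR_ge0.
  apply: ge0_le_integral => //; [|exact: mpE|exact: mpE|].
  - by move=> x _; rewrite lee_fin powR_ge0.
  - by move=> x _; rewrite lee_fin ge0_ler_powR ?nnegrE ?normc_ge0 ?(ltW p0).
apply: le_trans decay; rewrite [X in _ <= X]integral_mkcond.
have mphiE : measb (fun x => (phi x)%:E) by exact/measurable_EFinP.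
have mav := measurable_avgn hG hU hmu hDelta mK K0 K1 n mphiE (fun x => phi0 x).
have mAN : measurable_fun [set: B] (fun x : B => Normc.normc (mult_op \1_E (iter n T (mult_op \1_F f)) x)).
  by case: mA => ? ?; exact: measurable_normc.
apply: ge0_le_integral => //.
- by move=> x _; rewrite lee_fin powR_ge0.
- exact: mpE.
- apply/(measurable_restrictT _ mE); apply: measurable_funTS.
  exact: (measurableT_comp (measurable_poweR _)).
move=> g _; rewrite patchE /mult_op normcZ ?indicE ?ler0n//.
case: ifPn => [Eg|_]; last by rewrite mul0r powR0// gt_eqF.
rewrite mul1r -poweR_EFin; apply: gt0_ler_poweR; rewrite ?(ltW p0)//.
- by rewrite in_itv/= lee_fin normc_ge0 leey.
- by rewrite in_itv/= leey andbT; apply: avgn_ge0 => x; rewrite lee_fin.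
exact: (normc_iter_conv_op_le hG hU hmu hDelta mK K0 K1 n g mef).
Qed.

End OperatorNorms.

(** * The bilinear estimate for I - T *)

Section Pairing.
Variables (R : realType) (G : topologicalGroupType).
Implicit Types (g h k x y z : G).
Local Notation B := (borel G).
Hypothesis hG : hausdorff_space G.
Variable U : set G.
Hypothesis hU : generating_nbhd U.
Variable mu : {measure set B -> \bar R}.
Hypothesis hmu : left_haar_measure mu.
Variable Delta : G -> R.
Hypothesis hDelta : modular_function mu Delta.
Variable K : G -> R.
Hypothesis mK : measurable_fun [set: B] (K : B -> R).
Hypothesis K0 : (forall g, 0 <= K g)%R.
Local Open Scope ereal_scope.
Hypothesis K1 : \int[mu]_g (K g)%:E = 1.
Local Notation nu := (density_measure mu mK).
Local Notation measb f := (measurable_fun [set: B] (f : B -> \bar R)).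
Local Notation T := (conv_op mu K).

(** For every g and almost every h the point h^-1 * g avoids the exceptional null set of u, so the
    convolution converges at every g and not merely at almost every one. *)
Lemma law_translate_bounded (u : G -> R) (M : R) g : measurable_fun [set: B] (u : B -> R) ->
  {ae mu, forall g : B, (`|u g| <= M)%R} ->
  [/\ nu.-integrable setT (fun h : B => (u (h^-1 * g)%g)%:E),
      \int[nu]_h (u (h^-1 * g)%g)%:E = (convolution mu K u g)%:E
    & (`|convolution mu K u g| <= M)%R].
Proof.
move=> mu_ uM; have mug := measurable_divg g mu_.
have mugE : measb (fun h => (u (h^-1 * g)%g)%:E) by exact/measurable_EFinP.
have ub : {ae nu, forall h : B, (`|u (h^-1 * g)%g| <= M)%R}.
  exact: (ae_law mK (ae_divg hmu hDelta g uM)).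
have le : \int[nu]_h `|(u (h^-1 * g)%g)%:E| <= M%:E.
  rewrite -(integral_law_cst mK K0 K1 M%:E); apply: ge0_ae_le_integral => //.
  by apply: measurableT_comp.
have iu : nu.-integrable setT (fun h : B => (u (h^-1 * g)%g)%:E).
  by apply/integrableP; split => //; exact: le_lt_trans le (ltry _).
have E : \int[nu]_h (u (h^-1 * g)%g)%:E = (convolution mu K u g)%:E.
  have fin := integrable_fin_num measurableT iu.
  rewrite -(fineK fin); congr (_%:E).
  by rewrite (@integral_law_signed _ _ mu _ mK K0 _ mug).
split => //; rewrite -lee_fin -abse_EFin -E.
exact: le_trans (le_abse_integral _ _ _) le.
Qed.

Lemma integrable_sub_mul (a b : G -> R) (M : R) : measurable_fun [set: B] (a : B -> R) ->
  {ae mu, forall g : B, (`|a g| <= M)%R} -> mu.-integrable setT (fun g : B => (b g)%:E) ->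
  mu.-integrable setT
  (fun g : B => ((a g - convolution mu K a g) * b g)%:E).
Proof.
move=> ma aM ib.
have mb : measurable_fun [set: B] (b : B -> R) by have /measurable_int/measurable_EFinP := ib.
have mTa := measurable_convolution hG hU hmu hDelta mK K0 K1 ma.
have ib2 : mu.-integrable setT (fun g : B => (2 * M)%:E * (b g)%:E) by exact: integrableZl.
have mf : measb (fun g => ((a g - convolution mu K a g) * b g)%:E).
  by apply/measurable_EFinP; apply: measurable_funM => //; exact: measurable_funB.
apply/integrableP; split => //.
have mabs : measb (fun g => `|(2 * M)%:E * (b g)%:E|).
  by apply: measurableT_comp => //; exact: measurable_int ib2.
have /integrableP[_] := ib2; apply: le_lt_trans; apply: ge0_ae_le_integral => //.
  exact: measurableT_comp.
apply: filterS (aM) => g ag; have [_ _ Ta] := law_translate_bounded g ma aM.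
rewrite -EFinM !abse_EFin lee_fin !normrM ler_wpM2r//.
apply: le_trans (ler_normB _ _) _; apply: le_trans (lerD ag Ta) _.
rewrite -normrM; apply: le_trans (ler_norm _); lra.
Qed.

Section real_pairing.
Variables (C : R).
Hypothesis mean_le : forall (phi psi : G -> R) (A D : R),
  (0 <= A)%R -> (0 <= D)%R -> mu.-integrable setT (fun g : B => (phi g)%:E) ->
  (forall u, U u -> l1_diff mu phi u <= D%:E) -> div_measurable psi ->
  lipschitz_ae U mu A psi -> `|\int[nu]_x pair_diff mu phi psi x| <= (C * (A * D))%:E.
Variables (a b : G -> R) (M A D : R).
Hypothesis ma : measurable_fun [set: B] (a : B -> R).
Hypothesis M0 : (0 <= M)%R.
Hypothesis aM : {ae mu, forall g : B, (`|a g| <= M)%R}.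
Hypothesis A0 : (0 <= A)%R.
Hypothesis aA : lipschitz_ae U mu A a.
Hypothesis D0 : (0 <= D)%R.
Hypothesis ib : mu.-integrable setT (fun g : B => (b g)%:E).
Hypothesis bD : forall u, U u -> l1_diff mu b u <= D%:E.

Let mb : measurable_fun [set: B] (b : B -> R).
Proof. by have /measurable_int/measurable_EFinP := ib. Qed.

(** By Fubini's theorem the pairing of (I - T) a with b is minus the mean of [pair_diff b a] over
    the law of K, to which the estimate from centering applies. Boundedness of a and integrability
    of b make the double integral absolutely convergent, and a is first replaced by a version
    measurable on the product. *)
Lemma real_pairing_le :
  `|\int[mu]_g ((a g - convolution mu K a g) * b g)%:E| <= (C * (A * D))%:E.
Proof.
have [a' ma' aa'] := real_ae_div_measurable hU hG hmu ma.
have ma'B := div_measurable_borel ma'.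
have a'M : {ae mu, forall g : B, (`|a' g| <= M)%R}.
  by apply: filterS2 aa' aM => g ->.
have a'A := lipschitz_ae_eq hmu aa' aA.
have TaE g : convolution mu K a g = convolution mu K a' g.
  have [_ E1 _] := law_translate_bounded g ma aM.
  have [_ E2 _] := law_translate_bounded g ma'B a'M.
  apply: EFin_inj; rewrite -E1 -E2; apply: ae_eq_integral => //.
  - by apply/measurable_EFinP; exact: measurable_divg.
  - by apply/measurable_EFinP; exact: measurable_divg.
  by have := ae_law mK (ae_divg hmu hDelta g aa'); apply: filterS => h ->.
pose f (p : B * B) := (b p.2 * (a' (p.1^-1 * p.2)%g - a' p.2))%:E.
have mf : measurable_fun setT f.
  apply/measurable_EFinP; apply: measurable_funM.
    exact: (measurableT_comp mb measurable_snd).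
  apply: measurable_funB; first exact: ma'.
  exact: (measurableT_comp ma'B measurable_snd).
have inner g : \int[nu]_h f (h, g) = (- ((a' g - convolution mu K a' g) * b g))%:E.
  have [iu E _] := law_translate_bounded g ma'B a'M.
  have ic : nu.-integrable setT (fun _ : B => (a' g)%:E).
    apply/integrableP; split => //.
    by rewrite /= (integral_law_cst mK K0 K1) ltry.
  have -> : \int[nu]_h f (h, g) =
      \int[nu]_h ((b g)%:E * ((a' (h^-1 * g)%g)%:E - (a' g)%:E)).
    by apply: eq_integral => h _; rewrite /f EFinM EFinB.
  rewrite integralZl//; last exact: integrableB.
  rewrite integralB// E (integral_law_cst mK K0 K1) -EFinB -EFinM.
  by congr (_%:E); ring.
have mfh h : measurable_fun [set: B] (fun g : B => f (h, g)).
  exact: (measurable_fun_pair2 (f := f) h mf).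
have nf : measurable_fun setT (fun p => `|f p|) by exact: measurableT_comp.
have hfin : \int[nu]_h \int[mu]_g `|f (h, g)| < +oo.
  have /integrableP[mbE bfin] := ib.
  apply: (@le_lt_trans _ _ (\int[nu]_h ((2 * M)%:E * \int[mu]_g `|(b g)%:E|))); last first.
    rewrite (integral_law_cst mK K0 K1) lte_mul_pinfty ?lee_fin ?mulr_ge0//.
  apply: ge0_le_integral => //.
  - by move=> h _; exact: integral_ge0.
  - exact: (measurable_int_haar hG hU hmu nf).
  move=> h _; rewrite -ge0_integralZl//; last 2 first.
  - by apply: measurableT_comp.
  - by rewrite lee_fin mulr_ge0.
  apply: ge0_ae_le_integral => //.
  - exact: measurableT_comp.
  - by apply: measurable_funeM; exact: measurableT_comp.
  have := ae_mulgl hmu (h^-1)%g a'M; apply: filterS2 a'M => g hg hg'.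
  rewrite /f !abse_EFin -EFinM lee_fin normrM mulrC ler_wpM2r//.
  by apply: le_trans (ler_normB _ _) _; rewrite mulr_natl mulr2n lerD.
have FE := fubini_signed (law_sigma_finite mK K0 K1) (haar_sigma_finite hG hU hmu) mf hfin.
have := mean_le A0 D0 ib bD ma' a'A.
have -> : \int[nu]_x pair_diff mu b a' x = \int[nu]_h \int[mu]_g f (h, g) by [].
rewrite FE; under eq_integral do rewrite inner.
have -> : \int[mu]_g ((a g - convolution mu K a g) * b g)%:E =
    \int[mu]_g ((a' g - convolution mu K a' g) * b g)%:E.
  have m' : measb (fun g => ((a' g - convolution mu K a' g) * b g)%:E).
    apply/measurable_EFinP; apply: measurable_funM => //; apply: measurable_funB => //.
    exact: (measurable_convolution hG hU hmu hDelta mK K0 K1).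
  apply: ae_eq_integral => //.
  - exact: measurable_int (integrable_sub_mul ma aM ib).
  - by apply: filterS aa' => g -> _; rewrite TaE.
have i' : mu.-integrable setT (fun g : B => ((a' g - convolution mu K a' g) * b g)%:E).
  exact: (integrable_sub_mul ma'B a'M ib).
have -> : \int[mu]_g (- ((a' g - convolution mu K a' g) * b g))%:E =
    \int[mu]_g ((-1)%:E * ((a' g - convolution mu K a' g) * b g)%:E).
  by apply: eq_integral => g _; rewrite -EFinM mulN1r.
by rewrite integralZl// EFinN mulN1e abseN.
Qed.

End real_pairing.

Implicit Types f : G -> R[i].

Lemma Lp_norm_pinfty_le f (y : \bar R) :
  {ae mu, forall g : B, (Normc.normc (f g))%:E <= y} -> Lp_norm mu +oo f <= y.
Proof.
move=> h; rewrite /Lp_norm unlock /=; case: hmu => _ -> _; apply/ess_supP.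
by apply: filterS h => g; rewrite /= ger0_norm// normc_ge0.
Qed.

Lemma Lp_norm1 f : Lp_norm mu 1 f = \int[mu]_g (Normc.normc (f g))%:E.
Proof.
rewrite /Lp_norm Lnorm1; apply: eq_integral => g _.
by rewrite abse_EFin ger0_norm// normc_ge0.
Qed.

Lemma Lp_norm_ge0 p f : 0 <= Lp_norm mu p f.
Proof. exact: Lnorm_ge0. Qed.

Lemma difference_Re u f g : complex.Re (difference u f g) =
  (complex.Re (f (u^-1 * g)%g) - complex.Re (f g))%R.
Proof. by rewrite /difference /translate /=; case: (f _) => ? ?; case: (f g). Qed.

Lemma difference_Im u f g : complex.Im (difference u f g) =
  (complex.Im (f (u^-1 * g)%g) - complex.Im (f g))%R.
Proof. by rewrite /difference /translate /=; case: (f _) => ? ?; case: (f g). Qed.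

Lemma normc_difference_le u f g : (Normc.normc (difference u f g) <=
  2 * (Normc.normc (f (u^-1 * g)%g) + Normc.normc (f g)))%R.
Proof.
apply: le_trans (normc_le_ReIm _) _; rewrite difference_Re difference_Im.
have h1 := normr_Re_le (f g); have h2 := normr_Im_le (f g).
have h3 := normr_Re_le (f (u^-1 * g)%g); have h4 := normr_Im_le (f (u^-1 * g)%g).
apply: le_trans (lerD (ler_normB _ _) (ler_normB _ _)) _; lra.
Qed.

(** Translations preserve both norms, so differences stay in the space. The finite values are the
    real constants A and D that the mean estimate takes. *)
Lemma Gamma_fin (p : \bar R) f : p = 1 \/ p = +oo -> in_Lp mu p f ->
  exists2 A : R, (0 <= A)%R & Gamma mu U p f = A%:E.
Proof.
move=> hp [mf ff].
have U1 : U 1%g by case: hU.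
have [y y0 fy] : exists2 y : R, (0 <= y)%R & Lp_norm mu p f = y%:E.
  have := Lp_norm_ge0 p f; case: (Lp_norm mu p f) ff => // y _; rewrite lee_fin.
  by exists y.
have G0 : 0 <= Gamma mu U p f.
  apply: le_trans (Lp_norm_ge0 p (difference 1%g f)) _.
  by apply: ereal_sup_ubound; exists 1%g.
have mN := measurable_normc_EFin mf.
have N0 g : 0 <= (Normc.normc (f g))%:E by rewrite lee_fin normc_ge0.
have G4 : Gamma mu U p f <= (4 * y)%:E.
  apply: ge_ereal_sup => _ [u Uu <-]; case: hp fy ff => -> fy ff.
  - have mNu : measb (fun g => (Normc.normc (f (u^-1 * g)%g))%:E).
      exact: (measurableT_comp mN (measurable_mulgl (u^-1)%g)).
    have md : cmeasurable (difference u f).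
      case: mf => mr mi; split.
        under eq_fun do rewrite difference_Re; apply: measurable_funB => //.
        exact: (measurableT_comp mr (measurable_mulgl (u^-1)%g)).
      under eq_fun do rewrite difference_Im; apply: measurable_funB => //.
      exact: (measurableT_comp mi (measurable_mulgl (u^-1)%g)).
    have mdN := measurable_normc_EFin md.
    have mS := emeasurable_funD mNu mN.
    have S0 g : 0 <= (Normc.normc (f (u^-1 * g)%g))%:E + (Normc.normc (f g))%:E.
      by rewrite adde_ge0.
    rewrite Lp_norm1; apply: (@le_trans _ _ (\int[mu]_g (2%:E *
      ((Normc.normc (f (u^-1 * g)%g))%:E + (Normc.normc (f g))%:E)))).
      apply: ge0_le_integral => //.
      + by move=> g _; rewrite lee_fin normc_ge0.
      + exact: measurable_funeM.
      + by move=> g _; rewrite -EFinD -EFinM lee_fin normc_difference_le.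
    rewrite (ge0_integralZl mu measurableT mS (fun g _ => S0 g))//.
    rewrite ge0_integralD// (integral_mulgl hmu (u^-1)%g mN N0) -Lp_norm1 fy -EFinD -EFinM.
    by rewrite lee_fin; lra.
  - have fae : {ae mu, forall g : B, (Normc.normc (f g) <= y)%R}.
      by have := @Lp_norm_pinfty_ae _ _ mu hmu f y%:E; rewrite fy lexx => /(_ isT).
    apply: Lp_norm_pinfty_le.
    have := ae_mulgl hmu (u^-1)%g fae; apply: filterS2 fae => g h1 h2.
    rewrite lee_fin; apply: le_trans (normc_difference_le _ _ _) _; lra.
by case: (Gamma mu U p f) G0 G4 => // A; rewrite lee_fin => A0 _; exists A.
Qed.

Variable C : R.
Hypothesis mean_le : forall (phi psi : G -> R) (A D : R),
  (0 <= A)%R -> (0 <= D)%R -> mu.-integrable setT (fun g : B => (phi g)%:E) ->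
  (forall u, U u -> l1_diff mu phi u <= D%:E) -> div_measurable psi ->
  lipschitz_ae U mu A psi -> `|\int[nu]_x pair_diff mu phi psi x| <= (C * (A * D))%:E.

(** The complex pairing consists of four real ones, between the real and imaginary parts of f1 and
    f2, each bounded by C times the product of the two Gammas. The additional 1 makes the constant
    positive. *)
Lemma cpairing_le f1 f2 : in_Lp mu +oo f1 -> in_Lp mu 1 f2 ->
  (Normc.normc (cpairing mu (f1 \- T f1)%R f2))%:E <=
  (4 * C + 1)%:E * Gamma mu U +oo f1 * Gamma mu U 1 f2.
Proof.
move=> L1 L2; have [A A0 AE] := Gamma_fin (or_intror erefl) L1.
have [D D0 DE] := Gamma_fin (or_introl erefl) L2.
have [[mr1 mi1] f1fin] := L1; have [[mr2 mi2] f2fin] := L2.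
have [M M0 fM] : exists2 M : R, (0 <= M)%R & Lp_norm mu +oo f1 = M%:E.
  have := Lp_norm_ge0 +oo f1; case: (Lp_norm mu +oo f1) f1fin => // y _; rewrite lee_fin.
  by exists y.
have fae : {ae mu, forall g : B, (Normc.normc (f1 g) <= M)%R}.
  by have := @Lp_norm_pinfty_ae _ _ mu hmu f1 M%:E; rewrite fM lexx => /(_ isT).
have daeA u : U u -> {ae mu, forall g : B, (Normc.normc (difference u f1 g) <= A)%R}.
  move=> Uu; have h : Lp_norm mu +oo (difference u f1) <= A%:E.
    by rewrite -AE; apply: ereal_sup_ubound; exists u.
  exact: Lp_norm_pinfty_ae h.
have lipRe : lipschitz_ae U mu A (fun g => complex.Re (f1 g)).
  move=> u Uu; have := daeA u Uu; apply: filterS => g; apply: le_trans.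
  by rewrite -difference_Re normr_Re_le.
have lipIm : lipschitz_ae U mu A (fun g => complex.Im (f1 g)).
  move=> u Uu; have := daeA u Uu; apply: filterS => g; apply: le_trans.
  by rewrite -difference_Im normr_Im_le.
have aeRe : {ae mu, forall g : B, (`|complex.Re (f1 g)| <= M)%R}.
  by apply: filterS fae => g; apply: le_trans; exact: normr_Re_le.
have aeIm : {ae mu, forall g : B, (`|complex.Im (f1 g)| <= M)%R}.
  by apply: filterS fae => g; apply: le_trans; exact: normr_Im_le.
have mN2 := measurable_normc_EFin (conj mr2 mi2).
have iN : mu.-integrable setT (fun g : B => (Normc.normc (f2 g))%:E).
  apply/integrableP; split => //; under eq_integral do rewrite gee0_abs ?lee_fin ?normc_ge0//.
  by rewrite -Lp_norm1.
have iRe : mu.-integrable setT (fun g : B => (complex.Re (f2 g))%:E).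
  apply: le_integrable iN => //; first exact/measurable_EFinP.
  by move=> x _; rewrite !abse_EFin lee_fin (le_trans (normr_Re_le _))// ler_norm.
have iIm : mu.-integrable setT (fun g : B => (complex.Im (f2 g))%:E).
  apply: le_integrable iN => //; first exact/measurable_EFinP.
  by move=> x _; rewrite !abse_EFin lee_fin (le_trans (normr_Im_le _))// ler_norm.
have md u : cmeasurable (difference u f2).
  split.
    under eq_fun do rewrite difference_Re; apply: measurable_funB => //.
    exact: (measurableT_comp mr2 (measurable_mulgl (u^-1)%g)).
  under eq_fun do rewrite difference_Im; apply: measurable_funB => //.
  exact: (measurableT_comp mi2 (measurable_mulgl (u^-1)%g)).
have dD u : U u -> \int[mu]_g (Normc.normc (difference u f2 g))%:E <= D%:E.
  by move=> Uu; rewrite -Lp_norm1 -DE; apply: ereal_sup_ubound; exists u.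
have l1Re u : U u -> l1_diff mu (fun g => complex.Re (f2 g)) u <= D%:E.
  move=> Uu; apply: le_trans (dD u Uu); apply: ge0_le_integral => //.
  - by apply: measurableT_comp => //; apply/measurable_EFinP; exact: measurable_diff.
  - exact: measurable_normc_EFin.
  - by move=> g _; rewrite abse_EFin lee_fin -difference_Re normr_Re_le.
have l1Im u : U u -> l1_diff mu (fun g => complex.Im (f2 g)) u <= D%:E.
  move=> Uu; apply: le_trans (dD u Uu); apply: ge0_le_integral => //.
  - by apply: measurableT_comp => //; apply/measurable_EFinP; exact: measurable_diff.
  - exact: measurable_normc_EFin.
  - by move=> g _; rewrite abse_EFin lee_fin -difference_Im normr_Im_le.
pose P (a b : G -> R) g : R := ((a g - convolution mu K a g) * b g)%R.
pose r1 g := complex.Re (f1 g); pose i1 g := complex.Im (f1 g).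
pose r2 g := complex.Re (f2 g); pose i2 g := complex.Im (f2 g).
have irr : mu.-integrable setT (EFin \o (P r1 r2 : B -> R)) := integrable_sub_mul mr1 aeRe iRe.
have iii : mu.-integrable setT (EFin \o (P i1 i2 : B -> R)) := integrable_sub_mul mi1 aeIm iIm.
have iir : mu.-integrable setT (EFin \o (P i1 r2 : B -> R)) := integrable_sub_mul mi1 aeIm iRe.
have iri : mu.-integrable setT (EFin \o (P r1 i2 : B -> R)) := integrable_sub_mul mr1 aeRe iIm.
have bnd (a b : G -> R) : mu.-integrable setT (EFin \o (P a b : B -> R)) ->
    `|\int[mu]_g (P a b g)%:E| <= (C * (A * D))%:E ->
    (`|\int[mu]_g (P a b g)| <= C * (A * D))%R.
  by move=> iP; rewrite -lee_fin -abse_EFin /Rintegral fineK//; exact: integrable_fin_num.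
have brr := bnd _ _ irr (real_pairing_le mean_le mr1 M0 aeRe A0 lipRe D0 iRe l1Re).
have bii := bnd _ _ iii (real_pairing_le mean_le mi1 M0 aeIm A0 lipIm D0 iIm l1Im).
have bir := bnd _ _ iir (real_pairing_le mean_le mi1 M0 aeIm A0 lipIm D0 iRe l1Re).
have bri := bnd _ _ iri (real_pairing_le mean_le mr1 M0 aeRe A0 lipRe D0 iIm l1Im).
have TRe g : complex.Re (T f1 g) = convolution mu K r1 g.
  by apply: eq_Rintegral => h _; rewrite ReZ.
have TIm g : complex.Im (T f1 g) = convolution mu K i1 g.
  by apply: eq_Rintegral => h _; rewrite ImZ.
have mulconj_Re (x y z : R[i]) : complex.Re ((x - y) * (z^*)%C)%R =
    ((complex.Re x - complex.Re y) * complex.Re z + (complex.Im x - complex.Im y) * complex.Im z)%R.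
  by case: x => ? ?; case: y => ? ?; case: z => ? ? /=; ring.
have mulconj_Im (x y z : R[i]) : complex.Im ((x - y) * (z^*)%C)%R =
    ((complex.Im x - complex.Im y) * complex.Re z - (complex.Re x - complex.Re y) * complex.Im z)%R.
  by case: x => ? ?; case: y => ? ?; case: z => ? ? /=; ring.
have pRe g : complex.Re ((f1 \- T f1)%R g * ((f2 g)^*)%C)%R = (P r1 r2 g + P i1 i2 g)%R.
  by rewrite /P -TRe -TIm; exact: mulconj_Re.
have pIm g : complex.Im ((f1 \- T f1)%R g * ((f2 g)^*)%C)%R = (P i1 r2 g - P r1 i2 g)%R.
  by rewrite /P -TRe -TIm; exact: mulconj_Im.
rewrite AE DE -!EFinM lee_fin; apply: le_trans (normc_le_ReIm _) _.
have -> : complex.Re (cpairing mu (f1 \- T f1)%R f2) =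
   (\int[mu]_g P r1 r2 g + \int[mu]_g P i1 i2 g)%R.
  by rewrite -RintegralD//; apply: eq_Rintegral => g _; exact: pRe.
have -> : complex.Im (cpairing mu (f1 \- T f1)%R f2) =
   (\int[mu]_g P i1 r2 g - \int[mu]_g P r1 i2 g)%R.
  by rewrite -RintegralB//; apply: eq_Rintegral => g _; exact: pIm.
apply: le_trans (lerD (ler_normD _ _) (ler_normB _ _)) _.
have AD0 := mulr_ge0 A0 D0.
apply: le_trans (lerD (lerD brr bii) (lerD bir bri)) _.
by rewrite -mulrA mulrDl mul1r; lra.
Qed.

End Pairing.

(** * The three estimates for a centered density *)

Theorem theorem1p17 (R : realType) (G : topologicalGroupType)
    (hG_hausdorff : hausdorff_space G)
    (hG_loc_compact : locally_compact [set: G])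
    (hG_compactly_generated : compactly_generated G)
    (mu : {measure set (borel G) -> \bar R}) (hmu : left_haar_measure mu)
    (Delta : G -> R) (hDelta : modular_function mu Delta)
    (U : set G) (hU : generating_nbhd U)
    (s : splitting R G)
    (K : G -> R) (hK : probability_density mu K) (hK_centered : centered mu s K)
    (hK_supp : compact (closure [set g | K g != 0]))
    (hK_bounded : exists B : R, forall g, K g <= B)
    (hK_lower : exists2 W : set G, generating_nbhd W & 0 < inf [set K g | g in W]) :
  let T := conv_op mu K in
  [/\ exists2 c : R, 0 < c &
        forall f1 f2 : G -> R[i], in_Lp mu +oo f1 -> in_Lp mu 1 f2 ->
          ((Normc.normc (cpairing mu (f1 \- T f1) f2))%:E
             <= c%:E * Gamma mu U +oo f1 * Gamma mu U 1 f2)%E,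
      (exists2 omega : R, 0 < omega &
        forall (n : nat) (lambda : R) (psi : G -> R),
          (0 < n)%N -> weight_class mu U psi ->
          (opnorm mu 2%:E 2%:E
             (fun f => mult_op (fun g => expR (lambda * psi g))
                (iter n T (mult_op (fun g => expR (- lambda * psi g)) f)))
             <= (expR (omega * lambda ^+ 2 * n%:R))%:E)%E)
      /\
      (forall p : R, 1 < p ->
        exists c b : R, [/\ 0 < c, 0 < b &
          forall (n : nat) (E F : set G), (0 < n)%N ->
            measurable (E : set (borel G)) -> measurable (F : set (borel G)) ->
            (opnorm mu p%:E p%:E
               (fun f => mult_op \1_E (iter n T (mult_op \1_F f)))
               <= c%:E * gaussian b n (set_dist R U E F))%E])
    & exists c b : R, [/\ 0 < c, 0 < b &
        forall (n : nat) (g : G), (0 < n)%N ->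
          ((conv_power mu K n g)%:E
             <= (c * Delta g `^ (- 2^-1))%:E * gaussian b n (rho R U g))%E]].
Proof.
move=> T.
have [mK K0 K1] := hK.
(* The compact support lies in a single power of U; its exponent n0 + 1 is the m of the preceding
   sections and is positive, as the Gaussian bound requires. *)
have [n0 supp] := compact_set_pow hU hK_supp.
have Km g : K g != 0 -> set_pow U n0.+1 g by move=> Kg; apply: supp; exact: subset_closure.
have [W hW kappa0] := hK_lower.
have kappaW g : W g -> inf [set K g | g in W] <= K g.
  move=> Wg; apply: ge_inf; last by exists g.
  by exists 0 => _ [x _ <-].
have [KB hKB] := hK_bounded.
(* The bounds for K and Delta are raised to at least 1, since the Gaussian bound takes KB > 0 and D
   >= 1. *)
have hKB1 g : K g <= Num.max KB 1 by rewrite le_max hKB.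
have KB0 : 0 < Num.max KB 1 by rewrite lt_max ltr01 orbT.
have cDelta : continuous Delta by case: hDelta.
have [D hD] := compact_norm_bounded hK_supp cDelta.
have D1 : 1 <= Num.max D 1 by rewrite le_max lexx orbT.
have hD1 g : K g != 0 -> Delta g <= Num.max D 1.
  move=> Kg; rewrite le_max (le_trans (ler_norm _))// hD//.
  exact: subset_closure.
have [omega omega0 hw] := weighted_avgn_l2 hG_hausdorff hU hmu hDelta mK K0 K1 hK_centered
  Km hW kappa0 kappaW.
split.
- have [C C0 hC] := mean_pair_diff hG_hausdorff hU hmu mK K0 K1 hK_centered Km.
  exists (4 * C + 1); first by rewrite ltr_wpDl// mulr_ge0.
  move=> f1 f2; apply: (cpairing_le hG_hausdorff hU hmu hDelta (mK := mK) K0 K1 (C := C)) => phi psi A B.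
  by move=> A0 B0 iphi hphi mpsi hpsi; case: (hC phi psi A B A0 B0 iphi hphi mpsi hpsi).
- split.
    exists omega => // n lambda psi _ hpsi.
    exact: (weighted_opnorm_le hG_hausdorff hU hmu hDelta K0 K1 omega0 hw).
  move=> p p1; exact: (off_diagonal hG_hausdorff hU hmu hDelta K0 K1 omega0 hw).
- exact: (gaussian_bound hG_hausdorff hU hmu hDelta K0 K1 omega0 hw _ Km KB0 D1 hKB1 hD1).
Qed.
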